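(* Let $C_0$ be a smooth quasi-projective curve contained in a smooth projective curve $C$. Let $\rho:\pi_1(C_0)\to\mathrm{Aut}(\mathbb H)\simeq\mathrm{Aut}(\mathbb D)$ be a morphism. Then there exists at most one $\rho$-equivariant and non-constant holomorphic function $f:\widetilde{C_0}\to\mathbb H\simeq\mathbb D$, where $\widetilde{C_0}$ is the universal cover of $C_0$.
   Context: Curves are complex and connected (so $C_0$ is the complement of finitely many points in $C$). $\mathbb H$ is the upper half-plane and $\mathbb D$ the unit disc. A map $f:\widetilde{C_0}\to\mathbb H$ is $\rho$-equivariant if $f(\gamma\cdot x)=\rho(\gamma)(f(x))$ for all $\gamma\in\pi_1(C_0)$ (acting by deck transformations) and $x\in\widetilde{C_0}$. *)

(* Defs.v *)
From HB Require Import structures.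
From mathcomp Require Import all_boot all_order all_algebra.
From mathcomp Require mpoly.
From mathcomp Require Import complex.
From mathcomp Require Import all_classical all_reals all_analysis.

Set Implicit Arguments.
Unset Strict Implicit.
Unset Printing Implicit Defensive.

Import Order.TTheory GRing.Theory Num.Theory numFieldNormedType.Exports.

Local Open Scope classical_set_scope.
Local Open Scope ring_scope.
Local Open Scope complex_scope.

(* The complex numbers, with the norm topology and as a normed space over
   themselves, so that [derivable g z 1] is complex differentiability. *)
Notation Cplx R := (R[i]^o) (only parsing).

Section Holomorphy.
Context {R : realType}.

(* Only meaningful when [A] is open. *)
Definition holomorphic_on (A : set (Cplx R)) (g : Cplx R -> Cplx R) : Prop :=
  forall z, A z -> derivable g z 1.

Definition upper_half_plane : set (Cplx R) := [set z | 0 < complex.Im z].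

(* Automorphisms of the upper half-plane are represented by functions on the
   whole of C; values outside the half-plane are irrelevant. *)
Definition is_autH (phi : Cplx R -> Cplx R) : Prop :=
  exists psi : Cplx R -> Cplx R,
    [/\ holomorphic_on upper_half_plane phi,
        holomorphic_on upper_half_plane psi,
        (forall z, upper_half_plane z -> upper_half_plane (phi z)),
        (forall z, upper_half_plane z -> upper_half_plane (psi z)) &
        forall z, upper_half_plane z -> psi (phi z) = z /\ phi (psi z) = z].

Record autH := AutH {
  autH_fun :> Cplx R -> Cplx R;
  autHP : is_autH autH_fun }.

End Holomorphy.
Arguments autH : clear implicits.

Section RiemannSurface.
Context {R : realType}.

(* A homeomorphism [coord] from the open set [dom] onto the open subset
   [coord @` dom] of C, with inverse [coordV]. *)
Record chart (X : topologicalType) := Chart {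
  dom : set X;
  coord : X -> Cplx R;
  coordV : Cplx R -> X;
  dom_open : open dom;
  img_open : open (coord @` dom);
  coordK : forall x, dom x -> coordV (coord x) = x;
  coord_continuous : {within dom, continuous coord};
  coordV_continuous : {within coord @` dom, continuous coordV} }.

Record riemann_surface := RiemannSurface {
  carrier :> topologicalType;
  surface_hausdorff : hausdorff_space carrier;
  surface_connected : connected [set: carrier];
  atlas : set (chart carrier);
  atlas_cover : forall x, exists2 c, atlas c & dom c x;
  atlas_compat : forall c d, atlas c -> atlas d ->
    holomorphic_on (coord c @` (dom c `&` dom d)) (coord d \o coordV c) }.

Definition holomorphic_fun (X : riemann_surface) (U : set X) (f : X -> Cplx R)
    : Prop :=
  forall c : chart X, atlas c ->
    holomorphic_on (coord c @` (dom c `&` U)) (f \o coordV c).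

Definition holomorphic_map (X Y : riemann_surface) (p : X -> Y) : Prop :=
  continuous p /\
  forall (c : chart X) (d : chart Y), atlas c -> atlas d ->
    holomorphic_on (coord c @` (dom c `&` p @^-1` dom d))
                   (coord d \o p \o coordV c).

End RiemannSurface.
Arguments riemann_surface : clear implicits.

Section ProjectiveCurve.
Context {R : realType}.

(* The point of P^n(C) with homogeneous coordinates [v] (for [v != 0]), seen
   as the line spanned by [v]. *)
Definition proj_point n (v : 'rV[R[i]]_n.+1) : set 'rV[R[i]]_n.+1 :=
  [set a *: v | a in [set: R[i]]].

Definition homogeneous n (d : nat) (q : mpoly.mpoly n R[i]) : Prop :=
  forall m, mpoly.mcoeff m q != 0 -> mpoly.mdeg m = d.

Definition proj_zero_locus n (I : set (mpoly.mpoly n.+1 R[i])) :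
    set (set 'rV[R[i]]_n.+1) :=
  [set L | exists v : 'rV[R[i]]_n.+1,
     [/\ v != 0, L = proj_point v &
         forall q, I q -> mpoly.meval (fun j => v 0 j) q = 0]].

(* [phi] is holomorphic if it locally has holomorphic homogeneous coordinates
   [F]; it is moreover immersive at [x] iff the derivative of [F] at [x] in a
   local coordinate is not proportional to [F x]. *)
Definition holomorphic_immersion_at (X : riemann_surface R) n
    (phi : X -> set 'rV[R[i]]_n.+1) (x : X) : Prop :=
  exists (U : set X) (F : X -> 'rV[R[i]]_n.+1),
    [/\ open U, U x,
        (forall y, U y -> F y != 0 /\ phi y = proj_point (F y)),
        (forall j, holomorphic_fun U (fun y => F y 0 j : Cplx R)) &
        forall c : chart X, atlas c -> dom c x ->
          ~ exists a : R[i], forall j,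
              'D_1 ((fun y => F y 0 j : Cplx R) \o coordV c) (coord c x)
              = a * F x 0 j].

(* [X] is the analytic curve of a closed algebraic subset of P^n(C), smooth of
   dimension one. Since [X] is compact, the injective immersion [phi] is an
   embedding, so that its image, the zero locus of [I], is a submanifold. *)
Definition smooth_projective_curve (X : riemann_surface R) : Prop :=
  compact [set: X] /\
  exists (n : nat) (phi : X -> set 'rV[R[i]]_n.+1)
         (I : set (mpoly.mpoly n.+1 R[i])),
    [/\ (forall q, I q -> exists d, homogeneous d q),
        injective phi,
        range phi = proj_zero_locus I &
        forall x, holomorphic_immersion_at phi x].

End ProjectiveCurve.

Section Homotopy.
Context {R : realType}.

(* Paths are functions on R of which only the restriction to [0, 1] matters. *)
Definition path_in (X : topologicalType) (A : set X) (x y : X) (a : R -> X)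
    : Prop :=
  [/\ {within `[0, 1], continuous a},
      (forall t, 0 <= t <= 1 -> A (a t)), a 0 = x & a 1 = y].

Definition homotopic_in (X : topologicalType) (A : set X) (x y : X)
    (a b : R -> X) : Prop :=
  exists H : R * R -> X,
    [/\ {within `[0, 1] `*` `[0, 1], continuous H},
        (forall s t, 0 <= s <= 1 -> 0 <= t <= 1 -> A (H (s, t))),
        (forall t, 0 <= t <= 1 -> H (0, t) = a t /\ H (1, t) = b t) &
        forall s, 0 <= s <= 1 -> H (s, 0) = x /\ H (s, 1) = y].

Definition concat (X : Type) (a b : R -> X) (t : R) : X :=
  if t <= 2^-1 then a (2 * t) else b (2 * t - 1).

Definition homotopy_class (X : topologicalType) (A : set X) (x : X)
    (a : R -> X) : set (R -> X) :=
  [set b | path_in A x x b /\ homotopic_in A x x a b].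

Record pi1 (X : topologicalType) (A : set X) (x : X) := Pi1 {
  pi1_class :> set (R -> X);
  pi1P : exists2 a, path_in A x x a & pi1_class = homotopy_class A x a }.

Definition simply_connected (X : topologicalType) : Prop :=
  (forall x y : X, exists a, path_in [set: X] x y a) /\
  (forall (x : X) (a : R -> X), path_in [set: X] x x a ->
     homotopic_in [set: X] x x a (cst x)).

(* In [pi1] the product of the classes of [a] and [b] is the class of
   [concat a b], [a] being followed first. *)
Definition pi1_morphism (X : topologicalType) (A : set X) (x : X)
    (rho : pi1 A x -> autH R) : Prop :=
  forall (g h k : pi1 A x) (a b : R -> X),
    pi1_class g a -> pi1_class h b -> pi1_class k (concat a b) ->
    forall z, upper_half_plane z -> rho k z = rho g (rho h z).

End Homotopy.
Arguments pi1 R {X} A x.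
Arguments simply_connected R X : clear implicits.

Section UniversalCover.
Context {R : realType}.

(* A covering map of the subspace [A] of [Y]; [A] is meant to be open. *)
Definition covering_of (X Y : topologicalType) (A : set Y) (p : X -> Y)
    : Prop :=
  [/\ continuous p, range p = A &
      forall y, A y -> exists V : set Y, [/\ open V, V y, V `<=` A &
        exists S : set (set X),
          [/\ p @^-1` V = \bigcup_(W in S) W,
              trivIset S id &
              forall W, S W -> [/\ open W, set_bij W V p &
                forall W' : set X, open W' -> W' `<=` W -> open (p @` W')]]]].

Definition universal_cover (X Y : riemann_surface R) (A : set Y) (p : X -> Y)
    : Prop :=
  [/\ simply_connected R X, covering_of A p & holomorphic_map p].

Definition deck_transformation (X Y : topologicalType) (p : X -> Y)
    (g : X -> X) : Prop :=
  [/\ continuous g, (forall x, p (g x) = p x) &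
      exists h : X -> X, [/\ continuous h, cancel g h & cancel h g]].

(* The class [gam] acts by the deck transformation [g] which sends the base
   point [xt] above [x] to the end point of the lift from [xt] of a loop
   representing [gam]; with the order of [concat] this is a left action. *)
Definition acts_by (X Y : topologicalType) (A : set Y) (x : Y) (p : X -> Y)
    (xt : X) (gam : pi1 R A x) (g : X -> X) : Prop :=
  deck_transformation p g /\
  exists b : R -> X,
    path_in [set: X] xt (g xt) b /\ pi1_class gam (p \o b).

Definition equivariant (X Y : topologicalType) (A : set Y) (x : Y) (p : X -> Y)
    (xt : X) (rho : pi1 R A x -> autH R) (f : X -> Cplx R) : Prop :=
  forall (gam : pi1 R A x) (g : X -> X), acts_by p xt gam g ->
    forall u, f (g u) = rho gam (f u).

Definition nonconstant (X Y : Type) (f : X -> Y) : Prop :=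
  exists u v, f u <> f v.

Definition equivariant_holomorphic_to_H (X Y : riemann_surface R) (A : set Y)
    (x : Y) (p : X -> Y) (xt : X) (rho : pi1 R A x -> autH R)
    (f : X -> Cplx R) : Prop :=
  [/\ (forall u, upper_half_plane (f u)),
      holomorphic_fun [set: X] f,
      nonconstant f &
      equivariant p xt rho f].

End UniversalCover.

(* Main.v *)
(* Let [v = 4 sinh^2(d(f1, f2)/2)], with [d] the hyperbolic distance of the
   half-plane. Both maps are equivariant for the same [rho], which acts by
   isometries, so [v] is constant on the fibres of [p], hence a function on the
   curve minus finitely many points. Around a point with images [a], [b], it is
   bounded below by the square modulus of a multiple of the holomorphic function
   [(f1 - f2) / ((f1 - conj a) (f2 - conj b))], with equality only where
   [f1 = a] and [f2 = b]: by the maximum principle, where [v] reaches a nonzero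
   local maximum both maps are locally constant.
   Near a puncture with coordinate [z], lifting the universal covering of the
   punctured disc and applying Schwarz-Pick gives [v = O(log^2(1/|z|))], so that
   [v^n |z|^2] tends to [0] for every [n]; the maximum principle bounds it by its
   maximum over a fixed circle, and letting [n] tend to infinity bounds [v]
   itself by its maximum over that circle. By compactness of the curve, [v] has a
   global maximum, so either [v = 0] or [f1] is constant. *)
Require Import Defs.
From mathcomp Require Import all_boot all_order all_algebra.
From mathcomp Require Import complex ring lra.
From mathcomp Require Import all_classical all_reals all_analysis.
Import Defs.
Import Order.TTheory GRing.Theory Num.Theory numFieldNormedType.Exports.
Set Implicit Arguments.
Unset Strict Implicit.
Unset Printing Implicit Defensive.
Local Open Scope classical_set_scope.
Local Open Scope ring_scope.
Local Open Scope complex_scope.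

(** * Goursat's theorem for squares *)

(** The exponent [n] makes up for a missing function. The natural barrier is [v |z|^e] with small
    [e], but [|z|^e] is not the modulus of a single-valued holomorphic function; [v^n |z|^2] is the
    [n]-th power of [v |z|^(2/n)], and its minorant, a power of a quotient times the coordinate, is
    holomorphic. The bound [log^2] arises because each of the two maps moves away from a fixed point
    at a speed that contributes one factor [log(1/|z|)], and the triangle inequality multiplies the
    two. The lift [Phi] of the covering of the punctured disc is obtained as a continuous map only,
    while its local inverses are visibly holomorphic. So the comparison with the hyperbolic distance
    is made on the surface by a maximum principle over an annulus, and yields a distance bound that
    is weaker than Schwarz-Pick by a constant factor, which is enough for the growth. All maximum
    principles come from one mean value property, derived from Goursat's theorem in a logarithmic
    coordinate. It tolerates one point where only continuity is known, so difference quotients can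
    be filled in at their centre. *)

Section Bisection.
Context {R : realType}.

(** Nested squares: if [P] failed, it would fail on a sequence of quarters shrinking to a point,
    against the local hypothesis there. [P x y l] speaks of the square with lower left corner
    [(x, y)] and side [l]. Serves both for Goursat's estimate and for lifting squares through a
    covering. *)
Lemma square_bisection (P : R -> R -> R -> Prop) (x0 y0 l0 : R) :
  0 < l0 ->
  (forall x y l, x0 <= x -> x + l <= x0 + l0 -> y0 <= y -> y + l <= y0 + l0 ->
     0 < l -> P x y (l / 2) -> P (x + l / 2) y (l / 2) ->
     P x (y + l / 2) (l / 2) -> P (x + l / 2) (y + l / 2) (l / 2) -> P x y l) ->
  (forall x y, x0 <= x <= x0 + l0 -> y0 <= y <= y0 + l0 ->
     exists2 d : R, 0 < d & forall x' y' l : R, 0 < l < d ->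
       x0 <= x' -> x' + l <= x0 + l0 -> y0 <= y' -> y' + l <= y0 + l0 ->
       x' <= x <= x' + l -> y' <= y <= y' + l -> P x' y' l) ->
  P x0 y0 l0.
Proof.
move=> l0_gt0 split_ loc; apply: contrapT => nP0.
pose inb (q : R * R * R) := [/\ x0 <= q.1.1, q.1.1 + q.2 <= x0 + l0,
  y0 <= q.1.2, q.1.2 + q.2 <= y0 + l0 & 0 < q.2].
pose bad q := inb q /\ ~ P q.1.1 q.1.2 q.2.
(* A bad square has a bad quarter. For other [q] the witness is a dummy, so that [step] is total. *)
have stepE q : exists q', bad q -> [/\ bad q', q'.2 = q.2 / 2,
    q.1.1 <= q'.1.1 & q'.1.1 + q'.2 <= q.1.1 + q.2] /\
    (q.1.2 <= q'.1.2 /\ q'.1.2 + q'.2 <= q.1.2 + q.2).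
  have [bq|nbq] := pselect (bad q); last by exists q.
  move: q bq => [[x y] l] [] [/= h1 h2 h3 h4 h5] nP.
  have [p1|p1] := pselect (P x y (l / 2)); last first.
    by exists (x, y, l / 2) => _; split; split => //=; try lra; split=> //; split => //=; lra.
  have [p2|p2] := pselect (P (x + l / 2) y (l / 2)); last first.
    by exists (x + l / 2, y, l / 2) => _; split; split => //=; try lra; split=> //; split => //=; lra.
  have [p3|p3] := pselect (P x (y + l / 2) (l / 2)); last first.
    by exists (x, y + l / 2, l / 2) => _; split; split => //=; try lra; split=> //; split => //=; lra.
  have [p4|p4] := pselect (P (x + l / 2) (y + l / 2) (l / 2)); last first.
    by exists (x + l / 2, y + l / 2, l / 2) => _; split; split => //=; try lra; split=> //; split => //=; lra.
  by case: nP; apply: split_.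
have [step stepP] := choice stepE.
pose s n := iter n step (x0, y0, l0).
have sS n : s n.+1 = step (s n) by [].
have bads n : bad (s n).
  elim: n => [|n IH]; first by split => //; split => /=; lra.
  by have [[]] := stepP _ IH.
have ls n : (s n).2 = l0 / 2 ^+ n.
  elim: n => [|n IH]; first by rewrite expr0 divr1.
  have [[_ e _ _] _] := stepP _ (bads n).
  by rewrite sS e IH exprSr invfM mulrA.
have mono1 n m : (n <= m)%N -> (s n).1.1 <= (s m).1.1 /\
    (s m).1.1 + (s m).2 <= (s n).1.1 + (s n).2.
  move=> /subnKC <-; elim: (m - n)%N => [|k [IH1 IH2]]; first by rewrite addn0.
  have [[_ _ h1 h2] _] := stepP _ (bads (n + k)).
  by rewrite addnS sS; split; lra.
have mono2 n m : (n <= m)%N -> (s n).1.2 <= (s m).1.2 /\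
    (s m).1.2 + (s m).2 <= (s n).1.2 + (s n).2.
  move=> /subnKC <-; elim: (m - n)%N => [|k [IH1 IH2]]; first by rewrite addn0.
  have [_ [h1 h2]] := stepP _ (bads (n + k)).
  by rewrite addnS sS; split; lra.
(* Stated for one coordinate and applied to both: the supremum of the left ends lies in all the
   nested intervals. *)
have lim (u : nat -> R) : (forall n m, (n <= m)%N -> u n <= u m /\
    u m + (s m).2 <= u n + (s n).2) -> exists X, forall n, u n <= X <= u n + (s n).2.
  move=> mono; exists (sup (range u)) => n.
  have ub m : u m <= u n + (s n).2.
    have l_ge0 k : 0 < (s k).2 by have [[]] := bads k.
    have [nm|mn] := leqP n m.
      by have [_] := mono _ _ nm; have := l_ge0 m; lra.
    by have [] := mono _ _ (ltnW mn); have := l_ge0 n; lra.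
  have hub : ubound (range u) (u n + (s n).2) by move=> _ [m _ <-].
  apply/andP; split; last by apply: ge_sup => //; exists (u n), n.
  by apply: ub_le_sup; [exists (u n + (s n).2)|exists n].
have [X hX] := lim _ mono1; have [Y hY] := lim _ mono2.
have [d d_gt0 hd] : exists2 d : R, 0 < d & forall x' y' l : R, 0 < l < d ->
       x0 <= x' -> x' + l <= x0 + l0 -> y0 <= y' -> y' + l <= y0 + l0 ->
       x' <= X <= x' + l -> y' <= Y <= y' + l -> P x' y' l.
  by apply: loc; [have := hX 0%N|have := hY 0%N]; rewrite ls expr0 divr1.
have [n hn] : exists n, l0 / 2 ^+ n < d.
  exists (Num.truncn (l0 / d)).+1.
  rewrite ltr_pdivrMr ?exprn_gt0// mulrC -ltr_pdivrMr//.
  apply: (lt_trans (Num.Theory.truncnS_gt _)).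
  by rewrite -natrX ltr_nat ltn_expl.
have [[h1 h2 h3 h4 h5] nP] := bads n.
by apply: nP; apply: hd => //; rewrite h5 ls.
Qed.

End Bisection.

Section Goursat.
Context {R : realType}.
Implicit Types (f g : R -> R) (U V : R -> R -> R).

(** Only differences of values at points to the right of [a] are meaningful. The base point is kept
    strictly to the left of the interval of interest, so that the derivative is two-sided even at
    its left end. *)
Definition primitive f (a x : R) : R :=
  \int[@lebesgue_measure R]_(t in `[a, x]) f t.

Lemma is_derive_primitive f (a x : R) : continuous f -> a < x ->
  is_derive x 1 (primitive f a) (f x).
Proof.
move=> cf ax; have x1 : x < x + 1 by lra.
have [d1 d2] : derivable (primitive f a) x 1 /\ (primitive f a)^`()%classic x = f x.
  apply: (@continuous_FTC1_closed R f a x (x + 1) x1 _ ax (cf x)).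
  apply: continuous_compact_integrable; first exact: segment_compact.
  by apply: continuous_subspaceT.
by rewrite -d2 derive1E; apply/derivableP.
Qed.

(** The mean value theorem for the difference evaluates the integrals over two opposite sides of a
    square at a common parameter [t], which is what lets the linear terms cancel in Goursat's
    estimate. *)
Lemma primitive_sub_MVT f g (a b c : R) : continuous f -> continuous g ->
  a < b -> b < c ->
  exists2 t, b < t < c &
    (primitive f a c - primitive f a b) - (primitive g a c - primitive g a b) =
    (f t - g t) * (c - b).
Proof.
move=> cf cg ab bc.
have dfg x : b <= x -> is_derive x 1 (primitive f a - primitive g a) (f x - g x).
  by move=> bx; apply: is_deriveB; apply: is_derive_primitive => //; lra.
have [x||t tbc e] := @MVT R (primitive f a - primitive g a) (f - g) b c bc.
- by rewrite in_itv/= => /andP[bx xc]; apply: dfg; lra.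
- apply: derivable_within_continuous => x; rewrite in_itv/= => /andP[bx xc].
  by have [] := dfg _ bx.
by rewrite in_itv/= in tbc; exists t => //; rewrite -e !fctE; lra.
Qed.

Lemma primitive_MVT f (a b c : R) : continuous f -> a < b -> b < c ->
  exists2 t, b < t < c & primitive f a c - primitive f a b = f t * (c - b).
Proof.
move=> cf ab bc.
have dfx x : b <= x -> is_derive x 1 (primitive f a) (f x).
  by move=> bx; apply: is_derive_primitive => //; lra.
have [x||t tbc e] := @MVT R (primitive f a) f b c bc.
- by rewrite in_itv/= => /andP[bx xc]; apply: dfx; lra.
- apply: derivable_within_continuous => x; rewrite in_itv/= => /andP[bx xc].
  by have [] := dfx _ bx.
by rewrite in_itv/= in tbc; exists t.
Qed.

(** The imaginary part of the integral of [(U + iV) dz] along the boundary of the square, that is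
    the counterclockwise circulation of [V dx + U dy]. *)
Definition square_circulation U V (a b x y l : R) : R :=
  (primitive (U (x + l)) b (y + l) - primitive (U (x + l)) b y)
  - (primitive (U x) b (y + l) - primitive (U x) b y)
  + (primitive (V ^~ y) a (x + l) - primitive (V ^~ y) a x)
  - (primitive (V ^~ (y + l)) a (x + l) - primitive (V ^~ (y + l)) a x).

Lemma square_circulation_split U V (a b x y l : R) :
  square_circulation U V a b x y l =
  square_circulation U V a b x y (l / 2) +
  square_circulation U V a b (x + l / 2) y (l / 2) +
  square_circulation U V a b x (y + l / 2) (l / 2) +
  square_circulation U V a b (x + l / 2) (y + l / 2) (l / 2).
Proof.
rewrite /square_circulation.
have e z : z + l / 2 + l / 2 = z + l by lra.
by rewrite !e; ring.
Qed.

(* [U + iV] is complex differentiable on the closed square: [al], [be] are the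
   real and imaginary parts of its derivative. *)
Lemma goursat_square U V (a b x0 y0 l0 : R) :
  0 < l0 -> a < x0 -> b < y0 ->
  (forall x, continuous (U x)) -> (forall y, continuous (V ^~ y)) ->
  (forall x y, x0 <= x <= x0 + l0 -> y0 <= y <= y0 + l0 ->
    exists al be : R, forall e : R, 0 < e -> exists2 d : R, 0 < d &
      forall x' y' : R, x0 <= x' <= x0 + l0 -> y0 <= y' <= y0 + l0 ->
        `|x' - x| < d -> `|y' - y| < d ->
        `|U x' y' - U x y - al * (x' - x) + be * (y' - y)|
          <= e * (`|x' - x| + `|y' - y|) /\
        `|V x' y' - V x y - be * (x' - x) - al * (y' - y)|
          <= e * (`|x' - x| + `|y' - y|)) ->
  square_circulation U V a b x0 y0 l0 = 0.
Proof.
move=> l0_gt0 ax0 by0 cU cV diff.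
(* A bound proportional to the area is inherited from the four quarters, whose circulations add
   up. *)
have small (eta : R) : 0 < eta -> `|square_circulation U V a b x0 y0 l0| <= eta * l0 ^+ 2.
  move=> eta_gt0.
  apply: (@square_bisection R
    (fun x y l => `|square_circulation U V a b x y l| <= eta * l ^+ 2)) => //.
    move=> x y l _ _ _ _ l_gt0 p1 p2 p3 p4; rewrite square_circulation_split.
    have -> : eta * l ^+ 2 = eta * (l / 2) ^+ 2 + eta * (l / 2) ^+ 2 +
      eta * (l / 2) ^+ 2 + eta * (l / 2) ^+ 2 by field.
    by do 3 (apply: (le_trans (ler_normD _ _)); apply: lerD => //).
  (* By Cauchy-Riemann the affine parts contribute [al * l] on the vertical sides and [- al * l] on
     the horizontal ones. Each of the four evaluations errs by at most [eta / 8 * (l + l)], and the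
     four errors add up to [eta * l]. *)
  move=> x y hx hy; have [al [be]] := diff _ _ hx hy.
  move=> /(_ (eta / 8)) [|d d_gt0 hd]; first by lra.
  exists d => // x' y' l /andP[l_gt0 ld] h1 h2 h3 h4 hx' hy'.
  have ax' : a < x' by exact: lt_le_trans h1.
  have by' : b < y' by exact: lt_le_trans h3.
  have ly' : y' < y' + l by rewrite ltrDl.
  have lx' : x' < x' + l by rewrite ltrDl.
  have [t1 /andP[t11 t12] e1] := primitive_sub_MVT (cU (x' + l)) (cU x') by' ly'.
  have [t2 /andP[t21 t22] e2] := primitive_sub_MVT (cV y') (cV (y' + l)) ax' lx'.
  rewrite /square_circulation e1 -addrA e2.
  have dx z : x' <= z <= x' + l -> `|z - x| <= l.
    move: hx'; clear => /andP[? ?] /andP[? ?].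
    by rewrite ler_norml; apply/andP; split; lra.
  have dy z : y' <= z <= y' + l -> `|z - y| <= l.
    move: hy'; clear => /andP[? ?] /andP[? ?].
    by rewrite ler_norml; apply/andP; split; lra.
  have key u v : x' <= u <= x' + l -> y' <= v <= y' + l ->
      `|U u v - U x y - al * (u - x) + be * (v - y)| <= eta / 4 * l /\
      `|V u v - V x y - be * (u - x) - al * (v - y)| <= eta / 4 * l.
    move=> hu hv; have := hd u v; have dxu := dx _ hu; have dyv := dy _ hv.
    case.
    - by move: hu h1 h2; clear; move=> /andP[? ?] ? ?; apply/andP; split; lra.
    - by move: hv h3 h4; clear; move=> /andP[? ?] ? ?; apply/andP; split; lra.
    - exact: le_lt_trans ld.
    - exact: le_lt_trans ld.
    move=> k1 k2.
    have h : eta / 8 * (`|u - x| + `|v - y|) <= eta / 4 * l.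
      have -> : eta / 4 * l = eta / 8 * (l + l) by clear; field.
      by rewrite ler_pM2l ?lerD// divr_gt0.
    by split; apply: le_trans h.
  have [lex ley] : x' <= x' <= x' + l /\ y' <= y' <= y' + l.
    by rewrite !lexx !lerDl ltW.
  have [lex2 ley2] : x' <= x' + l <= x' + l /\ y' <= y' + l <= y' + l.
    by rewrite !lexx !lerDl ltW.
  have ht1 : y' <= t1 <= y' + l by rewrite !ltW.
  have ht2 : x' <= t2 <= x' + l by rewrite !ltW.
  have [[k1 _] [k2 _]] := (key _ _ lex2 ht1, key _ _ lex ht1).
  have [[_ k3] [_ k4]] := (key _ _ ht2 ley, key _ _ ht2 ley2).
  have -> : y' + l - y' = l by rewrite addrC addKr.
  have -> : x' + l - x' = l by rewrite addrC addKr.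
  rewrite -mulrDl normrM (gtr0_norm l_gt0) expr2 mulrA ler_pM2r//.
  move: k1 k2 k3 k4; rewrite !ler_norml => k1 k2 k3 k4.
  move: k1 k2 k3 k4; clear => /andP[? ?] /andP[? ?] /andP[? ?] /andP[? ?].
  by apply/andP; split; lra.
apply/eqP; rewrite -normr_eq0 eq_le normr_ge0 andbT.
apply/ler_addgt0Pr => e e_gt0; rewrite add0r.
have -> : e = e / l0 ^+ 2 * l0 ^+ 2 by rewrite divfK// gt_eqF// exprn_gt0.
by apply: small; rewrite divr_gt0// exprn_gt0.
Qed.

End Goursat.

(** * Complex differentiable functions *)

(* Stated over an abstract source so that the neighbourhood filter of a point
   is not unfolded by unification when the source is itself [K^o]. *)
Section ContinuityAt.
Context {K : numFieldType} {T : topologicalType}.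
Implicit Types (f g : T -> K^o) (x : T).

Lemma cont_cst (c : K^o) x : {for x, continuous (fun _ : T => c)}.
Proof. exact: cst_continuous. Qed.

Lemma contD f g x : {for x, continuous f} -> {for x, continuous g} ->
  {for x, continuous (fun y => f y + g y)}.
Proof. exact: cvgD. Qed.

Lemma contN f x : {for x, continuous f} -> {for x, continuous (fun y => - f y)}.
Proof. exact: cvgN. Qed.

Lemma contM f g x : {for x, continuous f} -> {for x, continuous g} ->
  {for x, continuous (fun y => f y * g y)}.
Proof. exact: cvgM. Qed.

Lemma contX f n x : {for x, continuous f} -> {for x, continuous (fun y => f y ^+ n)}.
Proof.
move=> cf; elim: n => [|n IH]; first exact: cont_cst.
have -> : (fun y => f y ^+ n.+1) = (fun y => f y * f y ^+ n).
  by apply/funext => y; rewrite exprS.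
exact: contM.
Qed.

Lemma contV f x : f x != 0 -> {for x, continuous f} ->
  {for x, continuous (fun y => (f y)^-1)}.
Proof. by move=> fx0 cf; exact: cvgV. Qed.

Lemma cont_neq0 f x : f x != 0 -> {for x, continuous f} ->
  \forall y \near x, f y != 0.
Proof. by move=> fx0 cf; apply: cvgr_neq0 cf fx0. Qed.

Lemma cont_comp (U V : topologicalType) (f : T -> U) (g : U -> V) x :
  {for x, continuous f} -> {for f x, continuous g} ->
  {for x, continuous (fun y => g (f y))}.
Proof. exact: continuous_comp. Qed.

Lemma near_cont (U : topologicalType) (f : T -> U) x (B : set U) :
  {for x, continuous f} -> nbhs (f x) B -> \forall y \near x, B (f y).
Proof. by move=> cf Bx; exact: cf Bx. Qed.

Lemma cont_near (U : topologicalType) (f g : T -> U) x :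
  (\forall y \near x, f y = g y) -> {for x, continuous f} -> {for x, continuous g}.
Proof.
move=> fg; rewrite /prop_for /continuous_at -(nbhs_singleton fg) => cf.
by apply: cvg_trans cf; apply: near_eq_cvg.
Qed.

End ContinuityAt.

Section ComplexDifferentiability.
Context {K : numFieldType}.
Local Notation C := (K^o).
Implicit Types (f g : C -> C) (z w : C).

(** Caratheodory's form of complex differentiability: the rules for products, composites and
    inverses become statements on the continuity of the slope [q]. It is local, unlike the slope
    given by [derivable_slope]. *)
Definition cdiff g z : Prop :=
  exists2 q : C -> C, {for z, continuous q} &
    \forall w \near z, g w = g z + q w * (w - z).

(** The slope is the difference quotient, filled in at [z] by the derivative. The identity holds for
    every [w]: in the Schwarz-Pick lemma this slope is used on the whole half-plane. *)
Lemma derivable_slope g z : derivable g z 1 ->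
  exists q : C -> C, [/\ {for z, continuous q}, q z = 'D_1 g z &
    forall w, g w = g z + q w * (w - z)].
Proof.
move=> dg; have hd : h^-1 *: (g (h *: 1 + z) - g z) @[h --> 0^'] --> 'D_1 g z by [].
set d := 'D_1 g z in hd *.
exists (fun w => if w == z then d else (g w - g z) / (w - z)); split.
- apply/(@cvgrPdist_lt _ C _ (nbhs z) (nbhs_filter z)) => e e_gt0; rewrite eqxx.
  move/cvgrPdist_lt/(_ _ e_gt0): hd => /nbhs_ballP[r /= r_gt0 hr].
  apply/nbhs_ballP; exists r => // w zw; case: eqVneq => [_|wz].
    by rewrite subrr normr0.
  have := hr (w - z); rewrite -ball_normE/= sub0r normrN.
  rewrite -ball_normE/= distrC in zw.
  by rewrite subr_eq0 => /(_ zw wz); rewrite [(w - z) *: 1]mulr1 subrK [_ *: _]mulrC.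
- by rewrite eqxx.
move=> w; case: eqVneq => [->|wz]; first by rewrite subrr mulr0 addr0.
by rewrite divfK ?subr_eq0// addrC subrK.
Qed.

Lemma derivable_cdiff g z : derivable g z 1 -> cdiff g z.
Proof.
by move=> /derivable_slope[q [cq _ hq]]; exists q => //; apply: filterE.
Qed.

Lemma cdiff_continuous g z : cdiff g z -> {for z, continuous g}.
Proof.
move=> [q cq hq].
apply: (@cont_near C C (fun w => g z + q w * (w - z))).
  by move: hq; apply: filterS => w ->.
apply: contD; first exact: cont_cst.
apply: contM => //; apply: contD; last exact: cont_cst.
exact: cvg_id.
Qed.

Lemma cdiff_cst (c z : C) : cdiff (fun=> c) z.
Proof.
exists (fun=> 0); first exact: cont_cst.
by apply: filterE => w; rewrite mul0r addr0.
Qed.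

Lemma cdiff_id z : cdiff id z.
Proof.
exists (fun=> 1); first exact: cont_cst.
by apply: filterE => w; rewrite mul1r addrC subrK.
Qed.

Lemma cdiffD f g z : cdiff f z -> cdiff g z -> cdiff (fun w => f w + g w) z.
Proof.
move=> [p cp hp] [q cq hq]; exists (fun w => p w + q w); first exact: contD.
by move: hp hq; apply: filterS2 => w -> ->; ring.
Qed.

Lemma cdiffM f g z : cdiff f z -> cdiff g z -> cdiff (fun w => f w * g w) z.
Proof.
move=> df dg; have cg := cdiff_continuous dg.
move: df dg => [p cp hp] [q cq hq].
exists (fun w => p w * g w + f z * q w).
  by apply: contD; apply: contM => //; exact: cont_cst.
by move: hp hq; apply: filterS2 => w hf hg; rewrite hf hg; ring.
Qed.

Lemma cdiffN f z : cdiff f z -> cdiff (fun w => - f w) z.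
Proof.
move=> /(cdiffM (cdiff_cst (-1) z)).
by under eq_fun do rewrite mulN1r.
Qed.

Lemma cdiffB f g z : cdiff f z -> cdiff g z -> cdiff (fun w => f w - g w) z.
Proof. by move=> df /cdiffN; apply: cdiffD. Qed.

Lemma cdiffV f z : f z != 0 -> cdiff f z -> cdiff (fun w => (f w)^-1) z.
Proof.
move=> fz0 df; have cf := cdiff_continuous df.
move: df => [p cp hp]; have nf0 := cont_neq0 fz0 cf.
exists (fun w => - p w * (f w)^-1 * (f z)^-1).
  apply: contM; last exact: cont_cst.
  by apply: contM; [exact: contN|exact: contV].
move: hp nf0; apply: filterS2 => w hf fw0.
have e : p w * (w - z) = f w - f z by rewrite hf addrAC subrr add0r.
transitivity ((f z)^-1 - (p w * (w - z)) * (f w)^-1 * (f z)^-1); last by ring.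
by rewrite e; field; rewrite fz0 fw0.
Qed.

Lemma cdiffX f z n : cdiff f z -> cdiff (fun w => f w ^+ n) z.
Proof.
move=> df; elim: n => [|n IH]; first exact: cdiff_cst.
by under eq_fun do rewrite exprS; exact: cdiffM.
Qed.

Lemma cdiff_comp f g z : cdiff f z -> cdiff g (f z) -> cdiff (fun w => g (f w)) z.
Proof.
move=> df dg; have cf := cdiff_continuous df.
move: df dg => [p cp hp] [q cq hq].
exists (fun w => q (f w) * p w).
  by apply: contM => //; apply: (@continuous_comp _ _ _ f q z).
have := cf _ hq; rewrite nbhs_filterE => hq'.
by move: hp hq'; apply: filterS2 => w hf ->; rewrite [X in _ * (X - _)]hf; ring.
Qed.

Lemma cdiff_near f g z : (\forall w \near z, f w = g w) -> cdiff f z -> cdiff g z.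
Proof.
move=> fg [p cp hp]; exists p => //.
have e := nbhs_singleton fg.
by move: fg hp; apply: filterS2 => w; rewrite -e => <-.
Qed.

(** Once the inverse [f] is known to be continuous, its slope is [1 / q (f z)]. Serves for the
    logarithm. *)
Lemma cdiff_inverse (g f : C -> C) (z0 : C) (q : C -> C) :
  {for z0, continuous f} -> {for f z0, continuous q} -> q (f z0) != 0 ->
  (\forall w \near f z0, g w = g (f z0) + q w * (w - f z0)) ->
  (\forall z \near z0, g (f z) = z) -> cdiff f z0.
Proof.
move=> cf cq q0 hq gf; have gf0 := nbhs_singleton gf.
have cqf : {for z0, continuous (fun z : C => q (f z) : C)}.
  by apply: (@continuous_comp _ _ _ f q z0).
exists (fun z => (q (f z))^-1); first exact: contV.
move: (near_cont cf hq) gf (cont_neq0 q0 cqf); apply: filterS3 => z.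
rewrite gf0 => h e n0.
have -> : z - z0 = q (f z) * (f z - f z0) by rewrite -{1}e h addrAC subrr add0r.
by rewrite mulKf// addrC subrK.
Qed.

End ComplexDifferentiability.

Section ComplexTopology.
Context {R : realType}.
Local Notation C := (R[i]^o).
Implicit Types (f g : C -> C) (z w : C).

(** The norm of [R[i]] takes its values in [R[i]], where the positive elements are the positive
    reals; this passes to real radii and to the real-valued modulus. *)
Lemma nbhsC z (A : set C) :
  nbhs z A <-> exists2 d : R, 0 < d & forall w : C, Normc.normc (w - z) < d -> A w.
Proof.
split.
  move=> /nbhs_ballP[e /= e_gt0 h].
  have [ree imee] : complex.Im e = 0 /\ 0 < complex.Re e.
    by move: e_gt0; rewrite ltcE/= => /andP[/eqP].
  exists (complex.Re e) => // w wz; apply: h.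
  by rewrite -ball_normE/= distrC normc_def ltcE/= ree eqxx; move: wz; case: (w - z).
move=> [d d_gt0 h]; apply/nbhs_ballP; exists d%:C; first by rewrite /= ltcR.
by move=> w; rewrite -ball_normE/= distrC normc_def ltcR => H; apply: h; move: H; case: (w - z).
Qed.

End ComplexTopology.

Section Modulus.
Context {R : realType}.
Local Notation C := (R[i]^o).
Local Notation nc := Normc.normc.
Local Notation Re := complex.Re.
Local Notation Im := complex.Im.
Implicit Types (z w : R[i]).

Lemma ReD z w : Re (z + w) = Re z + Re w. Proof. by case: z; case: w. Qed.
Lemma ImD z w : Im (z + w) = Im z + Im w. Proof. by case: z; case: w. Qed.
Lemma ReN z : Re (- z) = - Re z. Proof. by case: z. Qed.
Lemma ImN z : Im (- z) = - Im z. Proof. by case: z. Qed.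
Lemma ReM z w : Re (z * w) = Re z * Re w - Im z * Im w. Proof. by case: z; case: w. Qed.
Lemma ImM z w : Im (z * w) = Re z * Im w + Im z * Re w. Proof. by case: z; case: w. Qed.
Lemma ReJ z : Re (z^*)%C = Re z. Proof. by case: z. Qed.
Lemma ImJ z : Im (z^*)%C = - Im z. Proof. by case: z. Qed.
Lemma complex_ext z w : Re z = Re w -> Im z = Im w -> z = w.
Proof. by case: z; case: w => /= ? ? ? ? -> ->. Qed.

Lemma ncE z : nc z = Num.sqrt (Re z ^+ 2 + Im z ^+ 2). Proof. by case: z. Qed.
Lemma nc_ge0 z : 0 <= nc z. Proof. by rewrite ncE sqrtr_ge0. Qed.
Lemma nc_sqr z : nc z ^+ 2 = Re z ^+ 2 + Im z ^+ 2.
Proof. by rewrite ncE sqr_sqrtr// addr_ge0// sqr_ge0. Qed.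
Lemma nc_eq0 z : (nc z == 0) = (z == 0).
Proof.
by apply/eqP/eqP => [/Normc.eq0_normc//|->]; rewrite Normc.normc0.
Qed.
Lemma nc_gt0 z : (0 < nc z) = (z != 0).
Proof. by rewrite lt_def nc_ge0 nc_eq0 andbT. Qed.
Lemma ncN z : nc (- z) = nc z. Proof. by rewrite !ncE ReN ImN !sqrrN. Qed.
Lemma ncB z w : nc (z - w) = nc (w - z). Proof. by rewrite -ncN opprB. Qed.
Lemma ncJ z : nc (z^*)%C = nc z. Proof. by rewrite !ncE ReJ ImJ sqrrN. Qed.
Lemma ncX z n : nc (z ^+ n) = nc z ^+ n.
Proof.
by elim: n => [|n IH]; rewrite ?expr0 ?Normc.normc1// !exprS Normc.normcM IH.
Qed.
Lemma ncV z : nc z^-1 = (nc z)^-1. Proof. exact: Normc.normcV. Qed.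
Lemma nc_real (x : R) : nc x%:C = `|x|.
Proof. by rewrite ncE/= expr0n addr0 sqrtr_sqr. Qed.
Lemma ncD z w : nc (z + w) <= nc z + nc w.
Proof. exact: le_normcD. Qed.
Lemma Re_le_nc z : `|Re z| <= nc z.
Proof. by rewrite ncE -sqrtr_sqr ler_wsqrtr// lerDl sqr_ge0. Qed.
Lemma Im_le_nc z : `|Im z| <= nc z.
Proof. by rewrite ncE -sqrtr_sqr ler_wsqrtr// lerDr sqr_ge0. Qed.
Lemma nc_le_ReIm z : nc z <= `|Re z| + `|Im z|.
Proof.
rewrite -[leRHS]ger0_norm ?addr_ge0// -sqrtr_sqr ncE ler_wsqrtr//.
rewrite sqrrD !real_normK ?num_real// -addrA lerD2l lerDr.
by rewrite mulrn_wge0// mulr_ge0.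
Qed.

Lemma cont_ncP (f : C -> C) (z : C) : {for z, continuous f} <->
  forall e : R, 0 < e -> exists2 d : R, 0 < d &
    forall w, nc (w - z) < d -> nc (f w - f z) < e.
Proof.
split=> [cf e e_gt0|h].
  have /(cf _) : nbhs (f z) [set w | nc (w - f z) < e] by apply/nbhsC; exists e.
  by move=> /nbhsC.
move=> A /nbhsC[e e_gt0 hA]; have [d d_gt0 hd] := h _ e_gt0.
by apply/nbhsC; exists d => // w /hd; exact: hA.
Qed.

Lemma continuous_Re (z : C) : {for z, continuous (fun w : C => Re w)}.
Proof.
move=> A /nbhs_ballP[e /= e_gt0 hA]; apply/nbhsC; exists e => // w wz; apply: hA.
rewrite -ball_normE/= -ReN -ReD.
by apply: le_lt_trans (Re_le_nc _) _; rewrite ncB.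
Qed.

Lemma continuous_Im (z : C) : {for z, continuous (fun w : C => Im w)}.
Proof.
move=> A /nbhs_ballP[e /= e_gt0 hA]; apply/nbhsC; exists e => // w wz; apply: hA.
rewrite -ball_normE/= -ImN -ImD.
by apply: le_lt_trans (Im_le_nc _) _; rewrite ncB.
Qed.

Lemma continuous_Complex (T : topologicalType) (u v : T -> R) (t : T) :
  {for t, continuous u} -> {for t, continuous v} ->
  {for t, continuous (fun s => (u s +i* v s) : C)}.
Proof.
move=> cu cv A /nbhsC[e e_gt0 hA].
have e2 : 0 < e / 2 by rewrite divr_gt0.
have {}cu : \forall s \near t, `|u s - u t| < e / 2.
  by move/cvgrPdist_lt: cu => /(_ _ e2); apply: filterS => s; rewrite distrC.
have {}cv : \forall s \near t, `|v s - v t| < e / 2.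
  by move/cvgrPdist_lt: cv => /(_ _ e2); apply: filterS => s; rewrite distrC.
rewrite nbhs_filterE; move: cu cv; apply: filterS2 => s us vs; apply: hA.
by apply: le_lt_trans (nc_le_ReIm _) _; rewrite [e]splitr ltrD.
Qed.

Lemma continuous_nc (z : C) : {for z, continuous (fun w : C => nc w)}.
Proof.
move=> A /nbhs_ballP[e /= e_gt0 hA]; apply/nbhsC; exists e => // w wz; apply: hA.
rewrite -ball_normE/= ltr_norml.
have h1 : nc z <= nc w + nc (w - z).
  by rewrite ncB -{1}(subrK w z) addrC ncD.
have h2 : nc w <= nc z + nc (w - z) by rewrite -{1}(subrK z w) addrC ncD.
by apply/andP; split; lra.
Qed.

(* The hypothesis [P z = Q z] encodes the Cauchy-Riemann equations. *)
Lemma cdiff_ReIm (g P Q : C -> C) (z : C) :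
  {for z, continuous P} -> {for z, continuous Q} -> P z = Q z ->
  (\forall w \near z,
    g w = g z + P w * (Re (w - z))%:C + Q w * ('i * (Im (w - z))%:C)) ->
  cdiff g z.
Proof.
move=> cP cQ PQ hg.
(* Replacing the real increment by [(w - z) - 'i * Im (w - z)] leaves the correction [(Q - P) * t].
   It tends to [0] because [t] has modulus at most [1] and [P z = Q z]. *)
pose t (w : C) : C := if w == z then 0 else 'i * (Im (w - z))%:C / (w - z).
exists (fun w => P w + (Q w - P w) * t w).
  apply: (@contD _ C P (fun w => (Q w - P w) * t w) z cP); apply/cont_ncP => e e_gt0.
  have cQP : {for z, continuous (fun w : C => Q w - P w : C)} by exact: contD cQ (contN cP).
  move/cont_ncP: cQP => /(_ _ e_gt0)[d d_gt0 hd]; exists d => // w /hd.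
  rewrite PQ subrr subr0 mul0r subr0 Normc.normcM; apply: le_lt_trans.
  rewrite ler_piMr ?nc_ge0// /t; case: eqVneq => [_|wz]; first by rewrite Normc.normc0.
  rewrite Normc.normcM ncV ler_pdivrMr ?nc_gt0 ?subr_eq0// mul1r.
  by rewrite Normc.normcM nc_real ncE/= expr0n add0r expr1n sqrtr1 mul1r Im_le_nc.
move: hg; apply: filterS => w ->; rewrite /t; case: eqVneq => [->|wz].
  by rewrite subrr/= !mulr0 !addr0.
have -> : (P w + (Q w - P w) * ('i * (Im (w - z))%:C / (w - z))) * (w - z) =
    P w * (w - z) + (Q w - P w) * ('i * (Im (w - z))%:C).
  by rewrite mulrDl -!mulrA mulVf ?subr_eq0// mulr1.
have e := complexE (w - z); rewrite -addrA; congr (_ + _).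
rewrite [in RHS]mulrBl.
rewrite [X in _ = P w * X + _]e.
by rewrite mulrDr -addrA; congr (_ + _); rewrite addrCA subrr addr0.
Qed.

End Modulus.

(** * The complex exponential *)

Section ComplexExponential.
Context {R : realType}.
Local Notation C := (R[i]^o).
Local Notation nc := Normc.normc.
Local Notation Re := complex.Re.
Local Notation Im := complex.Im.
Implicit Types (z w : R[i]).

Definition cexp z : R[i] := (expR (Re z) * cos (Im z)) +i* (expR (Re z) * sin (Im z)).

Lemma cexpD z w : cexp (z + w) = cexp z * cexp w.
Proof.
rewrite /cexp ReD ImD expRD cosD sinD.
by apply: complex_ext; rewrite /= ?ReM ?ImM/=; ring.
Qed.

Lemma nc_cexp z : nc (cexp z) = expR (Re z).
Proof.
rewrite ncE/= !exprMn -mulrDr cos2Dsin2 mulr1 sqrtr_sqr.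
by rewrite ger0_norm// expR_ge0.
Qed.

Lemma cexp_neq0 z : cexp z != 0.
Proof. by rewrite -nc_gt0 nc_cexp expR_gt0. Qed.

Lemma cexp_2pi z : cexp (z + (0 +i* (pi *+ 2))) = cexp z.
Proof.
by rewrite /cexp ReD ImD/= addr0 cosD2pi sinD2pi.
Qed.

Lemma cdiff_cexp (z : C) : cdiff (cexp : C -> C) z.
Proof.
have [p [cp p0 hp]] := @derivable_slope R expR 0 (@derivable_expR R 0).
have [c [cc c0 hc]] := @derivable_slope R cos 0 (@derivable_cos R 0).
have [s [cs s0 hs]] := @derivable_slope R sin 0 (@derivable_sin R 0).
have cz : {for z, continuous (fun w : C => w - z : C)}.
  by apply: (@contD R[i] C (fun w => w)); [exact: cvg_id|exact: cont_cst].
have cRe : {for z, continuous (fun w : C => Re (w - z))}.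
  by apply: (cont_comp cz); exact: continuous_Re.
have cIm : {for z, continuous (fun w : C => Im (w - z))}.
  by apply: (cont_comp cz); exact: continuous_Im.
have Re0 : Re (z - z) = 0 by rewrite subrr.
have Im0 : Im (z - z) = 0 by rewrite subrr.
have cexpRe : {for z, continuous (fun w : C => expR (Re (w - z)))}.
  by apply: cont_comp cRe _; rewrite Re0; exact: continuous_expR.
(* The addition formula reduces to slopes at [0]. With [x], [y] the increments, [exp x * cos y] and
   [exp x * sin y] are expanded by [p], [c], [s]; at [0] these are [1], [0], [1], so that both
   coefficients equal [cexp z]. *)
apply: (@cdiff_ReIm R cexp (fun w => cexp z * (p (Re (w - z)))%:C)
  (fun w => cexp z * ((expR (Re (w - z)) * s (Im (w - z))) +i*
                      (- (expR (Re (w - z)) * c (Im (w - z))))))).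
- apply: (@contM R[i] C); first exact: cont_cst.
  apply: continuous_Complex; last exact: cont_cst.
  by apply: cont_comp cRe _; rewrite Re0.
- apply: (@contM R[i] C); first exact: cont_cst.
  apply: continuous_Complex.
    by apply: contM => //; apply: cont_comp cIm _; rewrite Im0.
  by apply: contN; apply: contM => //; apply: cont_comp cIm _; rewrite Im0.
- by rewrite Re0 Im0 p0 s0 c0 !derive_val expR0 cos0 sin0 oppr0 mulr0 mulr1 oppr0.
apply: filterE => w; rewrite -{1}(subrK z w) addrC cexpD.
rewrite [cexp (w - z)]/cexp; set x := Re (w - z); set y := Im (w - z).
have -> : (expR x * cos y) +i* (expR x * sin y) = 1 + (p x * x)%:C
   + ((expR x * s y) +i* (- (expR x * c y))) * ('i * y%:C) :> R[i].
  have ex : expR x = 1 + p x * x by rewrite hp expR0 subr0.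
  have cy : cos y = 1 + c y * y by rewrite hc cos0 subr0.
  have sy : sin y = s y * y by rewrite hs sin0 subr0 add0r.
  apply: complex_ext; rewrite !(ReD, ImD, ReM, ImM)/= ?cy ?sy; last by ring.
  by rewrite mulrDr mulr1 {1}ex; ring.
by rewrite rmorphM/=; ring.
Qed.

End ComplexExponential.

(** * The mean value property and the maximum modulus principle *)

Section MaximumModulus.
Context {R : realType}.
Local Notation C := (R[i]^o).
Local Notation nc := Normc.normc.
Local Notation Re := complex.Re.
Local Notation Im := complex.Im.
Implicit Types (z w : R[i]).

(** The argument is the [acos] of the normalised real part, replaced by [2 pi - acos] when the
    imaginary part is negative. The bounds on [t] later provide a compact fundamental domain for
    circles around a puncture. *)
Lemma polar z : z != 0 ->
  exists2 t : R, 0 <= t <= pi *+ 2 & z = cexp (ln (nc z) +i* t).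
Proof.
move=> z0; have nz : 0 < nc z by rewrite nc_gt0.
have e : nc z ^+ 2 = Re z ^+ 2 + Im z ^+ 2 := nc_sqr z.
pose c := Re z / nc z; pose s := Im z / nc z.
have cs : c ^+ 2 + s ^+ 2 = 1.
  by rewrite /c /s !expr_div_n -mulrDl -e divff// expf_neq0// gt_eqF.
have c1 : -1 <= c <= 1.
  by rewrite -ler_norml -(@ler_pXn2r _ 2)// ?nnegrE// real_normK ?num_real// expr1n -cs lerDl sqr_ge0.
have ct : cos (acos c) = c by rewrite acosK// in_itv.
have st : sin (acos c) = `|s|.
  by rewrite sin_acos// -cs addrC addKr sqrtr_sqr.
have zE t : cos t = c -> sin t = s -> z = cexp (ln (nc z) +i* t).
  move=> hc hs; rewrite /cexp/= lnK ?posrE// hc hs.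
  by apply: complex_ext; rewrite /= /c /s mulrC divfK ?gt_eqF.
have a0 := acos_ge0 c1; have api := acos_lepi c1; have p0 := @pi_ge0 R.
have [s0|s0] := lerP 0 s.
  exists (acos c); last by apply: zE => //; rewrite st ger0_norm.
  by rewrite a0 mulr2n; apply: le_trans api _; rewrite lerDl.
exists (pi *+ 2 - acos c).
  rewrite subr_ge0 lerBlDr lerDl a0 andbT mulr2n.
  by apply: le_trans api _; rewrite lerDl.
apply: zE.
  by rewrite addrC cosD2pi cosN.
by rewrite addrC sinD2pi sinN st ltr0_norm// opprK.
Qed.

Lemma backward_period (J : R -> R) (a l : R) : 0 < l ->
  (forall x, x + l <= a -> J (x + l) = J x) -> forall n, J (a - l *+ n) = J a.
Proof.
move=> l_gt0 Jper; elim=> [|n IH]; first by rewrite mulr0n subr0.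
have e : a - l *+ n.+1 + l = a - l *+ n by rewrite mulrS; ring.
have h : a - l *+ n.+1 + l <= a.
  by rewrite e lerBlDr lerDl; apply: mulrn_wge0; exact: ltW.
by rewrite -IH -e Jper.
Qed.

(* Integrating [k (z0 + exp w) dw] along the boundary of a square of side
   [2 pi] and using periodicity, the mean of [Re k] over a circle does not
   depend on its radius. *)
Lemma circle_mean (k : C -> C) (z0 : C) (r a th : R) : 0 < r -> expR a < r ->
  {for z0, continuous k} ->
  (forall z, 0 < nc (z - z0) < r -> cdiff k z) ->
  primitive (fun t => Re (k (z0 + cexp (a +i* t)))) (th - pi - 1) (th + pi) -
  primitive (fun t => Re (k (z0 + cexp (a +i* t)))) (th - pi - 1) (th - pi) =
  pi *+ 2 * Re (k z0).
Proof.
move=> r_gt0 ar ck dk.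
have p0 : 0 < pi :> R by exact: pi_gt0.
have [l lE] : exists l : R, l = pi *+ 2 by exists (pi *+ 2).
have l_gt0 : 0 < l by rewrite lE mulrn_wgt0.
pose g (w : C) : C := k (z0 + cexp w).
have dg (w : C) : expR (Re w) < r -> cdiff g w.
  move=> hw; apply: (@cdiff_comp R[i] (fun w => z0 + cexp w) k).
    by apply: cdiffD; [exact: cdiff_cst|exact: cdiff_cexp].
  by apply: dk; rewrite addrC addKr nc_cexp expR_gt0.
(* Truncating the real part at [a] makes [U] and [V] continuous on the whole plane without changing
   them where [x <= a], the only region integrated over. *)
pose U x y : R := Re (g ((Num.min x a) +i* y)).
pose V x y : R := Im (g ((Num.min x a) +i* y)).
have cg x y : {for (Num.min x a) +i* y, continuous g}.
  apply: cdiff_continuous; apply: dg => /=; apply: le_lt_trans ar.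
  by rewrite ler_expR ge_min lexx orbT.
have cmin : continuous (fun x => Num.min x a).
  move=> x; apply: (@continuous_min R R id (fun=> a)); first exact: cvg_id.
  exact: cont_cst.
have cgy x y : {for y, continuous (fun y => g ((Num.min x a) +i* y))}.
  apply: (@cont_comp R C C (fun t => Num.min x a +i* t) g y _ (cg x y)).
  by apply: continuous_Complex; [exact: cont_cst|exact: cvg_id].
have cgx x y : {for x, continuous (fun x => g ((Num.min x a) +i* y))}.
  apply: (@cont_comp R C C (fun t => Num.min t a +i* y) g x _ (cg x y)).
  by apply: continuous_Complex; [exact: cmin|exact: cont_cst].
have cUy x : continuous (U x).
  by move=> y; apply: (cont_comp (cgy x y)); exact: continuous_Re.
have cVx y : continuous (V ^~ y).
  by move=> x; apply: (cont_comp (cgx x y)); exact: continuous_Im.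
pose b := th - pi - 1.
pose J x := primitive (U x) b (th + pi) - primitive (U x) b (th - pi).
have Vper x : V x (th + pi) = V x (th - pi).
  rewrite /V /g; congr (Im (k (z0 + _))).
  rewrite -[RHS]cexp_2pi; congr cexp; apply: complex_ext; rewrite !(ReD, ImD)/=.
    by rewrite addr0.
  by ring.
(* In Goursat's identity for the square of side [2 pi] the two horizontal sides cancel by
   periodicity, and the vertical sides are [J (x + l)] and [J x]. *)
have Jper x : x + l <= a -> J (x + l) = J x.
  move=> xla.
  have := @goursat_square R U V (x - 1) b x (th - pi) l l_gt0 _ _ cUy cVx.
  have e : th - pi + l = th + pi by rewrite lE; ring.
  rewrite /square_circulation e.
  have -> : (V^~ (th + pi)) = (V^~ (th - pi)) by apply/funext => t; exact: Vper.
  rewrite addrK => H; apply/eqP; rewrite -subr_eq0; apply/eqP; apply: H.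
  - by rewrite ltrBlDr ltrDl.
  - by rewrite /b ltrBlDr ltrDl.
  clear e; move=> x1 y1 /andP[_ hx1] _.
  have x1a : x1 <= a by apply: le_trans xla.
  have dgw : cdiff g (x1 +i* y1).
    by apply: dg; apply: le_lt_trans ar; rewrite ler_expR.
  move: dgw => [q cq hq].
  exists (Re (q (x1 +i* y1))), (Im (q (x1 +i* y1))) => e e_gt0.
  move/cont_ncP: cq => /(_ _ e_gt0)[d1 d1_gt0 hd1].
  move: hq => /nbhsC[d2 d2_gt0 hd2].
  exists (Num.min d1 d2 / 2); first by rewrite divr_gt0// lt_min d1_gt0.
  move=> x2 y2 /andP[_ hx2] _ hx hy.
  have x2a : x2 <= a by apply: le_trans xla.
  rewrite /U /V !min_l//.
  set w1 := x1 +i* y1; set w2 := x2 +i* y2.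
  have Ew : Re (w2 - w1) = x2 - x1 /\ Im (w2 - w1) = y2 - y1 by [].
  have nw : nc (w2 - w1) <= `|x2 - x1| + `|y2 - y1|.
    by apply: le_trans (nc_le_ReIm _) _; rewrite Ew.1 Ew.2.
  have nwd : nc (w2 - w1) < Num.min d1 d2.
    by apply: le_lt_trans nw _; rewrite [ltRHS]splitr ltrD.
  rewrite lt_min in nwd; move/andP: nwd => [nwd1 nwd2].
  have E : g w2 - g w1 - q w1 * (w2 - w1) = (q w2 - q w1) * (w2 - w1).
    by rewrite (hd2 _ nwd2) /w1 /w2; ring.
  have nE : nc (g w2 - g w1 - q w1 * (w2 - w1)) <= e * (`|x2 - x1| + `|y2 - y1|).
    rewrite E Normc.normcM; apply: ler_pM => //; [exact: nc_ge0|exact: nc_ge0|].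
    by apply: ltW; exact: hd1.
  have := le_trans (Re_le_nc _) nE; have := le_trans (Im_le_nc _) nE.
  have -> : Re (g w2 - g w1 - q w1 * (w2 - w1)) = Re (g w2) - Re (g w1) -
      Re (q w1) * (x2 - x1) + Im (q w1) * (y2 - y1).
    by rewrite !(ReD, ReN, ReM) !(ImD, ImN)/=; ring.
  have -> : Im (g w2 - g w1 - q w1 * (w2 - w1)) = Im (g w2) - Im (g w1) -
      Im (q w1) * (x2 - x1) - Re (q w1) * (y2 - y1).
    by rewrite !(ImD, ImN, ImM) !(ReD, ReN)/=; ring.
  by [].
have Jn := backward_period l_gt0 Jper.
have UaE : U a = (fun t => Re (k (z0 + cexp (a +i* t)))).
  by apply/funext => t; rewrite /U /g minxx.
rewrite -/b -UaE -/(J a) -lE; apply/eqP; rewrite -subr_eq0 -normr_eq0 eq_le normr_ge0 andbT.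
apply/ler_addgt0Pr => e e_gt0; rewrite add0r.
have el : 0 < e / l by rewrite divr_gt0.
move/cont_ncP: ck => /(_ _ el)[d d_gt0 hd].
(* So many steps to the left that the circle of radius [exp (a - l n)] lies in the disc where [k]
   differs from [k z0] by less than [e / l]; its integral, over a length [l], is then within [e] of
   [l * Re (k z0)]. *)
pose n := (Num.truncn ((a - ln d) / l)).+1.
have hn : a - l *+ n < ln d.
  rewrite ltrBlDr -ltrBlDl -mulr_natr -ltr_pdivrMl// mulrC.
  exact: Num.Theory.truncnS_gt.
have [||t _ Ht] := @primitive_MVT R (U (a - l *+ n)) b (th - pi) (th + pi) (cUy _).
- by rewrite /b ltrBlDr ltrDl.
- by rewrite ltrD2l gtrN.
rewrite -(Jn n) /J Ht.
have -> : th + pi - (th - pi) = l by rewrite lE; ring.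
rewrite mulrC -mulrBr normrM (gtr0_norm l_gt0) mulrC -ler_pdivlMr//.
rewrite -ReN -ReD; apply: le_trans (Re_le_nc _) _; apply: ltW; apply: hd.
rewrite addrC addKr nc_cexp /= min_l.
  by rewrite -[ltRHS]lnK ?posrE// ltr_expR.
by rewrite lerBlDr lerDl mulrn_wge0// ltW.
Qed.

Lemma max_modulus (h : C -> C) (z0 : C) (r : R) :
  {for z0, continuous h} ->
  (forall z, 0 < nc (z - z0) < r -> cdiff h z) ->
  (forall z, nc (z - z0) < r -> nc (h z) <= nc (h z0)) ->
  forall z, nc (z - z0) < r -> nc (h z) = nc (h z0).
Proof.
move=> ch dh hmax z zr; have [->//|zz0] := eqVneq z z0.
have zz0' : z - z0 != 0 by rewrite subr_eq0.
have r_gt0 : 0 < r by apply: le_lt_trans zr; exact: nc_ge0.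
have [th _ zE] := polar zz0'; set a := ln _ in zE.
have ar : expR a < r by rewrite lnK// posrE nc_gt0.
pose m := nc (h z0) ^+ 2.
pose k (w : C) : C := (h z0)^*%C * h w.
have dk w : 0 < nc (w - z0) < r -> cdiff k w.
  by move=> /dh dhw; apply: cdiffM => //; exact: cdiff_cst.
have ck : {for z0, continuous k}.
  refine (@contM _ C (fun=> (h z0)^*%C) h z0 _ ch); exact: cont_cst.
have mE : Re (k z0) = m by rewrite /k ReM ReJ ImJ /m nc_sqr; ring.
have nk w : nc (w - z0) < r -> nc (k w) <= m.
  by move=> wr; rewrite /k Normc.normcM ncJ /m expr2 ler_wpM2l ?nc_ge0// hmax.
pose u t := Re (k (z0 + cexp (a +i* t))).
have um t : u t <= m.
  apply: le_trans (ler_norm _) _; apply: le_trans (Re_le_nc _) _; apply: nk.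
  by rewrite addrC addKr nc_cexp.
have cu : continuous u.
  move=> t; apply: (@cont_comp R C R (fun t => k (z0 + cexp (a +i* t)))); last exact: continuous_Re.
  apply: (@cont_comp R C C (fun t => a +i* t) (fun w => k (z0 + cexp w))).
    by apply: continuous_Complex; [exact: cont_cst|exact: cvg_id].
  apply: cdiff_continuous; apply: (@cdiff_comp R[i] (fun w => z0 + cexp w) k).
    by apply: cdiffD; [exact: cdiff_cst|exact: cdiff_cexp].
  by apply: dk; rewrite addrC addKr nc_cexp expR_gt0.
have p0 : 0 < pi :> R by exact: pi_gt0.
have := circle_mean th r_gt0 ar ck dk; rewrite -/u mE; set b := th - pi - 1 => mean.
have bth : b < th - pi by rewrite /b ltrBlDr ltrDl.
have F_le x y : th - pi <= x -> x < y -> primitive u b y - primitive u b x <= m * (y - x).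
  move=> tx xy; have [t _ ->] := primitive_MVT cu (lt_le_trans bth tx) xy.
  by rewrite ler_wpM2r// subr_ge0 ltW.
(* The integral of [u] over [[th - pi, th + pi]] is [2 pi m] and [u <= m]: a drop of [u] at the
   midpoint [th] would persist on [[th, th + d']] and make the integral smaller. *)
have uth : u th = m.
  apply/eqP; rewrite eq_le um/= leNgt; apply/negP => uthm.
  have /cvgrPdist_lt/(_ (m - u th)) := cu th; rewrite subr_gt0 => /(_ uthm).
  move=> /nbhs_ballP[d /= d_gt0 hd].
  pose d' := Num.min (d / 2) (pi / 2).
  have d'_gt0 : 0 < d' by rewrite lt_min !divr_gt0.
  have d'd : d' < d by rewrite gt_min ltr_pdivrMr// ltr_pMr// ltr1n.
  have d'pi : d' < pi by rewrite gt_min [X in _ || X]ltr_pdivrMr// ltr_pMr// ltr1n orbT.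
  have thd : th < th + d' by rewrite ltrDl.
  have bth' : b < th by apply: (lt_trans bth); rewrite ltrBlDr ltrDl.
  have [t /andP[t1 t2] e2] := primitive_MVT cu bth' thd.
  have utm : u t < m.
    have := hd t; rewrite /ball/= distrC gtr0_norm ?subr_gt0// => /(_ ltac:(lra)).
    rewrite ltr_norml => /andP[+ _]; lra.
  have e1 := F_le (th - pi) th (lexx _) ltac:(lra).
  have e3 := F_le (th + d') (th + pi) ltac:(lra) ltac:(lra).
  have e2' : u t * (th + d' - th) < m * (th + d' - th).
    by rewrite ltr_pM2r// addrC addKr.
  have : pi *+ 2 * m = m * (th - (th - pi)) + m * (th + d' - th) + m * (th + pi - (th + d')) by ring.
  lra.
have uz : u th = Re (k z) by rewrite /u -zE addrC subrK.
apply/eqP; rewrite eq_le hmax//=.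
have : m <= nc (h z0) * nc (h z).
  rewrite -[nc (h z0)]ncJ -Normc.normcM -/(k z).
  by rewrite -uth uz (le_trans (ler_norm _))// Re_le_nc.
have [->|hz0] := eqVneq (h z0) 0; first by rewrite Normc.normc0 nc_ge0.
by rewrite /m expr2 ler_pM2l// nc_gt0.
Qed.

End MaximumModulus.

Section WeakMaximum.
Context {R : realType}.
Local Notation C := (R[i]^o).
Local Notation nc := Normc.normc.
Local Notation Re := complex.Re.
Local Notation Im := complex.Im.

Lemma max_modulus_near (g : C -> C) (w : C) :
  {for w, continuous g} -> (\forall z \near w, z != w -> cdiff g z) ->
  (\forall z \near w, nc (g z) <= nc (g w)) ->
  \forall z \near w, nc (g z) = nc (g w).
Proof.
move=> cg /nbhsC[d1 d1_gt0 h1] /nbhsC[d2 d2_gt0 h2].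
apply/nbhsC; exists (Num.min d1 d2); first by rewrite lt_min d1_gt0.
apply: max_modulus => // z.
  by rewrite nc_gt0 lt_min subr_eq0 => /and3P[zw z1 _]; exact: h1.
by rewrite lt_min => /andP[_]; exact: h2.
Qed.

Lemma closed_realC (F : C -> R) (c : R) : continuous F -> closed [set w | F w <= c].
Proof. by move=> cF; apply: (@preimage_closed C R F [set x | x <= c]) => [x _|]; [exact: cF|exact: closed_le]. Qed.

Lemma compactC (A : set C) (M : R) : closed A ->
  (forall w, A w -> `|Re w| <= M /\ `|Im w| <= M) -> compact A.
Proof.
move=> clA bA; pose f (p : R * R) : C := p.1 +i* p.2.
have cf : continuous f.
  by move=> p; apply: continuous_Complex; [exact: cvg_fst|exact: cvg_snd].
apply: (@subclosed_compact _ A (f @` (`[- M, M] `*` `[- M, M]))) => //.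
  apply: continuous_compact; first by apply: continuous_subspaceT.
  by apply: compact_setX; exact: segment_compact.
move=> w /bA[]; rewrite !ler_norml => h1 h2.
by exists (Re w, Im w); [split; rewrite /= in_itv|case: (w)].
Qed.

(* Among the points of [K] where [F] is maximal, one with the largest real part
   cannot be a point around which [F] is locally constant. *)
Lemma weak_maximum (K : set C) (F : C -> R) (M : R) :
  compact K -> closed K -> (forall w, K w -> {for w, continuous F}) ->
  (forall w, K w -> M < F w -> (\forall z \near w, K z) /\
     ((\forall z \near w, F z <= F w) -> \forall z \near w, F z = F w)) ->
  forall w, K w -> F w <= M.
Proof.
move=> cK clK cF H w0 Kw0; rewrite leNgt; apply/negP => Mw0.
have [|w1] := @compact_EVT_max C R F K (ex_intro _ w0 Kw0) cK.
  by apply: continuous_in_subspaceT => w; rewrite inE; exact: cF.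
rewrite inE => Kw1 max1.
have m1 w : K w -> F w <= F w1 by move=> Kw; apply: max1; rewrite inE.
pose Z := K `&` [set w | F w = F w1].
have cZ : compact Z.
  apply: (@subclosed_compact _ Z K) => //; last by move=> w [].
  move=> w clZ; have Kw : K w.
    by apply: clK => B /clZ[z [[Kz _] Bz]]; exists z.
  split=> //=; apply/eqP; rewrite eq_le m1//= leNgt; apply/negP => lt1.
  have /cF/(_ [set x | x < F w1]) := Kw.
  case/(_ _)/clZ.
    by apply: open_nbhs_nbhs; split => //; exact: open_lt.
  by move=> z [[_ /= ->]]; rewrite ltxx.
have [|w2] := @compact_EVT_max C R (fun w : C => Re w) Z (ex_intro _ w1 (conj Kw1 erefl)) cZ.
  by apply: continuous_subspaceT => w; exact: continuous_Re.
rewrite inE => -[Kw2 /= F2] max2.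
have [|nK nF] := H _ Kw2; first by rewrite F2; apply: lt_le_trans Mw0 _; exact: m1.
have {}nF : \forall z \near w2, F z = F w2.
  by apply: nF; move: nK; apply: filterS => z; rewrite F2; exact: m1.
move/nbhsC: nK => [d1 d1_gt0 h1]; move/nbhsC: nF => [d2 d2_gt0 h2].
pose d := Num.min d1 d2 / 2.
have d_gt0 : 0 < d by rewrite divr_gt0// lt_min d1_gt0.
have [dd1 dd2] : d < d1 /\ d < d2.
  by apply/andP; rewrite -lt_min /d ltr_pdivrMr// ltr_pMr ?ltr1n// lt_min d1_gt0.
pose w3 : C := w2 + d%:C.
have n3 : nc (w3 - w2) = d by rewrite /w3 addrC addKr nc_real gtr0_norm.
have : Z w3 by split; [apply: h1; rewrite n3|rewrite /= h2 ?n3].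
by rewrite -in_setE => /max2; rewrite /w3 ReD/= gerDl leNgt d_gt0.
Qed.

End WeakMaximum.

(** * Hyperbolic distance and the Schwarz-Pick lemma *)

Section HyperbolicPlane.
Context {R : realType}.
Local Notation C := (R[i]^o).
Local Notation nc := Normc.normc.
Local Notation Re := complex.Re.
Local Notation Im := complex.Im.
Local Notation H := (@upper_half_plane R).
Implicit Types (a b c w : R[i]).

(* [hdist2 a b = 4 sinh^2(d(a, b)/2)], with [d] the hyperbolic distance. *)
Definition hdist2 a b : R := nc (a - b) ^+ 2 / (Im a * Im b).

Lemma hdist2C a b : hdist2 a b = hdist2 b a.
Proof. by rewrite /hdist2 ncB mulrC [Im a * _]mulrC mulrC. Qed.

Lemma hdist2_ge0 a b : H a -> H b -> 0 <= hdist2 a b.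
Proof.
by move=> Ha Hb; rewrite divr_ge0 ?sqr_ge0// mulr_ge0// ltW.
Qed.

Lemma hdist2_gt0 a b : H a -> H b -> (0 < hdist2 a b) = (a != b).
Proof.
move=> Ha Hb; rewrite /hdist2 pmulr_lgt0; last by rewrite invr_gt0 mulr_gt0.
by rewrite lt_def sqr_ge0 andbT expf_eq0/= nc_eq0 subr_eq0.
Qed.

Lemma nc_sub_conj a b : nc (a - b^*%C) ^+ 2 = nc (a - b) ^+ 2 + 4 * (Im a * Im b).
Proof. by rewrite !nc_sqr !(ReD, ImD, ReN, ImN, ReJ, ImJ); ring. Qed.

Lemma sub_conj_neq0 a b : H a -> H b -> a - b^*%C != 0.
Proof.
move=> Ha Hb; rewrite -nc_gt0 -(@ltr_pXn2r _ 2) ?nnegrE ?nc_ge0// expr0n/=.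
by rewrite nc_sub_conj ltr_wpDl ?sqr_ge0// !mulr_gt0.
Qed.

(* Addition formula of cosh: [hdist2 + 2 = 2 cosh d]. *)
Lemma hdist2_triangle a b c : H a -> H b -> H c ->
  hdist2 a c + 2 <= (hdist2 a b + 2) * (hdist2 b c + 2).
Proof.
rewrite /H/= => Ha Hb Hc.
have E u v : 0 < Im u -> 0 < Im v -> hdist2 u v + 2 =
    ((Re u - Re v) ^+ 2 + Im u ^+ 2 + Im v ^+ 2) / (Im u * Im v).
  move=> Hu Hv; rewrite /hdist2 nc_sqr !(ReD, ImD, ReN, ImN).
  by field; rewrite !gt_eqF.
rewrite !E//.
have -> : ((Re a - Re b) ^+ 2 + Im a ^+ 2 + Im b ^+ 2) / (Im a * Im b) *
   (((Re b - Re c) ^+ 2 + Im b ^+ 2 + Im c ^+ 2) / (Im b * Im c)) =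
   ((Re a - Re b) ^+ 2 + Im a ^+ 2 + Im b ^+ 2) *
   ((Re b - Re c) ^+ 2 + Im b ^+ 2 + Im c ^+ 2) / Im b ^+ 2 / (Im a * Im c).
  by field; rewrite !gt_eqF.
rewrite ler_pM2r ?invr_gt0 ?mulr_gt0// ler_pdivlMr ?exprn_gt0// -subr_ge0.
set p := Re a; set q := Re b; set s := Re c; set x := Im a; set y := Im b; set z := Im c.
have -> : ((p - q) ^+ 2 + x ^+ 2 + y ^+ 2) * ((q - s) ^+ 2 + y ^+ 2 + z ^+ 2) -
  ((p - s) ^+ 2 + x ^+ 2 + z ^+ 2) * y ^+ 2 =
  ((p - q) * (q - s) - y ^+ 2) ^+ 2 + ((p - q) * z) ^+ 2 + (x * (q - s)) ^+ 2
   + (x * z) ^+ 2 by ring.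
by rewrite !addr_ge0// sqr_ge0.
Qed.

(** A closed hyperbolic disc, with denominators cleared: it is then cut out of the whole plane by
    continuous functions, hence closed, and for [w0] in the half-plane and [k > 0] it contains no
    point outside the half-plane. *)
Definition hball (w0 : R[i]) (k : R) : set C :=
  [set w | nc (w - w0) ^+ 2 <= k * (Im w * Im w0)].

Lemma hballP w0 k w : H w0 -> 0 < k ->
  hball w0 k w <-> H w /\ hdist2 w w0 <= k.
Proof.
rewrite /H/= => H0 k0; split.
  rewrite /hball/= => h.
  have Hw : 0 < Im w.
    have h0 : 0 <= Im w.
      have := le_trans (sqr_ge0 _) h; rewrite pmulr_rge0//.
      by rewrite pmulr_lge0.
    rewrite lt_def h0 andbT; apply/eqP => w0E; move: h.
    rewrite w0E mul0r mulr0 => h.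
    have : nc (w - w0) == 0 by rewrite -sqrf_eq0 eq_le h sqr_ge0.
    by rewrite nc_eq0 subr_eq0 => /eqP e; rewrite -e w0E ltxx in H0.
  by split => //; rewrite /hdist2 ler_pdivrMr// mulr_gt0.
by case=> Hw; rewrite /hdist2 ler_pdivrMr ?mulr_gt0.
Qed.

Lemma continuous_nc_sub w0 : continuous (fun w : C => nc (w - w0)).
Proof.
move=> w.
refine (@cont_comp C C R (fun w : C => w - w0 : C) (fun z : C => nc z) w _ _).
  by apply: (@contD R[i] C (fun w => w)); [exact: cvg_id|exact: cont_cst].
exact: continuous_nc.
Qed.

Lemma continuous_hball w0 k :
  continuous (fun w : C => nc (w - w0) ^+ 2 - k * (Im w * Im w0)).
Proof.
move=> w; apply: (@contD R C (fun w => nc (w - w0) ^+ 2)); last first.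
  apply: (@contN R C (fun w => k * (Im w * Im w0))).
  apply: (@contM R C (fun=> k) (fun w => Im w * Im w0)); first exact: cont_cst.
  apply: (@contM R C (fun w => Im w) (fun=> Im w0)); last exact: cont_cst.
  exact: continuous_Im.
have c := @continuous_nc_sub w0 w.
exact: (@contM R C _ _ w c c).
Qed.

Lemma closed_hball w0 k : closed (hball w0 k).
Proof.
rewrite (_ : hball w0 k = [set w | nc (w - w0) ^+ 2 - k * (Im w * Im w0) <= 0]).
  exact: closed_realC (@continuous_hball w0 k).
by apply/seteqP; split => w; rewrite /hball/= subr_le0.
Qed.

Lemma compact_hball w0 k : H w0 -> 0 < k -> compact (hball w0 k).
Proof.
rewrite /H/= => H0 k0.
pose M := `|Re w0| + `|Im w0| + Im w0 * (k + 1).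
apply: (@compactC _ _ M); first exact: closed_hball.
move=> w /(hballP w H0 k0)[Hw]; rewrite /H/= in Hw.
rewrite /hdist2 ler_pdivrMr ?mulr_gt0// => h.
have n0 := nc_ge0 (w - w0).
have hI : Im w <= Im w0 + nc (w - w0).
  have : Im (w - w0) <= nc (w - w0) := le_trans (ler_norm _) (Im_le_nc _).
  by rewrite ImD ImN; lra.
(* With [n = nc (w - w0)] and [y = Im w0], the hypothesis reads [n^2 <= k y (y + n)], whereas
   [n > y (k + 1)] would give [n^2 > k y n + y^2 (k + 1)]. *)
have hn : nc (w - w0) <= Im w0 * (k + 1).
  rewrite leNgt; apply/negP => hlt.
  have h1 : nc (w - w0) ^+ 2 <= k * Im w0 * (Im w0 + nc (w - w0)).
    apply: le_trans h _; rewrite [Im w * _]mulrC mulrA ler_wpM2l//.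
    by rewrite mulr_ge0// ltW.
  have npos : 0 < nc (w - w0) by apply: le_lt_trans hlt; rewrite mulr_ge0 ?addr_ge0// ltW.
  have h2 : Im w0 * (k + 1) * nc (w - w0) < nc (w - w0) * nc (w - w0) by rewrite ltr_pM2r.
  have h3 : Im w0 * (Im w0 * (k + 1)) < Im w0 * nc (w - w0) by rewrite ltr_pM2l.
  have h4 : 0 < Im w0 * Im w0 by rewrite mulr_gt0.
  by move: h1 h2 h3 h4; rewrite expr2; clear; lra.
split.
  rewrite -(subrK w0 w) ReD; apply: le_trans (ler_normD _ _) _.
  have := Re_le_nc (w - w0); have := normr_ge0 (Im w0); rewrite /M; lra.
rewrite -(subrK w0 w) ImD; apply: le_trans (ler_normD _ _) _.
have := Im_le_nc (w - w0); have := normr_ge0 (Re w0); rewrite /M; lra.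
Qed.

Lemma near_hball w0 k w : hdist2 w w0 < k -> H w -> H w0 ->
  \forall z \near (w : C), hball w0 k z.
Proof.
rewrite /H/= => wk Hw H0.
pose g (z : C) := nc (z - w0) ^+ 2 - k * (Im z * Im w0).
have gw : g w < 0 by rewrite subr_lt0 -ltr_pdivrMr// mulr_gt0.
have : nbhs (g w) [set x | x < 0] by apply: open_nbhs_nbhs; split => //; exact: open_lt.
move=> /(@continuous_hball w0 k w); rewrite nbhs_filterE; apply: (@filterS C (nbhs (w : C))) => z /= /ltW.
by rewrite subr_le0.
Qed.

Lemma cont_hdist2 (T : topologicalType) (f g : T -> C) (x : T) :
  {for x, continuous f} -> {for x, continuous g} -> H (f x) -> H (g x) ->
  {for x, continuous (fun y => hdist2 (f y) (g y))}.
Proof.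
rewrite /H/= => cf cg Hf Hg.
have cn : {for x, continuous (fun y => nc (f y - g y))}.
  apply: (@cont_comp T C R (fun y => f y - g y : C) (fun z => nc z)); last exact: continuous_nc.
  by refine (@contD _ T f (fun y => - g y) x cf _); exact: contN.
have cI (h : T -> C) : {for x, continuous h} -> {for x, continuous (fun y => Im (h y))}.
  move=> ch; apply: (@cont_comp T C R h (fun z => Im z) x ch); exact: continuous_Im.
apply: (@contM R T (fun y => nc (f y - g y) ^+ 2)); first exact: (@contM R T _ _ x cn cn).
apply: (@contV R T (fun y => Im (f y) * Im (g y))); first by rewrite gt_eqF// mulr_gt0.
exact: (@contM R T (fun y => Im (f y)) (fun y => Im (g y)) x (cI _ cf) (cI _ cg)).
Qed.

Lemma continuous_hdist2l (w0 w : C) : H w0 -> H w ->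
  {for w, continuous (fun w : C => hdist2 w w0)}.
Proof.
move=> H0 Hw; have c1 : {for w, continuous (fun w : C => w : C)} by exact: cvg_id.
have c2 : {for w, continuous (fun _ : C => w0)} by exact: cont_cst.
exact: (cont_hdist2 c1 c2 Hw H0).
Qed.

End HyperbolicPlane.

Section SchwarzPick.
Context {R : realType}.
Local Notation C := (R[i]^o).
Local Notation nc := Normc.normc.
Local Notation Im := complex.Im.
Local Notation H := (@upper_half_plane R).
Implicit Types (a b c w : R[i]).

Lemma near_H a : H a -> \forall w \near (a : C), H w.
Proof.
move=> Ha; have : nbhs (Im a) [set x | 0 < x].
  by apply: open_nbhs_nbhs; split => //; exact: open_gt.
by move/(@continuous_Im R a); rewrite nbhs_filterE.
Qed.

(** The quotient is the Cayley transform centred at [b]; its modulus is [tanh (d/2)], and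
    [tanh^2 = sinh^2 / (sinh^2 + 1)]. *)
Lemma blaschke_sqr a b : H a -> H b ->
  nc ((a - b) / (a - b^*%C)) ^+ 2 = hdist2 a b / (hdist2 a b + 4).
Proof.
rewrite /H/= => Ha Hb; rewrite Normc.normcM ncV expr_div_n nc_sub_conj /hdist2.
have Hab : 0 < Im a * Im b by rewrite mulr_gt0.
set n := nc _ ^+ 2; set s := _ * _ in Hab *.
have n0 : 0 <= n by rewrite sqr_ge0.
have h : 0 < n + 4 * s by rewrite ltr_wpDl// mulr_gt0.
by field; rewrite !gt_eqF.
Qed.

(** Exhaustion of the half-plane by discs: [1 + 4 / k] is the inverse of [tanh^2 (d/2)] on the
    boundary circle [hdist2 = k], and it tends to [1]. *)
Lemma le_of_forall_hball (x v : R) :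
  (forall k, 0 < k -> v <= k -> x <= 1 + 4 / k) -> x <= 1.
Proof.
move=> h; apply/ler_addgt0Pr => e e_gt0.
pose k := Num.max (4 / e) (Num.max v 1).
have k_gt0 : 0 < k by rewrite !lt_max ltr01 !orbT.
apply: le_trans (h k k_gt0 _) _; first by rewrite !le_max lexx orbT.
rewrite lerD2l ler_pdivrMr// mulrC -ler_pdivrMr//.
by rewrite !le_max lexx.
Qed.

(** Schwarz's argument carried out in the half-plane: the quotient of the Blaschke factors of
    [phi w] and of [w] is bounded on each disc around [b] by its bound on the boundary circle, and
    the discs exhaust the half-plane. *)
Lemma schwarz_pick (phi : C -> C) : holomorphic_on H phi ->
  (forall z, H z -> H (phi z)) ->
  forall a b, H a -> H b -> hdist2 (phi a) (phi b) <= hdist2 a b.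
Proof.
move=> dphi Hphi a b Ha Hb; have [->|ab] := eqVneq a b.
  by rewrite /hdist2 !subrr Normc.normc0 expr0n !mul0r.
have [q [cq _ hq]] := derivable_slope (dphi _ Hb).
have Hc : H (phi b) by exact: Hphi.
(* The quotient of the two Blaschke factors, with [(phi w - phi b) / (w - b)] replaced by the slope
   [q], which gives it a continuous value at [b]. *)
pose g (w : C) : C := q w * (w - b^*%C) / (phi w - (phi b)^*%C).
pose F (w : C) := nc (g w) ^+ 2.
have cphi w : H w -> {for w, continuous phi}.
  by move=> Hw; apply: cdiff_continuous; exact: derivable_cdiff (dphi _ Hw).
have cid w : {for w, continuous (fun w : C => w : C)} by exact: cvg_id.
have cg w : H w -> {for w, continuous q} -> {for w, continuous g}.
  move=> Hw cqw.
  have c1 : {for w, continuous (fun w : C => w - b^*%C : C)}.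
    by refine (@contD _ C (fun w => w) _ w (cid w) _); exact: cont_cst.
  have c2 : {for w, continuous (fun w : C => phi w - (phi b)^*%C : C)}.
    by refine (@contD _ C phi _ w (cphi _ Hw) _); exact: cont_cst.
  refine (@contM _ C (fun w => q w * (w - b^*%C)) _ w (contM cqw c1) _).
  by refine (@contV _ C _ w _ c2); apply: sub_conj_neq0 => //; exact: Hphi.
have near_neq w : w != b -> \forall z \near (w : C), z != b.
  move=> wb; have c1 : {for w, continuous (fun w : C => w - b : C)}.
    by refine (@contD _ C (fun w => w) _ w (cid w) _); exact: cont_cst.
  have wb0 : (w : C) - b != 0 by rewrite subr_eq0.
  by have := @cont_neq0 _ C (fun w => w - b) w wb0 c1; apply: filterS => z; rewrite subr_eq0.
have qE w : w != b -> q w = (phi w - phi b) / (w - b).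
  by move=> wb; rewrite (hq w) addrAC subrr add0r mulfK// subr_eq0.
have dq w : H w -> w != b -> cdiff q w.
  move=> Hw wb; apply: (@cdiff_near _ (fun w => (phi w - phi b) / (w - b))).
    by move: (near_neq _ wb); apply: filterS => z /qE.
  apply: cdiffM; last apply: cdiffV.
  - by apply: cdiffB; [exact: derivable_cdiff (dphi _ Hw)|exact: cdiff_cst].
  - by rewrite subr_eq0.
  - by apply: cdiffB; [exact: cdiff_id|exact: cdiff_cst].
have dg w : H w -> w != b -> cdiff g w.
  move=> Hw wb; apply: cdiffM; first apply: cdiffM.
  - exact: dq.
  - by apply: cdiffB; [exact: cdiff_id|exact: cdiff_cst].
  apply: cdiffV; first by apply: sub_conj_neq0 => //; exact: Hphi.
  by apply: cdiffB; [exact: derivable_cdiff (dphi _ Hw)|exact: cdiff_cst].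
have FE w : H w -> w != b ->
    F w = (hdist2 (phi w) (phi b) / (hdist2 (phi w) (phi b) + 4)) /
          (hdist2 w b / (hdist2 w b + 4)).
  move=> Hw wb; rewrite -!blaschke_sqr//; last exact: Hphi.
  rewrite -expr_div_n -ncV -Normc.normcM /F /g qE// invfM invrK.
  have h (x y d e : R[i]) : x * y * d * e = x * e * (y * d) by ring.
  by rewrite h.
have cgH w : H w -> {for w, continuous g}.
  move=> Hw; have [->|wb] := eqVneq w b; first exact: cg.
  by apply: cdiff_continuous; exact: dg.
have F1 : F a <= 1.
  apply: (@le_of_forall_hball _ (hdist2 a b)) => k k_gt0 vk.
  apply: (@weak_maximum R (hball b k) F) => //.
  - exact: compact_hball.
  - exact: closed_hball.
  - move=> w /(hballP _ Hb k_gt0)[Hw _].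
    have c : {for w, continuous (fun w : C => nc (g w))}.
      by apply: (@cont_comp C C R g); [exact: cgH|exact: continuous_nc].
    exact: (@contM R C _ _ w c c).
  - move=> w /(hballP _ Hb k_gt0)[Hw wk] Fw.
    (* On the boundary circle the factor of [phi w] has modulus at most [1] and that of [w] has
       square modulus [k / (k + 4)], so [F] cannot exceed [1 + 4 / k] there. *)
    have wk' : hdist2 w b < k.
      rewrite lt_neqAle wk andbT; apply/eqP => wkE.
      have wb : w != b by rewrite -hdist2_gt0// wkE.
      move: Fw; rewrite FE// wkE ltNge => /negP; apply.
      have u0 : 0 <= hdist2 (phi w) (phi b) by apply: hdist2_ge0 => //; exact: Hphi.
      have k4 : 0 < k + 4 by rewrite addr_gt0.
      have u4 : 0 < hdist2 (phi w) (phi b) + 4 by rewrite ltr_wpDl.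
      rewrite invf_div [leRHS](_ : _ = 1 * ((k + 4) / k)); last first.
        by field; rewrite gt_eqF.
      apply: ler_wpM2r; first by rewrite divr_ge0// ltW.
      by rewrite ler_pdivrMr// mul1r lerDl.
    split; first exact: near_hball.
    move=> Fmax.
    have nmax : \forall z \near (w : C), nc (g z) <= nc (g w).
      by move: Fmax; apply: filterS => z; rewrite /F ler_pXn2r// nnegrE nc_ge0.
    have ndiff : \forall z \near (w : C), z != w -> cdiff g z.
      have [wb|wb] := eqVneq w b.
        by move: (near_H Hw); apply: filterS => z Hz; rewrite wb; exact: dg.
      by move: (near_H Hw) (near_neq _ wb); apply: filterS2 => z Hz zb _; exact: dg.
    move: (max_modulus_near (cgH _ Hw) ndiff nmax); apply: filterS => z.
    by rewrite /F => ->.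
  by apply/hballP.
have Ha' := Hphi _ Ha; move: F1; rewrite FE//.
have v0 : 0 < hdist2 a b by rewrite hdist2_gt0.
have u0 := hdist2_ge0 Ha' Hc.
set u := hdist2 (phi a) _ in u0 *; set v := hdist2 a b in v0 *.
have u4 : 0 < u + 4 by rewrite ltr_wpDl.
have v4 : 0 < v + 4 by rewrite addr_gt0.
have vv : 0 < v / (v + 4) by rewrite divr_gt0.
rewrite (ler_pdivrMr _ _ vv) mul1r (ler_pdivrMr _ _ u4) mulrAC (ler_pdivlMr _ _ v4).
by rewrite !mulrDr [v * u]mulrC lerD2l; clear; lra.
Qed.

Lemma autH_hdist2 (g : autH R) a b : H a -> H b ->
  hdist2 (g a) (g b) = hdist2 a b.
Proof.
move: g => [phi [psi [dphi dpsi Hphi Hpsi K]]] Ha Hb /=.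
apply/eqP; rewrite eq_le schwarz_pick//=.
by rewrite -{1}(K _ Ha).1 -{1}(K _ Hb).1 schwarz_pick//; exact: Hphi.
Qed.

End SchwarzPick.

(** * Local maxima of the distance between two holomorphic maps *)

Section LocalMaximum.
Context {R : realType}.
Local Notation C := (R[i]^o).
Local Notation nc := Normc.normc.
Local Notation Im := complex.Im.
Local Notation H := (@upper_half_plane R).

(* With [a = F1 z0], [b = F2 z0], the holomorphic function
   [(F1 - F2) / ((F1 - conj a) (F2 - conj b))] has, up to a constant factor,
   square modulus at most [hdist2 F1 F2], with equality only where [F1 = a] and
   [F2 = b]. *)
Lemma hdist2_local_max (F1 F2 Z : C -> C) (z0 : C) (n : nat) :
  (0 < n)%N ->
  (\forall z \near z0, [/\ cdiff F1 z, cdiff F2 z & cdiff Z z]) ->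
  (\forall z \near z0, H (F1 z) /\ H (F2 z)) ->
  F1 z0 != F2 z0 -> Z z0 != 0 ->
  (\forall z \near z0, hdist2 (F1 z) (F2 z) ^+ n * nc (Z z) ^+ 2 <=
                       hdist2 (F1 z0) (F2 z0) ^+ n * nc (Z z0) ^+ 2) ->
  \forall z \near z0, [/\ F1 z = F1 z0, F2 z = F2 z0 & nc (Z z) = nc (Z z0)].
Proof.
move=> n_gt0 nd nH F12 Z0 nmax.
set a := F1 z0 in F12 *; set b := F2 z0 in F12 *.
have [Ha Hb] : H a /\ H b := nbhs_singleton nH.
pose h (z : C) : C := (F1 z - F2 z) / ((F1 z - a^*%C) * (F2 z - b^*%C)).
pose k (z : C) : C := h z ^+ n * Z z.
(* This is [1 / cosh^2 (d/2)], equal to [1] exactly when [x = y]; it measures the loss between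
   [hdist2 F1 F2] and the square modulus of [h]. *)
pose t x y : R := 4 / (hdist2 x y + 4).
pose v z := hdist2 (F1 z) (F2 z).
have t01 x y : H x -> H y -> 0 < t x y <= 1.
  move=> Hx Hy; have d0 := hdist2_ge0 Hx Hy.
  have d4 : 0 < hdist2 x y + 4 by rewrite ltr_wpDl.
  by rewrite divr_gt0//= ler_pdivrMr// mul1r lerDr.
have t1 x y : H x -> H y -> t x y = 1 -> x = y.
  move=> Hx Hy; have d0 := hdist2_ge0 Hx Hy.
  have d4 : hdist2 x y + 4 != 0 by rewrite gt_eqF// ltr_wpDl.
  move=> /(congr1 ( *%R^~ (hdist2 x y + 4))); rewrite /t divfK// mul1r => e.
  by apply/eqP; apply: contraTT isT => xy; have := hdist2_gt0 Hx Hy; rewrite xy; lra.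
have hE z : H (F1 z) -> H (F2 z) ->
    nc (h z) ^+ 2 * (16 * (Im a * Im b)) = v z * (t (F1 z) a * t (F2 z) b).
  move=> H1 H2; rewrite /h Normc.normcM ncV Normc.normcM expr_div_n exprMn.
  rewrite !nc_sub_conj /v /t /hdist2; rewrite /H/= in H1 H2 Ha Hb.
  have p1 : 0 < nc (F1 z - a) ^+ 2 + 4 * (Im (F1 z) * Im a) by rewrite ltr_wpDl ?sqr_ge0// !mulr_gt0.
  have p2 : 0 < nc (F2 z - b) ^+ 2 + 4 * (Im (F2 z) * Im b) by rewrite ltr_wpDl ?sqr_ge0// !mulr_gt0.
  by field; rewrite !gt_eqF.
pose c := 16 * (Im a * Im b).
have c_gt0 : 0 < c by rewrite !mulr_gt0.
have kE z : H (F1 z) -> H (F2 z) ->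
    nc (k z) ^+ 2 * c ^+ n = v z ^+ n * nc (Z z) ^+ 2 * (t (F1 z) a * t (F2 z) b) ^+ n.
  move=> H1 H2; rewrite /k Normc.normcM ncX exprMn exprAC mulrAC -exprMn hE//.
  by rewrite exprMn mulrAC.
have taa x : t x x = 1.
  by rewrite /t /hdist2 subrr Normc.normc0 expr0n mul0r add0r divff.
have kE0 : nc (k z0) ^+ 2 * c ^+ n = v z0 ^+ n * nc (Z z0) ^+ 2.
  by rewrite kE// -/a -/b !taa mulr1 expr1n mulr1.
have kmax : \forall z \near z0, nc (k z) <= nc (k z0).
  move: nH nmax; apply: filterS2 => z [H1 H2] vz.
  rewrite -(@ler_pXn2r _ 2) ?nnegrE ?nc_ge0// -(@ler_pM2r _ (c ^+ n)) ?exprn_gt0//.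
  rewrite kE0 kE//; apply: le_trans vz.
  have /andP[p1 q1] := t01 _ _ H1 Ha; have /andP[p2 q2] := t01 _ _ H2 Hb.
  rewrite ler_piMr//; first by rewrite mulr_ge0 ?sqr_ge0// exprn_ge0// hdist2_ge0.
  have [p1' p2'] := (ltW p1, ltW p2).
  by apply: exprn_ile1; [exact: mulr_ge0|exact: mulr_ile1].
have dk : \forall z \near z0, z != z0 -> cdiff k z.
  move: nH nd; apply: filterS2 => z [H1 H2] [d1 d2 d3] _.
  apply: cdiffM => //; apply: cdiffX; apply: cdiffM; first exact: cdiffB.
  apply: cdiffV; first by rewrite mulf_neq0// sub_conj_neq0.
  by apply: cdiffM; apply: cdiffB => //; exact: cdiff_cst.
have ck : {for z0, continuous k}.
  apply: cdiff_continuous; have [d1 d2 d3] := nbhs_singleton nd.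
  apply: cdiffM => //; apply: cdiffX; apply: cdiffM; first exact: cdiffB.
  apply: cdiffV; first by rewrite mulf_neq0// sub_conj_neq0.
  by apply: cdiffM; apply: cdiffB => //; exact: cdiff_cst.
have v0_gt0 : 0 < v z0 by rewrite hdist2_gt0.
have Z0_gt0 : 0 < nc (Z z0) ^+ 2 by rewrite exprn_gt0// nc_gt0.
have kconst := max_modulus_near ck dk kmax.
move: nH nmax kconst; apply: filterS3 => z [H1 H2] vz kz.
have /andP[p1 q1] := t01 _ _ H1 Ha; have /andP[p2 q2] := t01 _ _ H2 Hb.
have e : v z ^+ n * nc (Z z) ^+ 2 * (t (F1 z) a * t (F2 z) b) ^+ n =
         v z0 ^+ n * nc (Z z0) ^+ 2 by rewrite -kE0 -kE// kz.
have vz_gt0 : 0 < v z ^+ n * nc (Z z) ^+ 2.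
  have := mulr_gt0 (exprn_gt0 n v0_gt0) Z0_gt0; rewrite -e pmulr_lgt0//.
  by rewrite exprn_gt0// mulr_gt0.
(* Since [|k|] is constant near [z0], the losses must be compensated by a value above the local
   maximum; hence there are none, and both factors [t] are [1]. *)
have tt1 : 1 <= (t (F1 z) a * t (F2 z) b) ^+ n.
  by rewrite -(ler_pM2l vz_gt0) mulr1 e.
have tt : t (F1 z) a * t (F2 z) b = 1.
  have [p1' p2'] := (ltW p1, ltW p2).
  apply/eqP; rewrite eq_le; apply/andP; split; first exact: mulr_ile1.
  rewrite leNgt; apply/negP => tlt; move: tt1; apply/negP; rewrite -ltNge.
  rewrite -(prednK n_gt0) exprS; apply: le_lt_trans (tlt).
  apply: ler_piMr; first exact: mulr_ge0.
  by apply: exprn_ile1; [exact: mulr_ge0|exact: ltW].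
have e1 : t (F1 z) a = 1.
  by apply/eqP; rewrite eq_le q1/= -tt ler_piMr// ltW.
have e2 : t (F2 z) b = 1 by rewrite -[LHS]mul1r -[in LHS]e1.
have E1 := t1 _ _ H1 Ha e1; have E2 := t1 _ _ H2 Hb e2; split=> //.
move: e; rewrite tt expr1n mulr1 /v E1 E2 => /mulfI e.
have : nc (Z z) ^+ 2 = nc (Z z0) ^+ 2.
  by apply: e; rewrite expf_neq0// gt_eqF.
by move/(congr1 Num.sqrt); rewrite !sqrtr_sqr !ger0_norm// nc_ge0.
Qed.

End LocalMaximum.

(** * Transfer of local statements through charts *)

Section Charts.
Context {R : realType} {X : topologicalType}.
Local Notation C := (R[i]^o).
Implicit Types (c : @chart R X) (u x : X) (z : C).

Lemma coordVP c z : (coord c @` dom c) z -> dom c (coordV c z) /\ coord c (coordV c z) = z.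
Proof. by move=> [x cx <-]; rewrite coordK. Qed.

Lemma near_img c u : dom c u -> \forall z \near coord c u, (coord c @` dom c) z.
Proof.
by move=> cu; apply: open_nbhs_nbhs; split; [exact: img_open|exists u].
Qed.

Lemma near_dom c u : dom c u -> \forall x \near u, dom c x.
Proof. by move=> cu; apply: open_nbhs_nbhs; split => //; exact: dom_open. Qed.

Lemma continuous_coord c u : dom c u -> {for u, continuous (coord c)}.
Proof.
move=> cu; have := @coord_continuous _ _ c.
by rewrite continuous_open_subspace; [apply; rewrite inE|exact: dom_open].
Qed.

Lemma continuous_coordV c u : dom c u -> {for coord c u, continuous (coordV c)}.
Proof.
move=> cu; have := @coordV_continuous _ _ c.
by rewrite continuous_open_subspace; [apply; rewrite inE; exists u|exact: img_open].
Qed.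

Lemma near_coordV c u (P : set X) : dom c u -> (\forall x \near u, P x) ->
  \forall z \near coord c u, P (coordV c z).
Proof.
move=> cu Pu; have := continuous_coordV cu; rewrite /prop_for /continuous_at coordK//.
by move=> /(_ _ Pu); rewrite nbhs_filterE.
Qed.

Lemma near_coord c u (Q : set C) : dom c u -> (\forall z \near coord c u, Q z) ->
  \forall x \near u, Q (coord c x).
Proof. by move=> cu Qu; have := continuous_coord cu Qu; rewrite nbhs_filterE. Qed.

Lemma near_chart c u (Q : set C) (P : set X) : dom c u ->
  (forall x, dom c x -> Q (coord c x) -> P x) ->
  (\forall z \near coord c u, Q z) -> \forall x \near u, P x.
Proof.
move=> cu QP /(near_coord cu) nQ; move: (near_dom cu) nQ.
by apply: filterS2 => x; exact: QP.
Qed.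

End Charts.

Section SurfaceLocalMaximum.
Context {R : realType} {X : riemann_surface R}.
Local Notation C := (R[i]^o).
Local Notation nc := Normc.normc.
Local Notation H := (@upper_half_plane R).
Implicit Types (c : @chart R X) (u : X) (f : X -> C).

Lemma holomorphic_fun_near c u (U : set X) f : atlas c -> dom c u -> nbhs u U ->
  holomorphic_fun U f -> \forall z \near coord c u, cdiff (f \o coordV c) z.
Proof.
move=> ac cu Uu hf; move: (near_img cu) (near_coordV cu Uu).
apply: filterS2 => z /coordVP[cz zE] Uz; apply: derivable_cdiff; apply: hf => //.
by exists (coordV c z).
Qed.

Lemma continuous_holomorphic f u : holomorphic_fun [set: X] f -> {for u, continuous f}.
Proof.
move=> hf; have [c ac cu] := atlas_cover u.
have nT : nbhs u [set: X] by exact: filterT.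
have d := nbhs_singleton (holomorphic_fun_near ac cu nT hf).
apply: (@cont_near X C (fun x => (f \o coordV c) (coord c x))).
  by move: (near_dom cu); apply: filterS => x cx /=; rewrite coordK.
apply: (@cont_comp X C C (coord c) (f \o coordV c)); first exact: continuous_coord.
exact: cdiff_continuous.
Qed.

Lemma surface_local_max (f1 f2 Z : X -> C) c u (n : nat) : (0 < n)%N ->
  atlas c -> dom c u ->
  holomorphic_fun [set: X] f1 -> holomorphic_fun [set: X] f2 ->
  (\forall z \near coord c u, cdiff (Z \o coordV c) z) ->
  (forall x, H (f1 x)) -> (forall x, H (f2 x)) ->
  f1 u != f2 u -> Z u != 0 ->
  (\forall x \near u, hdist2 (f1 x) (f2 x) ^+ n * nc (Z x) ^+ 2 <=
                      hdist2 (f1 u) (f2 u) ^+ n * nc (Z u) ^+ 2) ->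
  \forall x \near u, [/\ f1 x = f1 u, f2 x = f2 u & nc (Z x) = nc (Z u)].
Proof.
move=> n_gt0 ac cu h1 h2 hZ H1 H2 f12 Zu nmax.
have := @hdist2_local_max R (f1 \o coordV c) (f2 \o coordV c) (Z \o coordV c) (coord c u) n n_gt0.
rewrite /= !coordK// => hl.
apply: (near_chart cu) (hl _ _ f12 Zu _).
- by move=> x cx; rewrite coordK.
- have nT : nbhs u [set: X] by exact: filterT.
  move: (holomorphic_fun_near ac cu nT h1) (holomorphic_fun_near ac cu nT h2) hZ.
  by apply: filterS3 => z.
- by apply: filterE => z.
exact: (near_coordV cu nmax).
Qed.

Lemma surface_max_modulus (G : X -> C) c u : dom c u ->
  (\forall z \near coord c u, cdiff (G \o coordV c) z) ->
  (\forall x \near u, nc (G x) <= nc (G u)) ->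
  \forall x \near u, nc (G x) = nc (G u).
Proof.
move=> cu dG Gmax; have := @max_modulus_near R (G \o coordV c) (coord c u).
rewrite /= coordK// => mm; apply: (near_chart cu) (mm _ _ _).
- by move=> x cx; rewrite coordK.
- exact: cdiff_continuous (nbhs_singleton dG).
- by move: dG; apply: filterS.
- exact: (near_coordV cu Gmax).
Qed.

End SurfaceLocalMaximum.

(** * Coverings and deck transformations *)

Section Covering.
Context {X Y : topologicalType} {A : set Y} {p : X -> Y}.
Hypothesis hp : covering_of A p.

(** An evenly covered neighbourhood in usable form: [sheet x] is the sheet through [x], and [s x]
    the continuous section of [p] over [V] with values in that sheet. Both are meaningful only when
    [p x] lies in [V]. *)
Lemma covering_sheets y : A y -> exists V : set Y, exists sheet : X -> set X,
  exists s : X -> Y -> X, [/\ open V, V y, V `<=` A &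
  forall x, V (p x) -> [/\ open (sheet x), sheet x x,
    (forall x', sheet x x' -> V (p x') /\ sheet x' = sheet x),
    (forall y', V y' ->
       [/\ sheet x (s x y'), p (s x y') = y' & {for y', continuous (s x)}]) &
    forall x', sheet x x' -> s x (p x') = x']].
Proof.
case: hp => cp _ H /H[V [oV Vy VA [S [pV dS SW]]]].
have inS x : exists W, V (p x) -> S W /\ W x.
  have [Vx|nVx] := pselect (V (p x)); last by exists setT.
  have : (p @^-1` V) x by [].
  by rewrite pV => -[W SW' Wx]; exists W.
have [sheet hs] := choice inS.
have sheetU x W : S W -> W x -> V (p x) -> sheet x = W.
  by move=> sW Wx /hs[sx shx]; apply: (dS _ _ sx sW); exists x.
pose s x y' := xget x [set x' | sheet x x' /\ p x' = y'].
exists V, sheet, s; split=> // x Vx.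
have [Sx shx] := hs _ Vx; have [osh [funp injp surjp] openp] := SW _ Sx.
have sP y' : V y' -> sheet x (s x y') /\ p (s x y') = y'.
  by move=> /surjp[x' shx' px']; apply: (@xgetPex _ x [set x' | sheet x x' /\ p x' = y']); exists x'.
have sK x' : sheet x x' -> s x (p x') = x'.
  move=> shx'; have [h1 h2] := sP _ (funp _ shx').
  by apply: injp; rewrite ?inE.
split=> //.
  move=> x' shx'; have Vx' := funp _ shx'; split=> //; exact: sheetU.
move=> y' Vy'; have [h1 h2] := sP _ Vy'; split=> //.
(* The section is continuous because [p] maps open subsets of a sheet to open sets. *)
move=> N; rewrite nbhsE => -[G [oG Gy'] GN].
have oG' : open (p @` (G `&` sheet x)).
  by apply: openp; [exact: openI|move=> ? []].
rewrite nbhs_filterE; apply: (@filterS _ _ _ (p @` (G `&` sheet x))).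
  by move=> _ [x' [Gx' shx'] <-] /=; rewrite sK//; exact: GN.
by apply: open_nbhs_nbhs; split => //; exists (s x y').
Qed.

Lemma covering_continuous : continuous p.
Proof. by case: hp. Qed.

Lemma covering_range x : A (p x).
Proof. by case: hp => _ <- _; exists x. Qed.

Lemma covering_open x (N : set X) : nbhs x N -> nbhs (p x) (p @` N).
Proof.
move=> Nx; have [V [sheet [s [oV Vy VA]]]] := covering_sheets (covering_range x).
case/(_ x Vy) => osh shx _ sP sK.
have [_ _ cs] := sP _ Vy; have := cs N; rewrite sK// => /(_ Nx).
rewrite nbhs_filterE => h; have {}h : nbhs (p x) (s x @^-1` N) by [].
have nV : nbhs (p x) V by apply: open_nbhs_nbhs.
apply: filterS2 nV h => y' Vy' Ny'; exists (s x y') => //.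
by have [] := sP _ Vy'.
Qed.

Lemma lift_unique (T : topologicalType) (g h : T -> X) t0 :
  connected [set: T] -> continuous g -> continuous h ->
  (forall t, p (g t) = p (h t)) -> g t0 = h t0 -> g = h.
Proof.
move=> cT cg ch gh e0.
pose E := [set t | g t = h t].
(* While [g] and [h] stay in their sheets, they agree either everywhere or nowhere; the coincidence
   set is therefore both open and closed. *)
have sheets t : exists W1, exists W2, [/\ nbhs t (g @^-1` W1 `&` h @^-1` W2),
    W1 (g t), W2 (h t) & forall t', W1 (g t') -> W2 (h t') -> (g t' = h t' <-> g t = h t)].
  have [V [sheet [s [oV Vy VA H]]]] := covering_sheets (covering_range (g t)).
  have [ho1 s1 e1 sP1 sK1] := H _ Vy; rewrite gh in Vy.
  have [ho2 s2 e2 sP2 sK2] := H _ Vy.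
  exists (sheet (g t)), (sheet (h t)); split=> //.
    apply: filterI; [apply: cg|apply: ch]; exact: open_nbhs_nbhs.
  move=> t' h1 h2; split=> e; last first.
    by rewrite -(sK1 _ h1) gh -[RHS]sK1// e.
  have ee : sheet (g t) = sheet (h t).
    by rewrite -(e1 _ h1).2 -(e2 _ h2).2 e.
  by rewrite -[LHS]sK1// gh sK1// ee.
have oE : open E.
  rewrite openE => t Et; have [W1 [W2 [nW _ _ H]]] := sheets t.
  by apply: filterS nW => t' [h1 h2]; apply/(H _ h1 h2).
have cE : closed E.
  move=> t clE; have [W1 [W2 [nW _ _ H]]] := sheets t.
  by have [t' [Et' [h1 h2]]] := clE _ nW; apply/(H _ h1 h2).
have ET : E = setT.
  apply: cT; first by exists t0.
    by exists E => //; rewrite setTI.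
  by exists E => //; rewrite setTI.
by apply/funext => t; have : E t by rewrite ET.
Qed.

End Covering.

(** * Lifting of paths, squares and the plane *)

Section Clamp.
Context {R : realType}.
Implicit Types (a b s t : R).

(** The retraction of the line onto [[a, b]]: maps on a segment or a rectangle are extended by it,
    so that continuity always concerns the full space. *)
Definition clamp a b s := Num.max a (Num.min s b).

Lemma clamp_id a b s : a <= s <= b -> clamp a b s = s.
Proof. by move=> /andP[h1 h2]; rewrite /clamp min_l// max_r. Qed.

Lemma clamp_itv a b s : a <= b -> a <= clamp a b s <= b.
Proof.
by move=> ab; rewrite /clamp le_max lexx ge_max ab ge_min lexx orbT.
Qed.

Lemma clamp_splitl a m b s : a <= m -> m <= b -> s <= m -> clamp a b s = clamp a m s.
Proof. by move=> am mb sm; rewrite /clamp !min_l//; exact: le_trans mb. Qed.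

Lemma clamp_splitr a m b s : a <= m -> m <= b -> m <= s -> clamp a b s = clamp m b s.
Proof.
move=> am mb ms; rewrite /clamp !max_r// le_min ?ms ?mb// (le_trans am)// ?le_min ?ms//.
by rewrite (le_trans am).
Qed.

Lemma continuous_clamp a b : continuous (clamp a b).
Proof.
move=> s; apply: (@continuous_max R R (fun=> a) (fun s => Num.min s b)).
  exact: cont_cst.
apply: (@continuous_min R R id (fun=> b)); first exact: cvg_id.
exact: cont_cst.
Qed.

End Clamp.

Section Lifting.
Context {R : realType} {X Y : topologicalType} {A : set Y} {p : X -> Y}.
Hypothesis hp : covering_of A p.

Lemma connected_R : connected [set: R].
Proof. by apply/connected_intervalP => x y _ _ z _. Qed.

Lemma continuous_glue (T : topologicalType) (f : T -> R) (m : R) (g h : T -> X) :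
  continuous f -> continuous g -> continuous h -> (forall t, f t = m -> g t = h t) ->
  continuous (fun t => if f t <= m then g t else h t).
Proof.
move=> cf cg ch gh t; have [tm|tm|tm] := ltgtP (f t) m.
- have : nbhs (f t) [set x | x < m] by apply: open_nbhs_nbhs; split => //; exact: open_lt.
  move=> /(near_cont (cf t)) n.
  apply: (@cont_near T X g) (cg t).
  by apply: filterS n => t' /= /ltW ->.
- have : nbhs (f t) [set x | m < x] by apply: open_nbhs_nbhs; split => //; exact: open_gt.
  move=> /(near_cont (cf t)) n.
  apply: (@cont_near T X h) (ch t).
  by apply: filterS n => t' /=; rewrite leNgt => ->.
rewrite /continuous_at tm lexx => N Ng.
have Nh : nbhs (h t) N by rewrite -gh.
move: (near_cont (cg t) Ng) (near_cont (ch t) Nh).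
by apply: filterS2 => t' /= ? ?; case: ifP.
Qed.

Implicit Types (F : R * R -> Y) (G : R * R -> X).

(** Liftability over a rectangle from every point above its lower left corner; this quantification
    is what makes the property stable under gluing. *)
Definition rlift F (a b c d : R) : Prop := forall u, p u = F (a, c) ->
  exists G : R * R -> X, [/\ continuous G,
    forall s t, p (G (s, t)) = F (clamp a b s, clamp c d t) & G (a, c) = u].

Lemma cont_pair (T U V : topologicalType) (f : T -> U) (g : T -> V) x :
  {for x, continuous f} -> {for x, continuous g} ->
  {for x, continuous (fun y => (f y, g y))}.
Proof. by move=> cf cg; exact: (cvg_pair cf cg). Qed.

Lemma continuous_pairl (T U : topologicalType) (x : T) : continuous (fun y : U => (x, y)).
Proof. by move=> y; apply: (@cont_pair U T U (fun=> x) id); [exact: cvg_cst|exact: cvg_id]. Qed.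

Lemma continuous_pairr (T U : topologicalType) (x : T) : continuous (fun y : U => (y, x)).
Proof. by move=> y; apply: (@cont_pair U U T id (fun=> x)); [exact: cvg_id|exact: cvg_cst]. Qed.

Lemma rlift_swap F a b c d : rlift (fun q => F (q.2, q.1)) c d a b -> rlift F a b c d.
Proof.
move=> L u pu; have [G [cG pG Gu]] := L u pu.
exists (fun q => G (q.2, q.1)); split=> //= q.
apply: (@cont_comp _ _ _ (fun q : R * R => (q.2, q.1)) G); last exact: cG.
by apply: (@cont_pair _ _ _ snd fst); [exact: cvg_snd|exact: cvg_fst].
Qed.

(** The second lift starts where the first one ends on the bottom side; by uniqueness of lifts the
    two agree on the whole common side. *)
Lemma rlift_glue F a m b c d : a <= m -> m <= b -> c <= d ->
  rlift F a m c d -> rlift F m b c d -> rlift F a b c d.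
Proof.
move=> am mb cd L1 L2 u pu; have [G1 [cG1 pG1 G1u]] := L1 u pu.
have hc : clamp c d c = c by rewrite clamp_id// lexx.
have hm1 : clamp a m m = m by rewrite clamp_id// lexx andbT.
have hm2 : clamp m b m = m by rewrite clamp_id// lexx.
have [|G2 [cG2 pG2 G2m]] := L2 (G1 (m, c)); first by rewrite pG1 hm1 hc.
have e t : G1 (m, t) = G2 (m, t).
  have := @lift_unique X Y A p hp R (fun t => G1 (m, t)) (fun t => G2 (m, t)) c connected_R.
  move=> /(_ _ _ _ _)/(congr1 (@^~ t)); apply.
  - by move=> t'; apply: cont_comp (cG1 _); exact: continuous_pairl.
  - by move=> t'; apply: cont_comp (cG2 _); exact: continuous_pairl.
  - by move=> t'; rewrite pG1 pG2 hm1 hm2.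
  - by rewrite G2m.
exists (fun q => if q.1 <= m then G1 q else G2 q); split.
- apply: (@continuous_glue _ fst m G1 G2 _ cG1 cG2) => [q|[s t]/= ->//].
  exact: cvg_fst.
- move=> s t /=; case: ifPn => [sm|]; first by rewrite pG1 (clamp_splitl am mb sm).
  by rewrite -ltNge => /ltW ms; rewrite pG2 (clamp_splitr am mb ms).
- by rewrite /= am.
Qed.

(** By bisection: a small square is mapped into an evenly covered set, where a section of [p] lifts
    it, and four lifted quarters glue, in pairs along each direction. *)
Lemma rlift_square F x y l : continuous F -> (forall q, A (F q)) -> 0 < l ->
  rlift F x (x + l) y (y + l).
Proof.
move=> cF FA l_gt0.
pose P x y l := rlift F x (x + l) y (y + l).
apply: (@square_bisection R P) => //.
  move=> x1 y1 l1 _ _ _ _ l1_gt0; rewrite /P.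
  have e z : z + l1 / 2 + l1 / 2 = z + l1 by lra.
  rewrite !e => p1 p2 p3 p4.
  have [h1 h2] : (forall z, z <= z + l1 / 2) /\ (forall z, z + l1 / 2 <= z + l1).
    by split=> z; lra.
  have h3 z : z <= z + l1 := le_trans (h1 z) (h2 z).
  have q1 : rlift F x1 (x1 + l1) y1 (y1 + l1 / 2) by apply: (@rlift_glue F x1 (x1 + l1 / 2)).
  have q2 : rlift F x1 (x1 + l1) (y1 + l1 / 2) (y1 + l1) by apply: (@rlift_glue F x1 (x1 + l1 / 2)).
  apply: rlift_swap; apply: (@rlift_glue _ y1 (y1 + l1 / 2)) => //.
    exact: (@rlift_swap (fun q => F (q.2, q.1))).
  exact: (@rlift_swap (fun q => F (q.2, q.1))).
move=> x1 y1 _ _; have [V [sheet [s [oV Vy VA H]]]] := covering_sheets hp (FA (x1, y1)).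
have : nbhs (F (x1, y1)) V by apply: open_nbhs_nbhs.
move=> /(near_cont (cF _)) -[[U1 U2] /= [/nbhs_ballP[d1 /= d1_gt0 h1] /nbhs_ballP[d2 /= d2_gt0 h2]] HU].
exists (Num.min d1 d2); first by rewrite lt_min d1_gt0.
move=> x2 y2 l2 /andP[l2_gt0]; rewrite lt_min => /andP[ld1 ld2] _ _ _ _ hx hy u pu.
have inV s' t : V (F (clamp x2 (x2 + l2) s', clamp y2 (y2 + l2) t)).
  apply: HU; split => /=.
    apply: h1; rewrite /ball/= ltr_norml; have : x2 <= clamp x2 (x2 + l2) s' <= x2 + l2.
      by apply: clamp_itv; rewrite lerDl ltW.
    by move: hx ld1; clear; move=> /andP[? ?] ? /andP[? ?]; apply/andP; split; lra.
  apply: h2; rewrite /ball/= ltr_norml; have : y2 <= clamp y2 (y2 + l2) t <= y2 + l2.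
    by apply: clamp_itv; rewrite lerDl ltW.
  by move: hy ld2; clear; move=> /andP[? ?] ? /andP[? ?]; apply/andP; split; lra.
have hc z : clamp z (z + l2) z = z by rewrite clamp_id// lexx lerDl ltW.
have Vu : V (p u) by rewrite pu; have := inV x2 y2; rewrite !hc.
have [osh shu _ sP sK] := H _ Vu.
exists (fun q => s u (F (clamp x2 (x2 + l2) q.1, clamp y2 (y2 + l2) q.2))); split.
- move=> q; have [_ _ cs] := sP _ (inV q.1 q.2).
  apply: (@cont_comp _ _ _ (fun q : R * R => F (clamp x2 (x2 + l2) q.1, clamp y2 (y2 + l2) q.2))) cs.
  apply: (@cont_comp _ _ _ (fun q : R * R => (clamp x2 (x2 + l2) q.1, clamp y2 (y2 + l2) q.2)) F); last exact: cF.
  apply: (@cont_pair _ _ _ (fun q : R * R => clamp x2 (x2 + l2) q.1) (fun q : R * R => clamp y2 (y2 + l2) q.2)).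
    by apply: (@cont_comp _ _ _ fst (clamp x2 (x2 + l2))); [exact: cvg_fst|exact: continuous_clamp].
  by apply: (@cont_comp _ _ _ snd (clamp y2 (y2 + l2))); [exact: cvg_snd|exact: continuous_clamp].
- by move=> s' t /=; have [] := sP _ (inV s' t).
- by rewrite /= !hc -pu sK.
Qed.

End Lifting.

Section PlaneLift.
Context {R : realType} {X Y : topologicalType} {A : set Y} {p : X -> Y}.
Hypothesis hp : covering_of A p.

Lemma path_lift (a : R -> Y) u : continuous a -> (forall t, A (a t)) -> p u = a 0 ->
  exists b : R -> X, [/\ continuous b, forall t, p (b t) = a (clamp 0 1 t) & b 0 = u].
Proof.
move=> ca Aa pu.
have cF : continuous (fun q : R * R => a q.1).
  by move=> q; apply: (@cont_comp _ _ _ fst a); [exact: cvg_fst|exact: ca].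
have [|G [cG pG Gu]] := @rlift_square R X Y A p hp _ 0 0 1 cF _ ltr01 u pu; first by [].
exists (fun s => G (s, 0)); split=> // [s|t].
  by apply: cont_comp (cG _); exact: continuous_pairr.
by rewrite pG add0r.
Qed.

Lemma path_lift_unique (b1 b2 : R -> X) t0 : continuous b1 -> continuous b2 ->
  (forall t, p (b1 t) = p (b2 t)) -> b1 t0 = b2 t0 -> b1 = b2.
Proof. by move=> c1 c2; apply: (lift_unique hp connected_R c1 c2). Qed.

Lemma path_lift_eq (b1 b2 : R -> X) t0 t : continuous b1 -> continuous b2 ->
  (forall t, p (b1 t) = p (b2 t)) -> b1 t0 = b2 t0 -> b1 t = b2 t.
Proof. by move=> c1 c2 pb e; rewrite (path_lift_unique c1 c2 pb e). Qed.

Lemma continuous_ray (a b : R) : continuous (fun t : R => (clamp 0 1 t * a, clamp 0 1 t * b)).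
Proof.
move=> t; have c x : {for t, continuous (fun t : R => clamp 0 1 t * x)}.
  by apply: (@contM R R (clamp 0 1) (fun=> x)); [exact: continuous_clamp|exact: cont_cst].
exact: (@cont_pair _ _ _ (fun t : R => clamp 0 1 t * a) (fun t : R => clamp 0 1 t * b)).
Qed.

Lemma continuous_along_ray (Z : topologicalType) (G : R * R -> Z) (a b : R) :
  continuous G -> continuous (fun t : R => G (clamp 0 1 t * a, clamp 0 1 t * b)).
Proof.
move=> cG t.
exact: (@cont_comp _ _ _ (fun t : R => (clamp 0 1 t * a, clamp 0 1 t * b)) G t
          (@continuous_ray a b t) (cG _)).
Qed.

Lemma square_lift (F : R * R -> Y) (N : R) u : 0 < N -> continuous F ->
  (forall q, A (F q)) -> p u = F (0, 0) ->
  exists G : R * R -> X, [/\ continuous G,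
    forall q, `|q.1| <= N -> `|q.2| <= N -> p (G q) = F q & G (0, 0) = u].
Proof.
move=> N_gt0 cF FA pu.
(* Square lifts start at a corner, whereas the value is prescribed at the centre. The half-diagonal
   from the centre to the corner is lifted first; its end starts the square, and uniqueness along it
   recovers [G (0, 0) = u]. *)
pose a t := F (clamp 0 1 t * - N, clamp 0 1 t * - N).
have ca : continuous a.
  exact: continuous_along_ray.
have c0 : clamp 0 1 (0 : R) = 0 by rewrite clamp_id// lexx ler01.
have c1 : clamp 0 1 (1 : R) = 1 by rewrite clamp_id// lexx ler01.
have cc (t : R) : clamp 0 1 (clamp 0 1 t) = clamp 0 1 t by rewrite clamp_id// clamp_itv.
have [||b [cb pb b0]] := @path_lift a u ca; first by move=> t; exact: FA.
  by rewrite /a c0 mul0r.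
have e : - N + N *+ 2 = N by rewrite mulr2n addrA addNr add0r.
have N2_gt0 : 0 < N *+ 2 by rewrite mulrn_wgt0.
have [|G [cG pG Gu]] := @rlift_square R X Y A p hp F (- N) (- N) (N *+ 2) cF FA N2_gt0 (b 1).
  by rewrite pb c1 /a c1 mul1r.
exists G; split=> //.
  by move=> [s t] /=; rewrite !ler_norml => h1 h2; rewrite pG e !clamp_id.
have hb : (fun t => G (clamp 0 1 t * - N, clamp 0 1 t * - N)) = b.
  apply: (@path_lift_unique _ _ 1) => //.
  - exact: continuous_along_ray.
  - move=> t; rewrite pb /a cc pG e.
    have /andP[t0 t1] : 0 <= clamp 0 1 t <= 1 by exact: clamp_itv.
    have h : - N <= clamp 0 1 t * - N <= N.
      have N_ge0 := ltW N_gt0; rewrite mulrN lerN2 ler_piMl//=.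
      by apply: le_trans N_ge0; rewrite oppr_le0 mulr_ge0// ltW.
    by rewrite (clamp_id h).
  - by rewrite c1 mul1r.
by have := congr1 (@^~ 0) hb; rewrite /= c0 mul0r b0.
Qed.

Lemma plane_lift (F : R * R -> Y) u : continuous F -> (forall q, A (F q)) ->
  p u = F (0, 0) ->
  exists G : R * R -> X, [/\ continuous G, forall q, p (G q) = F q & G (0, 0) = u].
Proof.
move=> cF FA pu.
have /choice[G hG] : forall n : nat, exists G : R * R -> X, [/\ continuous G,
    forall q, `|q.1| <= n.+1%:R -> `|q.2| <= n.+1%:R -> p (G q) = F q & G (0, 0) = u].
  by move=> n; apply: square_lift.
pose inS (n : nat) (q : R * R) := `|q.1| <= n.+1%:R /\ `|q.2| <= n.+1%:R.
(* Lifts over two squares agree at the origin, hence along the segment from the origin to [q]. *)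
have agree n m q : inS n q -> inS m q -> G n q = G m q.
  move=> [n1 n2] [m1 m2]; have [cn pn un] := hG n; have [cm pm um] := hG m.
  have h := @path_lift_unique (fun t => G n (clamp 0 1 t * q.1, clamp 0 1 t * q.2))
    (fun t => G m (clamp 0 1 t * q.1, clamp 0 1 t * q.2)) 0.
  have c1 : clamp 0 1 (1 : R) = 1 by rewrite clamp_id// lexx ler01.
  have c0 : clamp 0 1 (0 : R) = 0 by rewrite clamp_id// lexx ler01.
  have hle t x (k : R) : `|x| <= k -> `|clamp 0 1 t * x| <= k.
    move=> xk; rewrite normrM; have /andP[t0 t1] : 0 <= clamp 0 1 t <= 1 by exact: clamp_itv.
    by rewrite (ger0_norm t0); apply: le_trans xk; rewrite ler_piMl.
  have /(congr1 (@^~ 1)) : (fun t => G n (clamp 0 1 t * q.1, clamp 0 1 t * q.2)) =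
      (fun t => G m (clamp 0 1 t * q.1, clamp 0 1 t * q.2)).
    apply: h.
    - exact: continuous_along_ray.
    - exact: continuous_along_ray.
    - by move=> t; rewrite pn ?pm//=; exact: hle.
    - by rewrite c0 !mul0r un um.
  by rewrite /= c1 !mul1r -surjective_pairing.
pose N (q : R * R) := Num.truncn (`|q.1| + `|q.2|).
have inN n q : `|q.1| + `|q.2| <= n.+1%:R -> inS n q.
  by move=> h; split; apply: le_trans h; rewrite (lerDl, lerDr).
have inNq q : inS (N q) q by apply: inN; rewrite ltW// Num.Theory.truncnS_gt.
exists (fun q => G (N q) q); split.
(* The index [N] jumps, but the additional [1] in [M] puts a whole neighbourhood of [q] in one
   square, where all choices agree with [G M]. *)
- move=> q; pose M := Num.truncn (`|q.1| + `|q.2| + 1).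
  have [cM _ _] := hG M.
  apply: (@cont_near _ _ (G M)) (cM q).
  have cn : {for q, continuous (fun q : R * R => `|q.1| + `|q.2|)}.
    apply: (@contD R _ (fun q : R * R => `|q.1|) (fun q : R * R => `|q.2|)).
      by apply: (@cont_comp _ _ _ fst (fun x : R => `|x|)); [exact: cvg_fst|exact: norm_continuous].
    by apply: (@cont_comp _ _ _ snd (fun x : R => `|x|)); [exact: cvg_snd|exact: norm_continuous].
  have nq : nbhs (`|q.1| + `|q.2|) [set x | x < `|q.1| + `|q.2| + 1].
    by apply: open_nbhs_nbhs; split; [exact: open_lt|rewrite /= ltrDl].
  move: (near_cont cn nq); apply: filterS => q' /= hq'.
  apply: agree; last exact: inNq.
  by apply: inN; apply: ltW; apply: lt_trans hq' (Num.Theory.truncnS_gt _).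
- by move=> q; have [_ h _] := hG (N q); have [] := inNq q; exact: h.
by have [_ _ h] := hG (N (0, 0)).
Qed.

End PlaneLift.

Section PathsWithin.
Context {R : realType} {T : topologicalType}.

Lemma clamp01 (t : R) : 0 <= clamp 0 1 t <= 1.
Proof. exact: clamp_itv. Qed.

Lemma continuous_within_clamp (a : R -> T) : {within `[0, 1], continuous a} ->
  continuous (fun t => a (clamp 0 1 t)).
Proof.
move=> /subspace_continuousP ca t N Na.
have h : `[0, 1]%classic (clamp 0 1 t) by rewrite /= in_itv/= clamp01.
have /(near_cont (@continuous_clamp R 0 1 t)) := ca _ h _ Na.
by apply: filterS => t' /=; apply; rewrite /= in_itv/= clamp01.
Qed.

Lemma continuous_within_clamp2 (F : R * R -> T) :
  {within `[0, 1] `*` `[0, 1], continuous F} ->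
  continuous (fun q : R * R => F (clamp 0 1 q.1, clamp 0 1 q.2)).
Proof.
move=> /subspace_continuousP cF q N Na.
have cc : {for q, continuous (fun q : R * R => (clamp 0 1 q.1, clamp 0 1 q.2))}.
  apply: (@cont_pair _ _ _ (fun q : R * R => clamp 0 1 q.1) (fun q : R * R => clamp 0 1 q.2)).
    by apply: (@cont_comp _ _ _ fst (clamp 0 1)); [exact: cvg_fst|exact: continuous_clamp].
  by apply: (@cont_comp _ _ _ snd (clamp 0 1)); [exact: cvg_snd|exact: continuous_clamp].
have h : (`[0, 1] `*` `[0, 1])%classic (clamp 0 1 q.1, clamp 0 1 q.2).
  by split; rewrite /= in_itv/= clamp01.
have /(near_cont cc) := cF _ h _ Na.
by apply: filterS => q' /=; apply; split; rewrite /= in_itv/= clamp01.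
Qed.

End PathsWithin.

(** * Transport of a point of a fibre along paths *)

Section PairsOfPaths.
Context {R : realType} {X Y : topologicalType} {A : set Y} {p : X -> Y}.
Hypothesis hp : covering_of A p.
Hypothesis sc : simply_connected R X.

(* [v'] is reached from [u'] by lifting the projection of a path from [u] to
   [v]. *)
Definition parallel (u u' v v' : X) : Prop := exists c1 c2 : R -> X,
  [/\ continuous c1, continuous c2, forall t, p (c1 t) = p (c2 t),
      c1 0 = u /\ c1 1 = v & c2 0 = u' /\ c2 1 = v'].

Lemma parallel_sym u u' v v' : parallel u u' v v' -> parallel u' u v' v.
Proof. by move=> [c1 [c2 [? ? ? ? ?]]]; exists c2, c1; split. Qed.

Lemma parallel_proj u u' v v' : parallel u u' v v' -> p v' = p v.
Proof. by move=> [c1 [c2 [_ _ h [_ <-] [_ <-]]]]. Qed.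

Lemma parallel_refl u u' : p u = p u' -> parallel u u' u u'.
Proof.
by move=> h; exists (cst u), (cst u'); split => // t; exact: cvg_cst.
Qed.

Let c0 : clamp 0 1 (0 : R) = 0. Proof. by rewrite clamp_id// lexx ler01. Qed.
Let c1 : clamp 0 1 (1 : R) = 1. Proof. by rewrite clamp_id// lexx ler01. Qed.
Let cc (t : R) : clamp 0 1 (clamp 0 1 t) = clamp 0 1 t.
Proof. by rewrite clamp_id// clamp01. Qed.

Lemma parallel_exists u u' v : p u = p u' -> exists v', parallel u u' v v'.
Proof.
move=> uu'; have [a [ca _ a0 a1]] := sc.1 u v.
have cb := continuous_within_clamp ca.
have cpb : continuous (fun t => p (a (clamp 0 1 t))).
  by move=> t; apply: (@cont_comp R X Y (fun t => a (clamp 0 1 t)) p); [exact: cb|exact: (covering_continuous hp)].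
have [||b [cb' pb b0]] := @path_lift R X Y A p hp _ u' cpb.
- by move=> t; exact: (covering_range hp).
- by rewrite c0 a0.
by exists (b 1), (fun t => a (clamp 0 1 t)), b; split=> //; rewrite ?c0 ?c1 // => t; rewrite pb cc.
Qed.

Lemma continuous_concat (a b : R -> X) : continuous a -> continuous b -> a 1 = b 0 ->
  continuous (concat a b).
Proof.
move=> ca cb ab; apply: (@continuous_glue R X R id 2^-1 (fun t => a (2 * t)) (fun t => b (2 * t - 1))).
- by move=> t; exact: cvg_id.
- move=> t; apply: (@cont_comp R R X (fun t => 2 * t) a); last exact: ca.
  by apply: (@contM R R (fun=> 2) id); [exact: cont_cst|exact: cvg_id].
- move=> t; apply: (@cont_comp R R X (fun t => 2 * t - 1) b); last exact: cb.
  apply: (@contD R R (fun t => 2 * t) (fun=> -1)); last exact: cont_cst.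
  by apply: (@contM R R (fun=> 2) id); [exact: cont_cst|exact: cvg_id].
- by move=> _ ->; rewrite divff// subrr.
Qed.

Lemma concat0 (a b : R -> X) : concat a b 0 = a 0.
Proof. by rewrite /concat invr_ge0 ler0n mulr0. Qed.

Lemma concat1 (a b : R -> X) : concat a b 1 = b 1.
Proof.
rewrite /concat lt_geF ?invf_lt1 ?ltr1n// mulr1.
by rewrite (_ : 2 - 1 = 1)//; ring.
Qed.

Lemma parallel_trans u u' v v' w w' :
  parallel u u' v v' -> parallel v v' w w' -> parallel u u' w w'.
Proof.
move=> [a1 [a2 [ca1 ca2 pa [a10 a11] [a20 a21]]]].
move=> [b1 [b2 [cb1 cb2 pb [b10 b11] [b20 b21]]]].
exists (concat a1 b1), (concat a2 b2); split.
- by apply: continuous_concat => //; rewrite a11 b10.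
- by apply: continuous_concat => //; rewrite a21 b20.
- by move=> t; rewrite /concat; case: ifP.
- by rewrite concat0 concat1.
- by rewrite concat0 concat1.
Qed.

(** Monodromy: a path followed by the reverse of another is null-homotopic in [X], and the
    projection of this homotopy is lifted again, now from [u']. *)
Lemma parallel_unique u u' v v1 v2 :
  parallel u u' v v1 -> parallel u u' v v2 -> v1 = v2.
Proof.
move=> [a1 [a2 [ca1 ca2 pa [a10 a11] [a20 a21]]]].
move=> [b1 [b2 [cb1 cb2 pb [b10 b11] [b20 b21]]]].
have rb1 : continuous (fun t : R => b1 (1 - t)).
  move=> t; apply: (@cont_comp R R X (fun t => 1 - t) b1); last exact: cb1.
  by apply: (@contD R R (fun=> 1) (fun t => - t)); [exact: cont_cst|apply: contN; exact: cvg_id].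
pose l := concat a1 (fun t => b1 (1 - t)).
have cl : continuous l by apply: continuous_concat => //; rewrite a11 subr0 b11.
have pl : path_in [set: X] u u l.
  split => //; [exact: continuous_subspaceT|by rewrite /l concat0|].
  by rewrite /l concat1 subrr.
have [F [cF _ F01 Fst]] := sc.2 _ _ pl.
pose K (q : R * R) := p (F (clamp 0 1 q.1, clamp 0 1 q.2)).
have cK : continuous K.
  move=> q; apply: (@cont_comp _ _ _ (fun q : R * R => F (clamp 0 1 q.1, clamp 0 1 q.2)) p).
    exact: (continuous_within_clamp2 cF).
  exact: (covering_continuous hp).
have uu' : p u = p u' by rewrite -a10 -a20 pa.
have z01 : 0 <= (0 : R) <= 1 by rewrite lexx ler01.
have o01 : 0 <= (1 : R) <= 1 by rewrite lexx ler01.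
have [||G [cG pG G0]] := @plane_lift R X Y A p hp K u' cK.
- by move=> q; exact: (covering_range hp).
- by rewrite /K /= c0 (Fst _ z01).1.
have cGl s : continuous (fun t => G (s, t)).
  by move=> t; apply: (@cont_comp R _ X (fun t => (s, t)) G); [exact: continuous_pairl|exact: cG].
have cGr s : continuous (fun t => G (t, s)).
  by move=> t; apply: (@cont_comp R _ X (fun t => (t, s)) G); [exact: continuous_pairr|exact: cG].
have const (b : R -> X) t0 : continuous b -> (forall t, p (b t) = p u') -> b t0 = u' ->
    forall t, b t = u'.
  move=> cb pb' bt0 t.
  apply: (@path_lift_eq R X Y A p hp b (fun=> u') t0 t cb _ pb' bt0).
  by move=> s; exact: cvg_cst.
(* On three sides of the square the projected homotopy is constant, so the lift keeps the value
   [u']; in particular the lifted loop on the side [s = 0] closes up. *)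
have Gs0 : forall s, G (s, 0) = u'.
  by apply: (const _ 0) => // t; rewrite pG /K /= c0 (Fst _ (clamp01 _)).1.
have G1t : forall t, G (1, t) = u'.
  by apply: (const _ 0) => // t; rewrite pG /K /= c1 (F01 _ (clamp01 _)).2.
have Gs1 : forall s, G (s, 1) = u'.
  by apply: (const _ 1) => // t; rewrite pG /K /= c1 (Fst _ (clamp01 _)).2.
have ch (f : R -> R) : continuous f -> continuous (fun t => G (0, f (clamp 0 1 t))).
  move=> cf t; apply: (@cont_comp R R X (fun t => f (clamp 0 1 t)) (fun t => G (0, t))); last exact: cGl.
  by apply: (@cont_comp R R R (clamp 0 1) f); [exact: continuous_clamp|exact: cf].
have chalf : continuous (fun t : R => t / 2).
  by move=> t; apply: (@contM R R id (fun=> 2^-1)); [exact: cvg_id|exact: cont_cst].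
have chalf' : continuous (fun t : R => 1 - t / 2).
  move=> t; apply: (@contD R R (fun=> 1) (fun t => - (t / 2))); first exact: cont_cst.
  by apply: (@contN R R (fun t => t / 2)); exact: chalf.
have ccl (b : R -> X) : continuous b -> continuous (fun t => b (clamp 0 1 t)).
  by move=> cb t; apply: (@cont_comp R R X (clamp 0 1) b); [exact: continuous_clamp|exact: cb].
have half01 t : 0 <= clamp 0 1 t / 2 <= (1 : R) /\ clamp 0 1 t / 2 <= (2^-1 : R).
  by have := clamp01 t; lra.
(* The midpoint of the side [s = 0] is reached from [t = 0] along [a2], which ends at [v1], and
   backwards from [t = 1] along [b2], which ends at [v2]. *)
have E1 : G (0, 2^-1) = v1.
  have := @path_lift_eq R X Y A p hp
    (fun t => G (0, clamp 0 1 t / 2)) (fun t => a2 (clamp 0 1 t)) 0 1 (ch _ chalf) (ccl _ ca2).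
  rewrite /= c1 c0 div1r mul0r G0 a20 a21; apply => // t.
  have [h1 h2] := half01 t.
  rewrite pG /K /= c0 (clamp_id h1) (F01 _ h1).1 /l /concat h2 -pa.
  by congr (p (a1 _)); field.
have E2 : G (0, 2^-1) = v2.
  have := @path_lift_eq R X Y A p hp
    (fun t => G (0, 1 - clamp 0 1 t / 2)) (fun t => b2 (clamp 0 1 t)) 0 1 (ch _ chalf') (ccl _ cb2).
  rewrite /= c1 c0 mul0r subr0 Gs1 b20 b21 (_ : 1 - 1 / 2 = 2^-1); last by field.
  apply => // t; have [h1 h2] := half01 t.
  have h3 : 0 <= 1 - clamp 0 1 t / 2 <= 1 by move: h1; lra.
  rewrite pG /K /= c0 (clamp_id h3) (F01 _ h3).1 /l /concat -pb.
  case: ifPn => h4.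
    have -> : clamp 0 1 t = 1 by have := clamp01 t; move: h4; lra.
    by rewrite b11 -a11; congr (p (a1 _)); field.
  by congr (p (b1 _)); field.
by rewrite -E1.
Qed.

End PairsOfPaths.

(** * Deck transformations of a simply connected covering *)

Section DeckTransformations.
Context {R : realType} {X : riemann_surface R} {Y : topologicalType} {A : set Y} {p : X -> Y}.
Hypothesis hp : covering_of A p.
Hypothesis sc : simply_connected R X.
Local Notation C := (R[i]^o).
Local Notation nc := Normc.normc.

Lemma locally_path_connected (v : X) (W : set X) : nbhs v W ->
  \forall x \near v, exists d : R -> X,
    [/\ continuous d, d 0 = v, d 1 = x & forall t, W (d t)].
Proof.
move=> Wv; have [c _ cv] := atlas_cover v.
move: (near_img cv) (near_coordV cv Wv) => /nbhsC[r1 r1_gt0 h1] /nbhsC[r2 r2_gt0 h2].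
pose r := Num.min r1 r2.
have hr : \forall z \near coord c v, nc (z - coord c v) < r.
  by apply/nbhsC; exists r => //; rewrite lt_min r1_gt0.
apply: (near_chart cv) hr => x cx; rewrite lt_min => /andP[xr1 xr2].
pose z (t : R) : C := coord c v + (clamp 0 1 t)%:C * (coord c x - coord c v).
have zr t s : nc (coord c x - coord c v) < s -> nc (z t - coord c v) < s.
  apply: le_lt_trans; rewrite /z addrC addKr Normc.normcM nc_real.
  have /andP[t0 t1] := clamp01 t.
  by rewrite ger0_norm// ler_piMl// nc_ge0.
exists (fun t => coordV c (z t)); split.
- move=> t; have /coordVP[cz zE] := h1 _ (zr t _ xr1).
  apply: (@cont_comp R C X z (coordV c)); last by rewrite -zE; exact: continuous_coordV.
  apply: (@contD R[i] R (fun=> coord c v)); first exact: cont_cst.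
  apply: (@contM R[i] R (fun t => (clamp 0 1 t)%:C : C)); last exact: cont_cst.
  by apply: continuous_Complex; [exact: continuous_clamp|exact: cont_cst].
- by rewrite /z clamp_id ?lexx ?ler01// mul0r addr0 coordK.
- by rewrite /z clamp_id ?lexx ?ler01// mul1r addrC subrK coordK.
- by move=> t; apply: h2; exact: zr.
Qed.

(** Near [v], points are joined to [v] by paths inside one sheet, along which transport is the
    projection followed by the section through [g v]; so [g] coincides there with a continuous
    map. *)
Lemma parallel_continuous (u u' : X) (g : X -> X) :
  (forall v, @parallel R X Y p u u' v (g v)) -> continuous g.
Proof.
move=> hg v.
have pg x : p (g x) = p x by exact: parallel_proj (hg x).
have [V [sheet [s [oV Vv VA H]]]] := covering_sheets hp (covering_range hp v).
have [osh shv shV _ _] := H _ Vv.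
have Vg : V (p (g v)) by rewrite pg.
have [_ shg _ sP sK] := H _ Vg.
have Wv : nbhs v (sheet v) by apply: open_nbhs_nbhs.
have ss : {for v, continuous (fun x => s (g v) (p x))}.
  apply: (@cont_comp _ _ _ p (s (g v))); first exact: (covering_continuous hp).
  by have [] := sP _ Vv.
apply: (@cont_near _ _ (fun x => s (g v) (p x))) ss.
move: (locally_path_connected Wv); apply: filterS => x [d [cd d0 d1 Wd]].
have Vd t : V (p (d t)) by have [] := shV _ (Wd t).
apply: (parallel_unique hp sc) (hg x).
apply: (parallel_trans (hg v)).
exists d, (fun t => s (g v) (p (d t))); split=> //.
- move=> t; apply: (@cont_comp R Y X (fun t => p (d t)) (s (g v))).
    by apply: (@cont_comp R X Y d p); [exact: cd|exact: (covering_continuous hp)].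
  by have [] := sP _ (Vd t).
- by move=> t; have [] := sP _ (Vd t).
- by rewrite d0 d1 -pg sK.
Qed.

(** Transport starting from the pair [(u, u')]; its inverse is the transport starting from
    [(u', u)]. *)
Lemma deck_transformation_exists (u u' : X) : p u = p u' ->
  exists2 g, deck_transformation p g & g u = u'.
Proof.
move=> uu'.
have [g hg] := choice (fun v => @parallel_exists R X Y A p hp sc u u' v uu').
have [h hh] := choice (fun v => @parallel_exists R X Y A p hp sc u' u v (esym uu')).
exists g; last first.
  exact: (parallel_unique hp sc) (hg u) (@parallel_refl R X Y p u u' uu').
split; [exact: parallel_continuous hg|by move=> x; exact: parallel_proj (hg x)|].
exists h; split; first exact: parallel_continuous hh.
- move=> x; apply: (parallel_unique hp sc) (hh _) _.
  exact: parallel_sym.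
- move=> x; apply: (parallel_unique hp sc) (hg _) _.
  exact: parallel_sym.
Qed.

(** The class is that of the projection of a path from [xt0] to [g xt0]. Equivariance thus applies
    to every deck transformation, hence to any two points of a fibre. *)
Lemma acts_by_exists (x0 : Y) (xt0 : X) (g : X -> X) : p xt0 = x0 ->
  deck_transformation p g -> exists gam : pi1 R A x0, acts_by p xt0 gam g.
Proof.
move=> px0 dg; have [a [ca _ a0 a1]] := sc.1 xt0 (g xt0).
pose b t := a (clamp 0 1 t).
have cb : continuous b := continuous_within_clamp ca.
have b0 : b 0 = xt0 by rewrite /b clamp_id// lexx ler01.
have b1 : b 1 = g xt0 by rewrite /b clamp_id// lexx ler01.
have cpb : continuous (p \o b).
  by move=> t; apply: (@cont_comp R X Y b p); [exact: cb|exact: (covering_continuous hp)].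
have pb : path_in A x0 x0 (p \o b).
  split.
  - exact: continuous_subspaceT.
  - by move=> t _; exact: (covering_range hp).
  - by rewrite /= b0.
  - by rewrite /= b1; case: dg => _ ->.
have hb : homotopic_in A x0 x0 (p \o b) (p \o b).
  exists (fun q => (p \o b) q.2); split.
  - apply: continuous_subspaceT => q.
    by apply: (@cont_comp _ R Y snd (p \o b)); [exact: cvg_snd|exact: cpb].
  - by move=> s t _ _; exact: (covering_range hp).
  - by [].
  - by move=> s _; case: pb.
exists (@Pi1 R Y A x0 (homotopy_class A x0 (p \o b)) (ex_intro2 _ _ _ pb erefl)).
split=> //; exists b; split=> //=.
split=> //; exact: continuous_subspaceT.
Qed.

End DeckTransformations.

(** * Behaviour near a puncture *)

Section ComplexLogarithm.
Context {R : realType}.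
Local Notation C := (R[i]^o).
Local Notation nc := Normc.normc.
Local Notation Re := complex.Re.
Local Notation Im := complex.Im.
Implicit Types (z w : R[i]).

(** The principal logarithm, meaningful on [Re z > 0] only; this suffices because it is applied to
    quotients close to [1]. *)
Definition clog z : R[i] := ln (nc z) +i* atan (Im z / Re z).

Lemma clogK z : 0 < Re z -> cexp (clog z) = z.
Proof.
move=> Rz; have nz : 0 < nc z.
  by rewrite nc_gt0; apply: contraTneq Rz => ->; rewrite ltxx.
set t := atan (Im z / Re z).
have ct : 0 < cos t by apply: cos_gt0_pihalf; rewrite atan_gtNpi2 atan_ltpi2.
have st : sin t = cos t * (Im z / Re z).
  by rewrite -(atanK (Im z / Re z)) -/t /tan mulrC divfK// gt_eqF.
have e : cos t * nc z = Re z.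
  apply/eqP; rewrite -(@eqrXn2 _ 2)// ?mulr_ge0 ?nc_ge0 ?ltW// exprMn nc_sqr.
  have := cos2Dsin2 t; rewrite st exprMn expr_div_n => h; apply/eqP.
  have Rz0 : Re z ^+ 2 != 0 by rewrite expf_neq0// gt_eqF.
  rewrite -[RHS]mulr1 -h; field; exact: lt0r_neq0.
rewrite /cexp /clog/= lnK ?posrE// -/t st mulrA [nc z * cos t]mulrC e mulrC divfK ?gt_eqF//.
by case: (z).
Qed.

Lemma cexpK z : - (pi / 2) < Im z < pi / 2 -> clog (cexp z) = z.
Proof.
move=> hz; have cz := cos_gt0_pihalf hz.
rewrite /clog nc_cexp expRK /cexp/= -mulf_div divff ?mul1r ?gt_eqF ?expR_gt0//.
by rewrite -/(tan _) tanK; [case: (z)|rewrite in_itv].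
Qed.

Lemma cdiff_clog (z0 : C) : 0 < Re z0 -> cdiff (clog : C -> C) z0.
Proof.
move=> Rz0; have z0_neq0 : z0 != 0 by apply: contraTneq Rz0 => ->; rewrite ltxx.
have [q cq hq] := cdiff_cexp (clog z0).
have nR : \forall z \near z0, 0 < Re z.
  have : nbhs (Re z0) [set x | 0 < x] by apply: open_nbhs_nbhs; split => //; exact: open_gt.
  by move/(@continuous_Re R z0); rewrite nbhs_filterE.
have gf : \forall z \near z0, cexp (clog z) = z.
  by move: nR; apply: filterS => z; exact: clogK.
(* If the slope vanished, a small real increment [d] would move [cexp] by less than [|z0| d],
   whereas it moves it by [|z0| (exp d - 1)], at least [|z0| d]. *)
have q0 : q (clog z0) != 0.
  have n0 : 0 < nc z0 by rewrite nc_gt0.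
  apply/eqP => qz0; move/cont_ncP: cq => /(_ _ n0)[d1 d1_gt0 h1].
  move/nbhsC: hq => [d2 d2_gt0 h2].
  pose d := Num.min d1 d2 / 2.
  have d_gt0 : 0 < d by rewrite divr_gt0// lt_min d1_gt0.
  have [dd1 dd2] : d < d1 /\ d < d2.
    by apply/andP; rewrite -lt_min /d ltr_pdivrMr// ltr_pMr ?ltr1n// lt_min d1_gt0.
  pose w : C := clog z0 + d%:C.
  have wE : w - clog z0 = d%:C by rewrite /w addrC addKr.
  have nw : nc (w - clog z0) = d by rewrite wE nc_real gtr0_norm.
  have := h2 w; have := h1 w; rewrite nw qz0 subr0 wE => /(_ dd1) a1 /(_ dd2) a2.
  have : nc (cexp w - cexp (clog z0)) < nc z0 * d.
    by rewrite a2 addrC addKr Normc.normcM nc_real gtr0_norm// ltr_pM2r.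
  rewrite /w cexpD clogK// -[X in _ - X]mulr1 -mulrBr Normc.normcM ltr_pM2l//.
  have -> : cexp d%:C - 1 = (expR d - 1)%:C.
    by apply: complex_ext; rewrite /cexp/= ?cos0 ?sin0 ?mulr1 ?mulr0 ?subr0.
  rewrite nc_real => /(le_lt_trans (ler_norm _)); rewrite ltNge.
  by have := expR_ge1Dx d; rewrite lerBrDl => ->.
have cl : {for z0, continuous (clog : C -> C)}.
  apply: (@continuous_Complex R C (fun z => ln (nc z)) (fun z => atan (Im z / Re z))).
    apply: (@cont_comp C R R (fun z => nc z) (@ln R)); first exact: continuous_nc.
    by apply: continuous_ln; rewrite nc_gt0.
  apply: (@cont_comp C R R (fun z => Im z / Re z) (@atan R)); last exact: continuous_atan.
  apply: (@contM R C (fun z => Im z) (fun z => (Re z)^-1)); first exact: continuous_Im.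
  by apply: (@contV R C (fun z => Re z)); [rewrite gt_eqF|exact: continuous_Re].
exact: (cdiff_inverse cl cq q0 hq gf).
Qed.

End ComplexLogarithm.

(** * Real inequalities for the growth near a puncture *)

Section RealEstimates.
Context {R : realType}.
Local Notation H := (@upper_half_plane R).

(* [htanh2 a b = tanh^2(d(a, b)/2)], with [d] the hyperbolic distance. *)
Definition htanh2 (a b : R[i]) : R := hdist2 a b / (hdist2 a b + 4).

Lemma bernoulli_ge (y : R) n : 0 <= y -> 1 + y *+ n <= (1 + y) ^+ n.
Proof.
move=> y0; elim: n => [|n IH]; first by rewrite mulr0n addr0 expr0.
rewrite exprS; have h : 0 <= 1 + y by rewrite addr_ge0.
apply: le_trans (ler_wpM2l h IH); rewrite mulrDl mul1r mulrS.
have : 0 <= y * (y *+ n) by rewrite mulr_ge0// mulrn_wge0.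
by rewrite mulrDr mulr1; clear; lra.
Qed.

Lemma bernoulli_le (x : R) n : 0 <= x <= 1 -> 1 - x ^+ n <= (1 - x) *+ n.
Proof.
move=> /andP[x0 x1]; elim: n => [|n IH]; first by rewrite expr0 subrr mulr0n.
have p1 : x ^+ n <= 1 by exact: exprn_ile1.
have p0 : 0 <= x ^+ n by exact: exprn_ge0.
have : 0 <= (1 - x) * (1 - x ^+ n) by rewrite mulr_ge0// subr_ge0.
rewrite exprS mulrS; move: IH; set q := x ^+ n; set m := _ *+ n.
by clear; nra.
Qed.

(** [5^-1] is the value of [htanh2] where [hdist2 = 1]. By Bernoulli,
    [(1 + 4 / D)^n >= 1 + 4 n / D >= 5]. *)
Lemma pow_frac_le (D : R) n : 0 < D -> D <= n%:R -> (D / (D + 4)) ^+ n <= 5^-1.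
Proof.
move=> D0 Dn; have D4 : 0 < D + 4 by rewrite addr_gt0.
have y0 : 0 <= 4 / D by rewrite divr_ge0// ltW.
have h := bernoulli_ge n y0.
have -> : D / (D + 4) = (1 + 4 / D)^-1 by field; rewrite !gt_eqF.
rewrite exprVn lef_pV2 ?posrE ?exprn_gt0// ?ltr_wpDr//.
apply: le_trans h; rewrite -mulr_natr.
have : 4 <= 4 / D * n%:R by rewrite mulrAC ler_pdivlMr// ler_pM2l.
by clear; lra.
Qed.

Lemma htanh2_ge0 a b : H a -> H b -> 0 <= htanh2 a b.
Proof. by move=> Ha Hb; have h := hdist2_ge0 Ha Hb; rewrite /htanh2 divr_ge0// addr_ge0. Qed.

Lemma htanh2_le1 a b : H a -> H b -> htanh2 a b <= 1.
Proof.
move=> Ha Hb; have h := hdist2_ge0 Ha Hb.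
by rewrite /htanh2 ler_pdivrMr ?mul1r ?lerDl// ltr_wpDl.
Qed.

Lemma le_frac (x y : R) : 0 <= x -> x <= y -> x / (x + 4) <= y / (y + 4).
Proof.
move=> x0 xy; have y0 := le_trans x0 xy.
have [x4 y4] : 0 < x + 4 /\ 0 < y + 4 by rewrite !ltr_wpDl.
rewrite ler_pdivrMr// mulrAC ler_pdivlMr// !mulrDr [y * x]mulrC lerD2l.
by move: xy; clear; lra.
Qed.

Lemma exp_decay (K d T0 : R) n : 0 < K -> 0 < d ->
  exists2 T, T0 < T & (K * T ^+ 2) ^+ n * expR (- (2 * T)) < d.
Proof.
move=> K0 d0; pose f : R := (n.*2.+1)`!%:R.
(* From [exp (2 T) >= T^(2n+1) / (2n+1)!], the claim follows as soon as
   [K^n T^(2n) < d T^(2n+1) / f], that is [T > M]. *)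
pose M := K ^+ n * f / d.
have f0 : 0 < f by rewrite ltr0n fact_gt0.
have Kn : 0 < K ^+ n by exact: exprn_gt0.
have M0 : 0 < M by rewrite !mulr_gt0// invr_gt0.
pose T := Num.max (M + 1) (T0 + 1); exists T.
  by rewrite lt_max ltrDl ltr01 orbT.
have MT : M < T by rewrite lt_max ltrDl ltr01.
have T_gt0 : 0 < T by exact: lt_trans MT.
have x0 : 0 <= 2 * T by rewrite mulr_ge0// ltW.
have := expR_ge1Dxn n.*2 x0; rewrite -/f => h.
have {}h : T ^+ n.*2.+1 / f <= expR (2 * T).
  apply: le_trans h; apply: (@le_trans _ _ ((2 * T) ^+ n.*2.+1 / f)); last by rewrite lerDr.
  rewrite ler_pM2r ?invr_gt0// lerXn2r ?nnegrE ?(ltW T_gt0)//.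
  by rewrite ler_pMl// ler1n.
rewrite expRN -(ltr_pdivlMr _ _ (_ : 0 < (expR (2 * T))^-1)) ?invr_gt0 ?expR_gt0// invrK.
apply: (@lt_le_trans _ _ (d * (T ^+ n.*2.+1 / f))); last by rewrite ler_pM2l.
rewrite exprMn -exprM mul2n exprSr mulrA mulrA.
rewrite [ltRHS](_ : _ = T ^+ n.*2 * (T * (d / f))); last by field; rewrite gt_eqF.
rewrite mulrC ltr_pM2l ?exprn_gt0//.
by move: MT; rewrite /M ltr_pdivrMr// => MT; rewrite mulrA ltr_pdivlMr.
Qed.

(** The factor [E] does not depend on [n], so it disappears when [n]-th roots are taken and [n]
    grows; Bernoulli's inequality replaces the limit. *)
Lemma le_of_pow_le (v m E : R) : 0 <= m ->
  (forall n, (0 < n)%N -> v ^+ n <= m ^+ n * E) -> v <= m.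
Proof.
move=> m0 h; rewrite leNgt; apply/negP => mv.
have v0 : 0 < v by exact: le_lt_trans mv.
move: m0; rewrite le_eqVlt => /orP[/eqP m0|m_gt0].
  by have := h 1%N isT; rewrite -m0 expr1 mul0r leNgt v0.
pose y := v / m - 1.
have y0 : 0 < y by rewrite subr_gt0 ltr_pdivlMr// mul1r.
pose n := (Num.truncn (E / y)).+1.
have hn : E / y < n%:R by exact: Num.Theory.truncnS_gt.
have := h n isT; rewrite mulrC -ler_pdivrMr ?exprn_gt0// -expr_div_n leNgt => /negP; apply.
have vm : 1 + y = v / m by rewrite /y addrC subrK.
have := bernoulli_ge n (ltW y0); rewrite vm; apply: lt_le_trans.
rewrite -[y *+ n]mulr_natl; move: hn; rewrite ltr_pdivrMr// => hn.
by apply: (lt_trans hn); rewrite ltrDr.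
Qed.

(** With [S = (Re w)^2] and [T = Im w], [hdist2 w i] is [(S + (T - 1)^2) / T]. This inequality says
    that it is at least [1]; the next one bounds it linearly in [T]. *)
Lemma le_sqr_sub1 (S T : R) : 3 <= T -> 0 <= S -> T <= S + (T - 1) ^+ 2.
Proof. nra. Qed.

Lemma sqr_sub1_le (P S T : R) : 3 <= T -> S <= P -> 0 <= P ->
  S + (T - 1) ^+ 2 <= ((P + 5) * T - 4) * T.
Proof.
move=> T3 SP P0; have T1 : 3 * T <= T ^+ 2 by rewrite expr2 ler_wpM2r//; lra.
have PT : 0 <= P * (T ^+ 2 - 1) by rewrite mulr_ge0//; lra.
have -> : ((P + 5) * T - 4) * T = P * (T ^+ 2 - 1) + P + 5 * T ^+ 2 - 4 * T by ring.
have -> : S + (T - 1) ^+ 2 = S + T ^+ 2 - 2 * T + 1 by ring.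
lra.
Qed.

End RealEstimates.

(** * The punctured disc and its covering by the half-plane *)

Section PuncturedDisc.
Context {R : realType} {Y X : riemann_surface R} {A : set Y} {p : X -> Y}.
Local Notation C := (R[i]^o).
Local Notation nc := Normc.normc.
Local Notation Re := complex.Re.
Local Notation Im := complex.Im.
Local Notation H := (@upper_half_plane R).
Hypothesis hp : covering_of A p.
Hypothesis holp : holomorphic_map p.
Variables (c : @chart R Y) (zq : R[i]) (r : R).
Hypothesis ac : atlas c.
Hypothesis r_gt0 : 0 < r.
Hypothesis discA : forall z : C, 0 < nc (z - zq) < r ->
  (coord c @` dom c) z /\ A (coordV c z).

(* The universal covering of the punctured disc by the half-plane. *)
Definition disc_exp (w : R[i]) : R[i] := zq + r%:C * cexp ('i * w).

Lemma disc_expB w : disc_exp w - zq = r%:C * cexp ('i * w).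
Proof. by rewrite /disc_exp addrC addKr. Qed.

Lemma nc_disc_exp w : nc (disc_exp w - zq) = r * expR (- Im w).
Proof.
rewrite /disc_exp addrC addKr Normc.normcM nc_real gtr0_norm// nc_cexp ReM/=.
by rewrite mul0r mul1r sub0r.
Qed.

Lemma disc_exp_in w : H w -> 0 < nc (disc_exp w - zq) < r.
Proof.
move=> Hw; rewrite nc_disc_exp mulr_gt0 ?expR_gt0//= gtr_pMr//.
by rewrite -expR0 ltr_expR oppr_lt0.
Qed.

Lemma disc_exp_neq w : disc_exp w - zq != 0.
Proof. by rewrite -nc_gt0 nc_disc_exp mulr_gt0// expR_gt0. Qed.

Lemma disc_exp_surj (z : R[i]) : 0 < nc (z - zq) ->
  exists w, [/\ z = disc_exp w, 0 <= Re w <= pi *+ 2 & Im w = - ln (nc (z - zq) / r)].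
Proof.
rewrite nc_gt0 => z0; have r0 : r%:C != 0 :> R[i].
  by rewrite -nc_gt0 nc_real normr_gt0 gt_eqF.
have q0 : (z - zq) / r%:C != 0 by rewrite mulf_neq0// invr_eq0.
have [t ht zE] := polar q0.
exists (t +i* (- ln (nc (z - zq) / r))); split => //.
rewrite /disc_exp.
have -> : 'i * (t +i* (- ln (nc (z - zq) / r))) = ln (nc ((z - zq) / r%:C)) +i* t.
  rewrite Normc.normcM ncV nc_real gtr0_norm//.
  by apply: complex_ext; rewrite ?ReM ?ImM/=; ring.
by rewrite -zE mulrC divfK// addrC subrK.
Qed.

Lemma cdiff_disc_exp (w : C) : cdiff (disc_exp : C -> C) w.
Proof.
apply: cdiffD; first exact: cdiff_cst.
apply: cdiffM; first exact: cdiff_cst.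
apply: (@cdiff_comp R[i] (fun w => 'i * w) cexp); last exact: cdiff_cexp.
by apply: cdiffM; [exact: cdiff_cst|exact: cdiff_id].
Qed.

Lemma continuous_coordV_disc (w : C) : H w -> {for disc_exp w : C, continuous (coordV c)}.
Proof.
move=> Hw; have [/coordVP[cw wE] _] := discA (disc_exp_in Hw).
by rewrite -{1}wE; exact: continuous_coordV.
Qed.

Lemma disc_lift : exists Phi : C -> X,
  (forall w, H w -> {for w, continuous Phi}) /\
  (forall w, H w -> p (Phi w) = coordV c (disc_exp w)).
Proof.
(* A homeomorphism from the plane onto the half-plane, through which [plane_lift] applies. *)
pose e (q : R * R) : C := q.1 +i* expR q.2.
have He q : H (e q) by rewrite /H/= expR_gt0.
pose F (q : R * R) := coordV c (disc_exp (e q)).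
have FA q : A (F q) by have [] := discA (disc_exp_in (He q)).
have cF : continuous F.
  move=> q; apply: (@cont_comp _ C Y (fun q => disc_exp (e q)) (coordV c)); last first.
    exact: continuous_coordV_disc.
  apply: (@cont_comp _ C C e disc_exp); last exact/cdiff_continuous/cdiff_disc_exp.
  apply: continuous_Complex; first exact: cvg_fst.
  by apply: (@cont_comp _ R R snd expR); [exact: cvg_snd|exact: continuous_expR].
have [u _ pu] : range p (F (0, 0)) by case: hp => _ -> _; exact: FA.
have [G [cG pG _]] := plane_lift hp cF FA pu.
exists (fun w => G (Re w, ln (Im w))); split=> w Hw.
  apply: (@cont_comp C _ X (fun w => (Re w, ln (Im w))) G); last exact: cG.
  apply: (@cont_pair C R R (fun w => Re w) (fun w => ln (Im w))); first exact: continuous_Re.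
  apply: (@cont_comp C R R (fun w => Im w) (@ln R)); first exact: continuous_Im.
  exact: continuous_ln.
rewrite pG /F /e/= lnK ?posrE//.
by congr (coordV c (disc_exp _)); case: (w).
Qed.

Variable Phi : C -> X.
Hypothesis cPhi : forall w, H w -> {for w, continuous Phi}.
Hypothesis pPhi : forall w, H w -> p (Phi w) = coordV c (disc_exp w).

Lemma dom_Phi w : H w -> dom c (p (Phi w)).
Proof. by move=> Hw; rewrite pPhi//; have [/coordVP[]] := discA (disc_exp_in Hw). Qed.

Lemma coord_Phi w : H w -> coord c (p (Phi w)) = disc_exp w.
Proof. by move=> Hw; rewrite pPhi//; have [/coordVP[]] := discA (disc_exp_in Hw). Qed.

Lemma cdiff_proj (d : @chart R X) u : atlas d -> dom d u -> dom c (p u) ->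
  \forall z \near coord d u, cdiff (coord c \o p \o coordV d) z.
Proof.
move=> ad du cu; move: (near_img du) (near_coordV du (near_cont (holp.1 u) (near_dom cu))).
apply: filterS2 => z /coordVP[dz zE] cz; apply: derivable_cdiff.
by apply: holp.2 => //; exists (coordV d z).
Qed.

(* [Phi] is a local homeomorphism; its local inverse is given by a branch of
   the logarithm of the coordinate, hence is holomorphic. *)
Lemma Phi_local_inverse w1 : H w1 -> exists L : X -> C,
  [/\ L (Phi w1) = w1,
      forall d : @chart R X, atlas d -> dom d (Phi w1) ->
        \forall z \near coord d (Phi w1), cdiff (L \o coordV d) z,
      {for Phi w1, continuous L},
      \forall u \near Phi w1, Phi (L u) = u &
      \forall w \near w1, L (Phi w) = w].
Proof.
move=> Hw1; set u1 := Phi w1.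
pose zeta u := coord c (p u) - zq.
have zeta1 : zeta u1 = disc_exp w1 - zq by rewrite /zeta coord_Phi.
have zeta1_neq0 : zeta u1 != 0 by rewrite zeta1 disc_exp_neq.
(* Solves [zeta u = r * exp (i w)] for [w] near [w1], after division by the same equation at
   [w1]. *)
pose L u : C := w1 - 'i * clog (zeta u / zeta u1).
have cu1 : dom c (p u1) by exact: dom_Phi.
have clog1 : clog (1 : R[i]) = 0.
  by rewrite /clog Normc.normc1 ln1/= mul0r atan0.
have L1 : L u1 = w1 by rewrite /L divff// clog1 mulr0 subr0.
have dL d : atlas d -> dom d u1 -> \forall z \near coord d u1, cdiff (L \o coordV d) z.
  move=> ad du; have dp := cdiff_proj ad du cu1.
  have dz : \forall z \near coord d u1, cdiff (fun z => zeta (coordV d z) / zeta u1 : C) z.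
    move: dp; apply: filterS => z hz.
    apply: cdiffM; last exact: cdiff_cst.
    by apply: (@cdiffB _ (coord c \o p \o coordV d)) => //; exact: cdiff_cst.
  have nR : \forall z \near coord d u1, 0 < Re (zeta (coordV d z) / zeta u1).
    have c1 := cdiff_continuous (nbhs_singleton dz).
    have : nbhs (Re (zeta (coordV d (coord d u1)) / zeta u1)) [set x | 0 < x].
      apply: open_nbhs_nbhs; split; first exact: open_gt.
      by rewrite /= coordK// divff//= ltr01.
    by move/(@continuous_Re R _)/c1; rewrite nbhs_filterE.
  move: dz nR; apply: filterS2 => z hz hR.
  apply: cdiffB; first exact: cdiff_cst.
  apply: cdiffM; first exact: cdiff_cst.
  by apply: (@cdiff_comp R[i] (fun z => zeta (coordV d z) / zeta u1) clog) => //; exact: cdiff_clog.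
have cL : {for u1, continuous L}.
  have [d ad du] := atlas_cover u1.
  apply: (@cont_near X C (fun u => (L \o coordV d) (coord d u))).
    by move: (near_dom du); apply: filterS => u du' /=; rewrite coordK.
  apply: (@cont_comp X C C (coord d) (L \o coordV d)); first exact: continuous_coord.
  exact: cdiff_continuous (nbhs_singleton (dL d ad du)).
have cz : {for u1, continuous (fun u => zeta u / zeta u1 : C)}.
  apply: (@contM R[i] X (fun u => zeta u : C)); last exact: cont_cst.
  apply: (@contD R[i] X (fun u => coord c (p u) : C)); last exact: cont_cst.
  apply: (@cont_comp X Y C p (coord c)); first exact: (covering_continuous hp).
  exact: continuous_coord.
have nRu : \forall u \near u1, 0 < Re (zeta u / zeta u1).
  have : nbhs (Re (zeta u1 / zeta u1)) [set x | 0 < x].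
    apply: open_nbhs_nbhs; split; first exact: open_gt.
    by rewrite /= divff//= ltr01.
  by move/(@continuous_Re R _)/cz; rewrite nbhs_filterE.
have nH : \forall u \near u1, H (L u).
  have : nbhs (L u1) H by rewrite L1; exact: near_H.
  by move/cL; rewrite nbhs_filterE.
have r0 : r%:C != 0 :> R[i] by rewrite -nc_gt0 nc_real normr_gt0 gt_eqF.
have pPL : \forall u \near u1, p (Phi (L u)) = p u.
  have ncu : \forall u \near u1, dom c (p u).
    by apply: near_cont (near_dom cu1); exact: (covering_continuous hp).
  move: nRu nH ncu; apply: filterS3 => u hR hH hc.
  rewrite pPhi// -[RHS](coordK hc); congr (coordV c _).
  have -> : coord c (p u) = zq + zeta u by rewrite /zeta addrC subrK.
  rewrite /disc_exp; congr (_ + _).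
  rewrite /L mulrBr mulrA -expr2 sqr_i mulN1r opprK cexpD clogK//.
  move: zeta1; rewrite /disc_exp addrC addKr => ->.
  by rewrite mulrA mulrC divfK// mulf_neq0// cexp_neq0.
(* By continuity of [Phi] and [L], both points lie in the sheet of [u1], and they have the same
   projection. *)
have PhiL : \forall u \near u1, Phi (L u) = u.
  have [V [sheet [s [oV Vy VA HV]]]] := covering_sheets hp (covering_range hp u1).
  have [osh shu _ sP sK] := HV _ Vy.
  have Wu : nbhs u1 (sheet u1) by apply: open_nbhs_nbhs.
  have cPL : {for u1, continuous (fun u => Phi (L u))}.
    by apply: (@cont_comp X C X L Phi); [exact: cL|rewrite L1; exact: cPhi].
  have WPL : \forall u \near u1, sheet u1 (Phi (L u)).
    by apply: (near_cont cPL); rewrite L1.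
  move: pPL Wu WPL; apply: filterS3 => u e1 e2 e3.
  by rewrite -(sK _ e3) e1 sK.
exists L; split => //.
have p2 : 0 < pi / 2 :> R by rewrite divr_gt0// pi_gt0.
(* Within this radius the exponent [i (w - w1)] has imaginary part in the range of the principal
   branch. *)
have nw : \forall w \near w1, nc (w - w1) < pi / 2 by apply/nbhsC; exists (pi / 2).
move: nw (near_H Hw1); apply: filterS2 => w hw Hw.
rewrite /L; have -> : zeta (Phi w) / zeta u1 = cexp ('i * (w - w1)).
  rewrite zeta1 /zeta coord_Phi// !disc_expB.
  have -> : cexp ('i * w) = cexp ('i * (w - w1)) * cexp ('i * w1).
    by rewrite -cexpD -mulrDr subrK.
  by rewrite mulrCA mulfK// mulf_neq0// cexp_neq0.
rewrite cexpK.
  by rewrite mulrA -expr2 sqr_i mulN1r opprK addrC subrK.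
rewrite ImM/= mul0r mul1r add0r -ltr_norml.
by apply: le_lt_trans hw; exact: Re_le_nc.
Qed.

Let i0 : R[i] := 'i.
Let Hi0 : H i0. Proof. exact: ltr01. Qed.
(** The maximum principle is applied on [X], where [f] and the local inverse [L] of [Phi] are
    holomorphic: [F] read through [L] is the square modulus of [B^n / b], with [B] and [b] the
    Blaschke factors of [f] and of [L]. *)
Lemma Phi_local_max (f : X -> C) (a : R[i]) (n : nat) (z : C) :
  holomorphic_fun [set: X] f -> (forall x, H (f x)) -> H a -> H z -> z != i0 ->
  let F (w : C) := htanh2 (f (Phi w)) a ^+ n / htanh2 w i0 in
  (\forall w \near z, F w <= F z) -> \forall w \near z, F w = F z.
Proof.
move=> hf Hf Ha Hz zi F Fmax.
have [L [Lz dL cL PL LP]] := Phi_local_inverse Hz; set u1 := Phi z in Lz dL cL PL.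
pose B x : C := (f x - a) / (f x - a^*%C).
pose b u : C := (L u - i0) / (L u - i0^*%C).
pose G u : C := B u ^+ n / b u.
have GE u : H (L u) -> Phi (L u) = u -> nc (G u) ^+ 2 = F (L u).
  move=> HL PLu; rewrite /G Normc.normcM ncX ncV exprMn -exprM mulnC exprM exprVn.
  by rewrite /B /b !blaschke_sqr// /F PLu.
have nHL : \forall u \near u1, H (L u).
  have : nbhs (L u1) H by rewrite Lz; exact: near_H.
  by move/cL; rewrite nbhs_filterE.
have n0 : \forall u \near u1, L u != i0.
  have cLi : {for u1, continuous (fun u => L u - i0 : C)}.
    by refine (@contD _ X L (fun=> - i0) u1 cL _); exact: cont_cst.
  have L0 : L u1 - i0 != 0 by rewrite Lz subr_eq0.
  by have := cont_neq0 L0 cLi; apply: filterS => u; rewrite subr_eq0.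
have Gu1 : nc (G u1) ^+ 2 = F z by rewrite GE ?Lz.
have Gmax : \forall u \near u1, nc (G u) <= nc (G u1).
  have nF : \forall u \near u1, F (L u) <= F z.
    have : nbhs (L u1) [set w | F w <= F z] by rewrite Lz.
    by move/cL; rewrite nbhs_filterE.
  move: nHL PL nF; apply: filterS3 => u HL PLu FL.
  by rewrite -(@ler_pXn2r _ 2) ?nnegrE ?nc_ge0// Gu1 GE.
have [d ad du] := atlas_cover u1.
have dG : \forall x \near coord d u1, cdiff (G \o coordV d) x.
  have nT : nbhs u1 [set: X] by exact: filterT.
  have nI : \forall u \near u1, H (L u) /\ L u != i0.
    by move: nHL n0; apply: filterS2.
  move: (holomorphic_fun_near ad du nT hf) (dL d ad du) (near_coordV du nI).
  apply: filterS3 => x df dLx [HL L0].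
  apply: cdiffM.
    apply: cdiffX; apply: cdiffM; first by apply: cdiffB => //; exact: cdiff_cst.
    apply: cdiffV; first exact: sub_conj_neq0.
    by apply: cdiffB => //; exact: cdiff_cst.
  apply: cdiffV; first by rewrite mulf_neq0// ?invr_eq0 ?sub_conj_neq0// subr_eq0.
  apply: cdiffM; first by apply: cdiffB => //; exact: cdiff_cst.
  apply: cdiffV; first exact: sub_conj_neq0.
  by apply: cdiffB => //; exact: cdiff_cst.
have Gc := surface_max_modulus du dG Gmax.
have Gc' := near_cont (cPhi Hz) Gc.
move: (near_H Hz) LP Gc'; apply: filterS3 => w Hw LPw Gw.
have := GE (Phi w); rewrite LPw => /(_ Hw erefl) <-.
by rewrite Gw Gu1.
Qed.

(** A weak Schwarz-Pick estimate for [f] composed with [Phi]: outside the disc [hdist2 w i <= 1],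
    the [N]-th power of [htanh2] of the images is at most [htanh2 w i]. The power [N] is chosen so
    that this holds on the inner circle; near infinity [htanh2 w i] tends to [1]. *)
Lemma Phi_growth (f : X -> C) : holomorphic_fun [set: X] f -> (forall x, H (f x)) ->
  exists2 N : nat, (0 < N)%N & forall w, H w -> 1 <= hdist2 w i0 ->
    hdist2 (f (Phi w)) (f (Phi i0)) + 4 <= N%:R * (hdist2 w i0 + 4).
Proof.
move=> hf Hf; pose a := f (Phi i0).
have Ha : H a by exact: Hf.
have cfP w : H w -> {for w, continuous (fun w : C => f (Phi w))}.
  move=> Hw; apply: (@cont_comp C X C Phi f); first exact: cPhi.
  exact: continuous_holomorphic.
have cD w : H w -> {for w, continuous (fun w : C => hdist2 (f (Phi w)) a)}.
  by move=> Hw; apply: cont_hdist2 => //; [exact: cfP|exact: cont_cst].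
have cv w : H w -> {for w, continuous (fun w : C => hdist2 w i0)}.
  by move=> Hw; exact: continuous_hdist2l.
have [||w0] := @compact_EVT_max C R (fun w => hdist2 (f (Phi w)) a) (hball i0 1)
    _ (compact_hball Hi0 ltr01).
- exists i0; apply/hballP => //; split => //.
  by rewrite /hdist2 subrr Normc.normc0 expr0n mul0r ler01.
- by apply: continuous_in_subspaceT => w; rewrite inE => /(hballP _ Hi0 ltr01)[Hw _]; exact: cD.
rewrite inE => /(hballP _ Hi0 ltr01)[Hw0 _] max0.
pose D := Num.max 1 (hdist2 (f (Phi w0)) a).
have D_gt0 : 0 < D by rewrite lt_max ltr01.
pose N := (Num.truncn D).+1.
have DN : D <= N%:R by rewrite ltW// Num.Theory.truncnS_gt.
exists N => // w Hw w1.
pose F (w : C) := htanh2 (f (Phi w)) a ^+ N / htanh2 w i0.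
have be_gt0 z : H z -> 1 <= hdist2 z i0 -> 0 < htanh2 z i0.
  move=> Hz z1; have z0 : 0 < hdist2 z i0 by apply: lt_le_trans z1.
  by rewrite /htanh2 divr_gt0// addr_gt0.
have F1 : F w <= 1.
  apply: (@le_of_forall_hball _ _ (hdist2 w i0)) => k k_gt0 wk.
  (* The closed annulus [1 <= hdist2 z i <= k], with denominators cleared; it avoids the pole of [F]
     at [i]. *)
  pose K := hball i0 k `&` [set z | - (nc (z - i0) ^+ 2 - 1 * (Im z * Im i0)) <= 0].
  have KP z : K z <-> [/\ H z, 1 <= hdist2 z i0 & hdist2 z i0 <= k].
    rewrite /K; split.
      move=> [/(hballP _ Hi0 k_gt0)[Hz zk]] /=; rewrite oppr_le0 subr_ge0 => z1; split=> //.
      by rewrite /hdist2 ler_pdivlMr// mulr_gt0.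
    move=> [Hz z1 zk]; split; first by apply/hballP.
    rewrite /= oppr_le0 subr_ge0.
    by move: z1; rewrite /hdist2 ler_pdivlMr// mulr_gt0.
  have clK : closed K.
    apply: closedI; first exact: closed_hball.
    apply: (@closed_realC R (fun z => - (nc (z - i0) ^+ 2 - 1 * (Im z * Im i0)))).
    move=> z; have ch := @continuous_hball R i0 1 z.
    exact: (@contN R C _ z ch).
  have cK : compact K.
    by apply: (@subclosed_compact _ K (hball i0 k)) => //; [exact: compact_hball|move=> z []].
  apply: (@weak_maximum R K F) => //; last by apply/KP.
  - move=> z /KP[Hz z1 zk].
    have ch (g : C -> R) : {for z, continuous g} -> g z + 4 != 0 ->
        {for z, continuous (fun z : C => g z / (g z + 4))}.
      move=> cg g4; apply: (@contM R C g (fun z => (g z + 4)^-1) z cg).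
      apply: (@contV R C (fun z => g z + 4)) => //.
      by apply: (@contD R C g (fun=> 4) z cg); exact: cont_cst.
    have d4 x y : H x -> H y -> hdist2 x y + 4 != 0.
      by move=> Hx Hy; rewrite gt_eqF// ltr_wpDl// hdist2_ge0.
    apply: (@contM R C (fun z => htanh2 (f (Phi z)) a ^+ N)).
      by apply: (@contX R C (fun z => htanh2 (f (Phi z)) a)); apply: ch; [exact: cD|exact: d4].
    apply: (@contV R C (fun z => htanh2 z i0)); first by rewrite gt_eqF// be_gt0.
    by apply: ch; [exact: cv|exact: d4].
  - move=> z /KP[Hz z1 zk] Fz.
    have HfP : H (f (Phi z)) by exact: Hf.
    have z1' : 1 < hdist2 z i0.
      rewrite lt_neqAle z1 andbT; apply/eqP => zE.
      move: Fz; rewrite ltNge => /negP; apply.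
      apply: (@le_trans _ _ 1); last by rewrite lerDl divr_ge0// ltW.
      rewrite /F ler_pdivrMr ?be_gt0// mul1r.
      have -> : htanh2 z i0 = 5^-1 by rewrite /htanh2 -zE div1r; congr (_^-1); ring.
      apply: le_trans (pow_frac_le D_gt0 DN); apply: lerXn2r.
      - by rewrite nnegrE; exact: htanh2_ge0.
      - by rewrite nnegrE divr_ge0// ?addr_ge0// ltW.
      apply: le_frac; first exact: hdist2_ge0.
      rewrite le_max; apply/orP; right; apply: max0; rewrite inE.
      by apply/(hballP _ Hi0 ltr01); rewrite -zE.
    have zk' : hdist2 z i0 < k.
      rewrite lt_neqAle zk andbT; apply/eqP => zE.
      move: Fz; rewrite ltNge => /negP; apply.
      rewrite /F ler_pdivrMr ?be_gt0// /htanh2 zE.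
      have -> : (1 + 4 / k) * (k / (k + 4)) = 1.
        by field; rewrite !gt_eqF// addr_gt0.
      by apply: exprn_ile1; [exact: htanh2_ge0|exact: htanh2_le1].
    split.
      have n1 : \forall w \near z, 1 < hdist2 w i0.
        have : nbhs (hdist2 z i0) [set x | 1 < x].
          by apply: open_nbhs_nbhs; split => //; exact: open_gt.
        by move/(cv _ Hz); rewrite nbhs_filterE.
      have := near_hball zk' Hz Hi0; move: n1; apply: filterS2 => w' w1' /(hballP _ Hi0 k_gt0)[Hw' wk'].
      by apply/KP; split => //; exact: ltW.
    apply: Phi_local_max => //.
    by rewrite -hdist2_gt0//; apply: lt_trans z1'.
have be1 := be_gt0 _ Hw w1.
have HfP : H (f (Phi w)) by exact: Hf.
have u4 : 0 < hdist2 (f (Phi w)) a + 4 by rewrite ltr_wpDl// hdist2_ge0.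
have v4 : 0 < hdist2 w i0 + 4 by rewrite ltr_wpDl// hdist2_ge0.
move: F1; rewrite /F (ler_pdivrMr _ _ be1) mul1r => F1.
(* Since [1 - htanh2 = 4 / (hdist2 + 4)], Bernoulli turns the bound on the [N]-th power into the
   linear bound with factor [N]. *)
have := bernoulli_le N (_ : 0 <= htanh2 (f (Phi w)) a <= 1).
rewrite htanh2_ge0// htanh2_le1// => /(_ isT) hb.
have : 1 - htanh2 w i0 <= (1 - htanh2 (f (Phi w)) a) *+ N by apply: le_trans hb; rewrite lerD2l lerN2.
have e (x : R) : 0 < x + 4 -> 1 - x / (x + 4) = 4 / (x + 4) by move=> x4; field; rewrite gt_eqF.
rewrite /htanh2 !e// -[X in _ <= X -> _]mulr_natl mulrA (ler_pdivrMr _ _ v4) mulrAC (ler_pdivlMr _ _ u4).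
by rewrite -mulrA mulrCA ler_pM2l.
Qed.

Variables f1 f2 : X -> C.
Hypothesis hf1 : holomorphic_fun [set: X] f1.
Hypothesis hf2 : holomorphic_fun [set: X] f2.
Hypothesis Hf1 : forall x, H (f1 x).
Hypothesis Hf2 : forall x, H (f2 x).
Let v u := hdist2 (f1 u) (f2 u).
Hypothesis v_proj : forall u u', p u = p u' -> v u = v u'.

(** [Im w] is [log (r / |z|)]. The triangle inequality along [f1 (Phi w)], [a1], [a2], [f2 (Phi w)]
    multiplies two factors linear in [Im w]. The height [3] ensures [hdist2 w i >= 1]. *)
Lemma v_growth : exists2 K : R, 0 < K & forall w, 3 <= Im w -> 0 <= Re w <= pi *+ 2 ->
  v (Phi w) <= K * Im w ^+ 2.
Proof.
have [N1 N1_gt0 h1] := Phi_growth hf1 Hf1.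
have [N2 N2_gt0 h2] := Phi_growth hf2 Hf2.
pose a1 := f1 (Phi i0); pose a2 := f2 (Phi i0).
have [Ha1 Ha2] : H a1 /\ H a2 by split; [exact: Hf1|exact: Hf2].
(* [P] bounds [(Re w)^2] in the strip, and [M] is the coefficient from [sqr_sub1_le]. *)
pose P : R := (pi *+ 2) ^+ 2; pose M := P + 5.
have M_gt0 : 0 < M by rewrite ltr_wpDl// sqr_ge0.
have D_gt0 : 0 < hdist2 a1 a2 + 2 by rewrite ltr_wpDl// hdist2_ge0.
exists (N1%:R * M * (hdist2 a1 a2 + 2) * (N2%:R * M)).
  by rewrite !mulr_gt0// ltr0n.
move=> w w3 hw; have T_gt0 : 0 < Im w by apply: lt_le_trans w3.
have hE : hdist2 w i0 = (Re w ^+ 2 + (Im w - 1) ^+ 2) / Im w.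
  by rewrite /hdist2 nc_sqr !(ReD, ImD, ReN, ImN)/= oppr0 addr0 mulr1.
have w1 : 1 <= hdist2 w i0.
  by rewrite hE ler_pdivlMr// mul1r le_sqr_sub1// sqr_ge0.
have wM : hdist2 w i0 + 4 <= M * Im w.
  rewrite hE -lerBrDr ler_pdivrMr//; apply: sqr_sub1_le => //; last exact: sqr_ge0.
  by move/andP: hw => [s0 s1]; rewrite lerXn2r ?nnegrE// mulrn_wge0// pi_ge0.
have g1 := le_trans (h1 _ T_gt0 w1) (ler_wpM2l (ler0n _ _) wM).
have g2 := le_trans (h2 _ T_gt0 w1) (ler_wpM2l (ler0n _ _) wM).
have HP1 := Hf1 (Phi w); have HP2 := Hf2 (Phi w).
have t1 := hdist2_triangle HP1 Ha1 HP2.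
have t2 := hdist2_triangle Ha1 Ha2 HP2.
rewrite [hdist2 a2 _]hdist2C in t2.
have d1 := hdist2_ge0 HP1 Ha1; have d2 := hdist2_ge0 HP2 Ha2.
have dd := hdist2_ge0 Ha1 HP2.
apply: (@le_trans _ _ (hdist2 (f1 (Phi w)) (f2 (Phi w)) + 2)); first by rewrite lerDl.
apply: (le_trans t1).
have -> : N1%:R * M * (hdist2 a1 a2 + 2) * (N2%:R * M) * Im w ^+ 2 =
  (N1%:R * (M * Im w)) * ((hdist2 a1 a2 + 2) * (N2%:R * (M * Im w))) by ring.
have le24 (x y : R) : x + 4 <= y -> x + 2 <= y by apply: le_trans; rewrite lerD2l ler_nat.
apply: ler_pM; [by rewrite addr_ge0|by rewrite addr_ge0|exact: le24|].
apply: (le_trans t2); apply: ler_wpM2l; [exact: ltW|exact: le24].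
Qed.

Let Z u := coord c (p u) - zq.

Lemma continuous_v u : {for u, continuous v}.
Proof. by apply: cont_hdist2 => //; exact: continuous_holomorphic. Qed.

Lemma continuous_ncZ u : dom c (p u) -> {for u, continuous (fun u => nc (Z u))}.
Proof.
move=> cu; apply: (@cont_comp X C R Z (fun z => nc z)); last exact: continuous_nc.
have cc : {for u, continuous (fun u => coord c (p u) : C)}.
  apply: (@cont_comp X Y C p (coord c)); first exact: (covering_continuous hp).
  exact: continuous_coord.
by refine (@contD _ X (fun u => coord c (p u)) (fun=> - zq) u cc _); exact: cont_cst.
Qed.

(* [p] is open, so [Z] takes values of larger modulus near any point. *)
Lemma ncZ_not_locally_const w : H w ->
  ~ \forall u \near Phi w, nc (Z u) = nc (Z (Phi w)).
Proof.
move=> Hw h; have := covering_open hp h => h'.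
move: (near_img (dom_Phi Hw)) (near_coordV (dom_Phi Hw) h').
rewrite coord_Phi// => n1 n2.
have /nbhsC[d d_gt0 hd] : \forall z \near (disc_exp w : C), nc (z - zq) = nc (disc_exp w - zq).
  move: n1 n2; apply: filterS2 => z /coordVP[cz zE] [u e pu].
  by move: e; rewrite /Z pu zE coord_Phi.
have rho_gt0 : 0 < nc (disc_exp w - zq) by rewrite nc_gt0 disc_exp_neq.
pose t := d / (2 * nc (disc_exp w - zq)).
have t_gt0 : 0 < t by rewrite divr_gt0// mulr_gt0.
have := hd (disc_exp w + t%:C * (disc_exp w - zq)).
rewrite addrC addKr Normc.normcM nc_real gtr0_norm//.
have -> : t * nc (disc_exp w - zq) = d / 2 by rewrite /t; field; rewrite gt_eqF.
rewrite ltr_pdivrMr// ltr_pMr// ltr1n => /(_ isT).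
have -> : disc_exp w + t%:C * (disc_exp w - zq) - zq = (1 + t)%:C * (disc_exp w - zq).
  by rewrite rmorphD/= mulrDl mul1r addrAC.
rewrite Normc.normcM nc_real gtr0_norm ?addr_gt0// => /eqP.
by rewrite -subr_eq0 -{2}[nc _]mul1r -mulrBl addrAC subrr add0r mulf_eq0 !gt_eqF.
Qed.

(* Up to a constant factor, [v^n |Z|^2] read through [Phi]. *)
Let g (n : nat) (w : C) : R := v (Phi w) ^+ n * expR (- (2 * Im w)).

Lemma continuous_vPhi (w : C) : H w -> {for w, continuous (fun w : C => v (Phi w))}.
Proof.
move=> Hw; apply: (@cont_comp C X R Phi v); first exact: cPhi.
exact: continuous_v.
Qed.

Lemma continuous_g n w : H w -> {for w, continuous (g n)}.
Proof.
move=> Hw; have cv := continuous_vPhi Hw.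
have c1 : {for w, continuous (fun w : C => - (2 * Im w))}.
  apply: (@contN R C (fun w => 2 * Im w)).
  by apply: (@contM R C (fun=> 2) (fun w => Im w)); [exact: cont_cst|exact: continuous_Im].
have c2 : {for w, continuous (fun w : C => expR (- (2 * Im w)))}.
  by apply: (@cont_comp C R R (fun w => - (2 * Im w)) expR) => //; exact: continuous_expR.
exact: (@contM R C (fun w => v (Phi w) ^+ n) _ w (@contX R C _ n w cv) c2).
Qed.

Lemma compact_rectangle (a b x y : R) :
  compact ((fun q : R * R => q.1 +i* q.2 : C) @` (`[a, b] `*` `[x, y])).
Proof.
apply: continuous_compact; last by apply: compact_setX; exact: segment_compact.
by apply: continuous_subspaceT => q; apply: continuous_Complex; [exact: cvg_fst|exact: cvg_snd].
Qed.

(** At such a point [v^n |Z|^2] would have a local maximum on [X], forcing [|Z|] to be locally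
    constant. Here [Re w] may be an end of the strip: vertical sides do not count as boundary. *)
Lemma g_no_interior_max n w (T : R) : (0 < n)%N -> 3 < Im w -> Im w < T -> 0 < g n w ->
  (forall w', 3 < Im w' < T -> 0 <= Re w' <= pi *+ 2 -> g n w' <= g n w) -> False.
Proof.
move=> n_gt0 w3 wT gw gmax.
have Hw : H w by apply: lt_trans w3.
apply: (ncZ_not_locally_const Hw); set u := Phi w.
have cu : dom c (p u) by exact: dom_Phi.
have [d ad du] := atlas_cover u.
have dZ : \forall z \near coord d u, cdiff (Z \o coordV d) z.
  move: (cdiff_proj ad du cu); apply: filterS => z hz.
  by apply: (@cdiffB _ (coord c \o p \o coordV d)) => //; exact: cdiff_cst.
have Zu : Z u != 0 by rewrite /Z coord_Phi// disc_exp_neq.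
have vu : 0 < v u ^+ n by move: gw; rewrite /g pmulr_lgt0 ?expR_gt0.
have f12 : f1 u != f2 u.
  rewrite -hdist2_gt0// -/(v u) lt_def hdist2_ge0// andbT.
  by apply: contraTneq vu => ->; rewrite expr0n gtn_eqF// ltxx.
have ZE w' : H w' -> nc (disc_exp w' - zq) ^+ 2 = r ^+ 2 * expR (- (2 * Im w')).
  move=> _; rewrite nc_disc_exp exprMn; congr (_ * _).
  by rewrite -expRM_natl; congr expR; rewrite mulrN.
suff : \forall x \near u, [/\ f1 x = f1 u, f2 x = f2 u & nc (Z x) = nc (Z u)].
  by apply: filterS => x [].
apply: (surface_local_max n_gt0 ad du hf1 hf2 dZ Hf1 Hf2 f12 Zu).
have ncu : \forall x \near u, dom c (p x).
  by apply: near_cont (near_dom cu); exact: (covering_continuous hp).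
have Zu' : nc (Z u) = r * expR (- Im w) by rewrite /Z coord_Phi// nc_disc_exp.
have nZ : \forall x \near u, r * expR (- T) < nc (Z x) /\ nc (Z x) < r * expR (- 3).
  have h1 : nbhs (nc (Z u)) [set x | r * expR (- T) < x].
    apply: open_nbhs_nbhs; split; first exact: open_gt.
    by rewrite /= Zu' ltr_pM2l// ltr_expR ltrN2.
  have h2 : nbhs (nc (Z u)) [set x | x < r * expR (- 3)].
    apply: open_nbhs_nbhs; split; first exact: open_lt.
    by rewrite /= Zu' ltr_pM2l// ltr_expR ltrN2.
  move: (near_cont (continuous_ncZ cu) h1) (near_cont (continuous_ncZ cu) h2).
  by apply: filterS2.
move: ncu nZ; apply: filterS2 => x cx [x1 x2].
have x0 : 0 < nc (coord c (p x) - zq) by apply: lt_trans x1; rewrite mulr_gt0// expR_gt0.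
(* A nearby point [x] is replaced by a point [Phi w'] of its fibre with [w'] in the fundamental
   strip; neither [v] nor [Z] changes. *)
have [w' [w'E hre _]] := disc_exp_surj x0.
have Zx : nc (Z x) = r * expR (- Im w') by rewrite /Z w'E nc_disc_exp.
have hT : 3 < Im w' < T.
  by move: x1 x2; rewrite Zx !ltr_pM2l// !ltr_expR !ltrN2 => -> ->.
have Hw' : H w' by case/andP: hT => h _; apply: lt_trans h.
have vx : v x = v (Phi w').
  by apply: v_proj; rewrite pPhi// -w'E coordK.
rewrite -/(v x) -/(v u) vx {1}/Z w'E ZE// /Z coord_Phi// ZE//.
rewrite mulrCA [leRHS]mulrCA ler_pM2l ?exprn_gt0//.
exact: gmax.
Qed.

(** The bound is the maximum of [v] over the segment [Im w = 3], which covers a circle around the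
    puncture. If [g n] exceeded its bound there, its maximum over a tall rectangle would lie neither
    on the bottom nor on the top, against [g_no_interior_max]. *)
Lemma puncture_bound : exists u', forall w, 3 <= Im w -> v (Phi w) <= v u'.
Proof.
have [K K_gt0 hK] := v_growth.
have pi2 : 0 <= pi *+ 2 :> R by rewrite mulrn_wge0// pi_ge0.
pose e (s : R) : C := s +i* 3.
have He s : H (e s) by rewrite /H/=.
have [|s0 s0in smax] := @EVT_max R (fun s => v (Phi (e s))) 0 (pi *+ 2) pi2.
  apply: continuous_subspaceT => s.
  apply: (@cont_comp R C R e (fun w => v (Phi w))); last exact: continuous_vPhi.
  by apply: continuous_Complex; [exact: cvg_id|exact: cont_cst].
pose m := v (Phi (e s0)); exists (Phi (e s0)); rewrite -/m.
have m_ge0 : 0 <= m by exact: hdist2_ge0.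
have v_ge0 u : 0 <= v u by exact: hdist2_ge0.
have main w : 3 <= Im w -> 0 <= Re w <= pi *+ 2 -> v (Phi w) <= m.
  (* The factor compares the weights [exp (- 2 Im w)] at [w] and at height [3]; it is independent of
     [n]. *)
  move=> w3 hw; apply: (@le_of_pow_le _ _ _ (expR (2 * Im w - 6))) => // n n_gt0.
  suff : g n w <= m ^+ n * expR (- 6).
    by rewrite /g expRN ler_pdivrMr ?expR_gt0// -mulrA -expRD addrC.
  rewrite leNgt; apply/negP => gw.
  have gw0 : 0 < g n w by apply: le_lt_trans gw; rewrite mulr_ge0 ?exprn_ge0 ?expR_ge0.
  (* The height is chosen so that by [v_growth] the values of [g n] on the top side are below
     [g n w]. *)
  have [T wT hT] := exp_decay (Im w) n K_gt0 gw0.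
  pose Q := (fun q : R * R => q.1 +i* q.2 : C) @` (`[0, pi *+ 2] `*` `[3, T]).
  have QP z : Q z <-> 0 <= Re z <= pi *+ 2 /\ 3 <= Im z <= T.
    split; first by move=> [[s t] [/= h1 h2] <-] /=; move: h1 h2; rewrite !in_itv.
    by move=> [h1 h2]; exists (Re z, Im z); [split; rewrite /= in_itv|case: (z)].
  have Qw : Q w by apply/QP; rewrite hw w3 (ltW wT).
  have [|z0] := @compact_EVT_max C R (g n) Q (ex_intro _ w Qw) (@compact_rectangle _ _ _ _).
    apply: continuous_in_subspaceT => z; rewrite inE => /QP[_ /andP[z3 _]].
    by apply: continuous_g; apply: lt_le_trans z3.
  rewrite inE => /QP[hz /andP[z3 zT]] zmax.
  have gz : g n w <= g n z0 by apply: zmax; rewrite inE.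
  have z3' : 3 < Im z0.
    rewrite lt_neqAle z3 andbT; apply/eqP => zE; move: gw; apply/negP; rewrite -leNgt.
    apply: (le_trans gz); rewrite /g -zE.
    have -> : - (2 * 3) = - 6 :> R by ring.
    rewrite ler_pM2r ?expR_gt0// lerXn2r ?nnegrE//.
    have -> : z0 = e (Re z0) by apply: complex_ext.
    by apply: smax; rewrite in_itv.
  have zT' : Im z0 < T.
    rewrite lt_neqAle zT andbT; apply/eqP => zE; move: hT; apply/negP; rewrite -leNgt.
    apply: (le_trans gz); rewrite /g zE ler_pM2r ?expR_gt0// lerXn2r ?nnegrE//.
      by rewrite mulr_ge0 ?sqr_ge0// ltW.
    by rewrite -zE; apply: hK.
  apply: (g_no_interior_max n_gt0 z3' zT'); first exact: lt_le_trans gz.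
  move=> w' /andP[h1 h2] h3; apply: zmax; rewrite inE; apply/QP; split => //.
  by rewrite !ltW.
move=> w w3; have Hw : H w by apply: lt_le_trans w3.
have := disc_exp_in Hw => /andP[d0 _].
have [w' [w'E hre him]] := disc_exp_surj d0.
have imE : Im w' = Im w.
  by rewrite him nc_disc_exp mulrC mulKf ?gt_eqF// expRK opprK.
have -> : v (Phi w) = v (Phi w').
  by apply: v_proj; rewrite !pPhi// ?w'E// /H/= imE.
by apply: main => //; rewrite imE.
Qed.

End PuncturedDisc.

(** * Uniqueness of equivariant maps *)

Section Uniqueness.
Context {R : realType} {Y X : riemann_surface R} {A : set Y} {p : X -> Y}.
Local Notation C := (R[i]^o).
Local Notation nc := Normc.normc.
Local Notation H := (@upper_half_plane R).

Lemma equivariant_hdist2 (x0 : Y) (xt0 : X) (rho : pi1 R A x0 -> autH R) (f1 f2 : X -> C) :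
  universal_cover A p -> p xt0 = x0 ->
  equivariant_holomorphic_to_H p xt0 rho f1 ->
  equivariant_holomorphic_to_H p xt0 rho f2 ->
  forall u u', p u = p u' -> hdist2 (f1 u) (f2 u) = hdist2 (f1 u') (f2 u').
Proof.
move=> [sc hp _] px0 [Hf1 _ _ e1] [Hf2 _ _ e2] u u' uu'.
have [g dg <-] := deck_transformation_exists hp sc uu'.
have [gam act] := acts_by_exists hp sc px0 dg.
by rewrite (e1 _ _ act) (e2 _ _ act) autH_hdist2.
Qed.

Lemma near_puncture (q : Y) : finite_set (~` A) -> \forall y \near q, A y \/ y = q.
Proof.
move=> finA; pose B := ~` A `&` ~` [set q].
have clB : closed B.
  have /accessible_finite_set_closed cl : accessible_space Y.
    exact/hausdorff_accessible/surface_hausdorff.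
  by apply: cl; apply: sub_finite_set finA => y [].
have : nbhs q (~` B) by apply: open_nbhs_nbhs; split; [exact: closed_openC|by move=> [_ []]].
apply: filterS => y nB; have [Ay|nAy] := pselect (A y); [by left|right].
by apply: contrapT => yq; apply: nB.
Qed.

Section Maximum.
Variables (f1 f2 : X -> C).
Hypothesis finA : finite_set (~` A).
Hypothesis hp : covering_of A p.
Hypothesis holp : holomorphic_map p.
Hypothesis hf1 : holomorphic_fun [set: X] f1.
Hypothesis hf2 : holomorphic_fun [set: X] f2.
Hypothesis Hf1 : forall x, H (f1 x).
Hypothesis Hf2 : forall x, H (f2 x).
Let v u := hdist2 (f1 u) (f2 u).
Hypothesis v_proj : forall u u', p u = p u' -> v u = v u'.

(** The neighbourhood is the disc of radius [r exp (-3)], whose points other than [q] come from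
    [Im w >= 3]; the fibre over [q] itself is empty. *)
Lemma puncture_sup (q : Y) : ~ A q ->
  exists u', \forall y \near q, forall u, p u = y -> v u <= v u'.
Proof.
move=> nAq; have [c ac cq] := atlas_cover q; pose zq := coord c q.
move: (near_img cq) (near_coordV cq (near_puncture q finA)) => /nbhsC[r1 r1_gt0 h1] /nbhsC[r2 r2_gt0 h2].
pose r := Num.min r1 r2; have r_gt0 : 0 < r by rewrite lt_min r1_gt0.
have discA (z : C) : 0 < nc (z - zq) < r -> (coord c @` dom c) z /\ A (coordV c z).
  rewrite nc_gt0 subr_eq0 lt_min => /and3P[zq' z1 z2]; have iz := h1 _ z1; split=> //.
  have [//|e] := h2 _ z2; move: zq'; rewrite /zq -e.
  by have [_ ->] := coordVP iz; rewrite eqxx.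
have [Phi [cPhi pPhi]] := disc_lift hp r_gt0 discA.
have [u' hu'] := puncture_bound hp holp ac r_gt0 discA cPhi pPhi hf1 hf2 Hf1 Hf2 v_proj.
exists u'.
have e3 : 0 < r * expR (- 3) by rewrite mulr_gt0// expR_gt0.
have nq : \forall z \near coord c q, nc (z - zq) < r * expR (- 3).
  by apply/nbhsC; exists (r * expR (- 3)).
apply: (near_chart cq) nq => y cy y3 u pu.
have Ay : A y by rewrite -pu; exact: (covering_range hp).
have y0 : 0 < nc (coord c y - zq).
  rewrite nc_gt0 subr_eq0; apply: contra_notN nAq => /eqP e.
  by rewrite -(coordK cq) -/zq -e coordK.
have [w [wE _ imw]] := disc_exp_surj r_gt0 y0.
have w3 : 3 <= complex.Im w.
  rewrite imw lerNr -ler_expR lnK ?posrE ?divr_gt0// ler_pdivrMr// mulrC.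
  exact: ltW.
have -> : v u = v (Phi w); last exact: hu'.
apply: v_proj; rewrite pu pPhi -?wE ?coordK//.
by apply: lt_le_trans w3.
Qed.

(** If there were no maximum, every point of [Y] would have a neighbourhood over which [v] is at
    most some value taken by [v]: at a puncture by [puncture_sup], elsewhere by continuity and a
    larger value. Compactness makes one value serve for all. *)
Lemma v_max (u0 : X) : compact [set: Y] -> exists us, forall u, v u <= v us.
Proof.
move=> cY; apply: contrapT => nomax.
have larger u : exists u', v u < v u'.
  apply: contrapT => nu; apply: nomax; exists u => u'; rewrite leNgt; apply/negP => h.
  by apply: nu; exists u'.
have cv u : {for u, continuous v}.
  by apply: cont_hdist2 => //; exact: continuous_holomorphic.
have local (y : Y) : exists u', \forall y' \near y, forall u, p u = y' -> v u <= v u'.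
  have [Ay|] := pselect (A y); last exact: puncture_sup.
  have [u _ pu] : range p y by case: hp => _ -> _.
  have [u' uu'] := larger u; exists u'; rewrite -pu.
  have nu : \forall x \near u, v x < v u'.
    have nv : nbhs (v u) [set t | t < v u'].
      by apply: open_nbhs_nbhs; split => //; exact: open_lt.
    exact: near_cont (cv u) nv.
  move: (covering_open hp nu); apply: filterS => y' [x xu' <-] u2 pu2.
  by rewrite (v_proj pu2) ltW.
(* The filter of superlevel sets of [v]: eventually along it means for all points with large enough
   [v], which replaces taking the largest of finitely many local bounds. *)
pose F : set_system X := [set S | exists u1, forall u, v u1 <= v u -> S u].
have FF : Filter F.
  split.
  - by exists u0.
  - move=> P Q [u1 h1] [u2 h2]; have [u12|u21] := leP (v u1) (v u2).
      by exists u2 => u h; split; [apply: h1; exact: le_trans h|exact: h2].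
    by exists u1 => u h; split; [exact: h1|apply: h2; exact: le_trans (ltW u21) h].
  - by move=> P Q PQ [u1 h1]; exists u1 => u /h1/PQ.
have /compact_near_coveringP/(_ X F (fun u y => forall x, p x = y -> v x <= v u) FF) := cY.
case.
  move=> y _; have [u' nu'] := local y.
  exists ([set y' | forall u, p u = y' -> v u <= v u'], [set u | v u' <= v u]) => /=.
    by split => //; exists u'.
  by move=> [y' u] [/= h1 h2] x /h1 h; exact: le_trans h2.
move=> us hus; apply: nomax; exists us => u.
by apply: (hus us (lexx _) (p u)).
Qed.

(** If the maximum of [v] is positive, the set where [(f1, f2)] takes its value at [us] is closed,
    and open by the local maximum principle with exponent [1] and [Z = 1]; connectedness then makes
    [f1] constant. *)
Lemma eq_of_bounded_sup (us : X) : (forall u, v u <= v us) -> nonconstant f1 -> f1 = f2.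
Proof.
move=> vmax [x1 [x2 nx]]; apply: contrapT => nf.
have vus : f1 us != f2 us.
  apply/negP => /eqP e; apply: nf; apply/funext => u; apply/eqP.
  rewrite -[_ == _]negbK -hdist2_gt0// -leNgt; apply: le_trans (vmax u) _.
  by rewrite /v e /hdist2 subrr Normc.normc0 expr0n mul0r.
pose E := [set u | f1 u = f1 us /\ f2 u = f2 us].
have oE : open E.
  rewrite openE => u [e1 e2]; have [c ac cu] := atlas_cover u.
  have dZ : \forall z \near coord c u, cdiff ((fun=> 1 : C) \o coordV c) z.
    by apply: filterE => z; exact: cdiff_cst.
  have f12 : f1 u != f2 u by rewrite e1 e2.
  have vu : \forall x \near u, hdist2 (f1 x) (f2 x) ^+ 1 * nc 1 ^+ 2 <=
      hdist2 (f1 u) (f2 u) ^+ 1 * nc 1 ^+ 2.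
    apply: filterE => x; rewrite !expr1 Normc.normc1 expr1n !mulr1 e1 e2.
    exact: vmax.
  have := surface_local_max (ltn0Sn 0) ac cu hf1 hf2 dZ Hf1 Hf2 f12 (oner_neq0 _) vu.
  by apply: filterS => x [x1E x2E _]; rewrite /E/= x1E x2E.
have clEf (f : X -> C) a : holomorphic_fun [set: X] f -> closed [set u | f u = a].
  move=> hf u clu; apply: contrapT => /eqP fa.
  have cfa : {for u, continuous (fun x => f x - a : C)}.
    have cf := continuous_holomorphic (u := u) hf.
    by refine (@contD _ X f (fun=> - a) u cf _); exact: cont_cst.
  have fa0 : f u - a != 0 by rewrite subr_eq0.
  have nfa := @cont_neq0 _ X (fun x => f x - a : C) u fa0 cfa.
  by have [x [/= xa]] := clu _ nfa; rewrite xa subrr eqxx.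
have clE : closed E by apply: closedI; exact: clEf.
have ET : E = setT.
  apply: (@surface_connected R X); first by exists us.
    by exists E => //; rewrite setTI.
  by exists E => //; rewrite setTI.
apply: nx; have : E x1 /\ E x2 by rewrite ET.
by move=> [[-> _] [-> _]].
Qed.

End Maximum.
End Uniqueness.

Unset Implicit Arguments.

Theorem theorem5p10 (R : realType)
  (C : riemann_surface R) (hC : smooth_projective_curve C)
  (C0 : set C) (hC0 : finite_set (~` C0)) (x0 : C) (hx0 : C0 x0)
  (X : riemann_surface R) (p : X -> C) (hp : universal_cover C0 p)
  (xt0 : X) (hxt0 : p xt0 = x0)
  (rho : pi1 R C0 x0 -> autH R) (hrho : pi1_morphism rho)
  (f1 f2 : X -> R[i])
  (hf1 : equivariant_holomorphic_to_H p xt0 rho f1)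
  (hf2 : equivariant_holomorphic_to_H p xt0 rho f2) :
  f1 = f2.
Proof.
have v_proj := equivariant_hdist2 hp hxt0 hf1 hf2.
case: hC hp hf1 hf2 => cC _ [sc cov hol] [Hf1 h1 n1 _] [Hf2 h2 _ _].
have [us hus] := v_max hC0 cov hol h1 h2 Hf1 Hf2 v_proj xt0 cC.
exact: (eq_of_bounded_sup h1 h2 Hf1 Hf2 hus n1).
Qed.
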